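(* Let $\Sigma_0,\Sigma_1\in\mathcal S^+(n)$ and write $\Phi(\Sigma_i)=(S_i,\Delta_i)$ for $i=0,1$. The unique minimizing $g^{\mathrm{ext}}$-geodesic joining $\Sigma_0$ to $\Sigma_1$ is $$\gamma(t)=\Phi^{-1}\bigl((1-t)(S_0,\Delta_0)+t(S_1,\Delta_1)\bigr)=\exp\bigl(S_t+\mathcal D(S_t)+\Delta_t\bigr),$$ where $S_t=(1-t)S_0+tS_1$ and $\Delta_t=(1-t)\Delta_0+t\Delta_1$. Moreover, $$d_{g^{\mathrm{ext}}}(\Sigma_0,\Sigma_1)^2=\|S_1-S_0\|_F^2+\|\Delta_1-\Delta_0\|_F^2.$$ If $\Sigma_0,\Sigma_1\in\mathrm{Cor}^+(n)$ (so $\Delta_0=\Delta_1=0$), then $\gamma(t)\in\mathrm{Cor}^+(n)$ for all $t$: the inclusion $\mathrm{Cor}^+(n)\hookrightarrow(\mathcal S^+(n),g^{\mathrm{ext}})$ is totally geodesic.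
   Context: $\mathcal S(n)$ = real symmetric $n\times n$ matrices, $\mathcal S^+(n)$ = symmetric positive-definite ones, $\mathrm{Cor}^+(n)$ = matrices in $\mathcal S^+(n)$ with unit diagonal, $\mathrm{Hol}(n)$ = symmetric matrices with zero diagonal, $\mathrm{Diag}(n)$ = diagonal matrices. $\mathrm{Diag}(A)$ is the diagonal part of $A$, $\mathrm{off}(A)=A-\mathrm{Diag}(A)$; $\exp,\log$ are the matrix exponential and logarithm; $\|\cdot\|_F$ is the Frobenius norm. For each $S\in\mathcal S(n)$, $\mathcal D(S)\in\mathrm{Diag}(n)$ is the unique diagonal matrix with $\exp(S+\mathcal D(S))\in\mathrm{Cor}^+(n)$ (existence, uniqueness and smoothness of $\mathcal D$ are known). The map $\Phi:\mathcal S^+(n)\to\mathrm{Hol}(n)\oplus\mathrm{Diag}(n)$, $\Phi(\Sigma)=(\mathrm{off}(\log\Sigma),\mathrm{Diag}(\log\Sigma)-\mathcal D(\mathrm{off}(\log\Sigma)))$, is a diffeomorphism with inverse $\Phi^{-1}(S,\Delta)=\exp(S+\mathcal D(S)+\Delta)$, and $g^{\mathrm{ext}}=\Phi^*\langle\cdot,\cdot\rangle$ is the pullback of the constant metric $\langle(S,\Delta),(S',\Delta')\rangle=\mathrm{tr}(SS')+\mathrm{tr}(\Delta\Delta')$; $d_{g^{\mathrm{ext}}}$ is its geodesic distance. Geodesics are parametrized on $t\in[0,1]$. *)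

(* Defs.v *)
From HB Require Import structures.
From mathcomp Require Import all_boot all_order all_algebra.
From mathcomp Require Import all_classical all_reals all_analysis.

Set Implicit Arguments.
Unset Strict Implicit.
Unset Printing Implicit Defensive.

Import Order.TTheory GRing.Theory Num.Theory.
Import numFieldNormedType.Exports.

Local Open Scope ring_scope.
Local Open Scope classical_set_scope.

Section Riemannian.
(* Riemannian geometry of a metric g on U, where U is an open subset of a linear
   subspace T of V, so that T is the tangent space at every point of U and
   U has a global linear chart.  Curves are parametrized on [0, 1]; they are
   given as functions on R whose values outside [0, 1] are irrelevant. *)
Context {R : realType} {V : normedModType R}.
Implicit Types (U T N : set V) (g : V -> V -> V -> R) (c : R -> V).

Definition C1 c : Prop := (forall t, derivable c t 1) /\ continuous c^`().

Definition C2 c : Prop := (forall t, derivable c t 1) /\ C1 c^`().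

(* On each closed piece [s i, s i.+1] the curve coincides with a C1 function,
   i.e. it is C1 up to the end points of the piece. *)
Definition piecewise_C1 c : Prop :=
  exists (m : nat) (s : nat -> R),
    [/\ s 0%N = 0, s m = 1, forall i, (i < m)%N -> s i < s i.+1
      & forall i, (i < m)%N ->
          exists2 e : R -> V, C1 e & forall t, s i <= t <= s i.+1 -> c t = e t].

Definition admissible U c : Prop :=
  piecewise_C1 c /\ forall t, 0 <= t <= 1 -> U (c t).

Definition speed g c (t : R) : R := Num.sqrt (g (c t) (c^`() t) (c^`() t)).

(* The derivative may fail to exist at finitely many points only. *)
Definition riem_length g c : \bar R :=
  \int[lebesgue_measure]_(t in `[0, 1]) (speed g c t)%:E.

Definition riem_dist U g (x y : V) : \bar R :=
  ereal_inf [set riem_length g c | c in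
    [set c | [/\ admissible U c, c 0 = x & c 1 = y]]].

(* g (nabla_(c') c', w) for the Levi-Civita connection of g and a constant
   vector field w: by Koszul's formula the Christoffel symbols of the first
   kind in the linear chart give
   Gamma(v, v; w) = (D_v g)(v, w) - 1/2 (D_w g)(v, v). *)
Definition covariant_acceleration g c (t : R) (w : V) : R :=
  let p := c t in let v := c^`() t in
  g p (c^`(2) t) w + 'D_v (fun x => g x v w) p
    - 2^-1 * 'D_w (fun x => g x v v) p.

(* A C2 curve on [0, 1] (up to the end points) is the restriction of a C2
   function on R, hence the global C2 condition. *)
Definition geodesic U T g c : Prop :=
  C2 c /\ forall t, 0 <= t <= 1 ->
    U (c t) /\ forall w, T w -> covariant_acceleration g c t w = 0.

Definition minimizing_geodesic U T g c (x y : V) : Prop :=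
  [/\ geodesic U T g c, c 0 = x, c 1 = y & riem_length g c = riem_dist U g x y].

(* N is a submanifold of U, with constant tangent space TN: every geodesic of
   U which is tangent to N at some time stays in N. *)
Definition totally_geodesic U T g N (TN : set V) : Prop :=
  forall c, geodesic U T g c ->
    forall s, 0 <= s <= 1 -> N (c s) -> TN (c^`() s) ->
    forall t, 0 <= t <= 1 -> N (c t).

End Riemannian.

Section CorrelationMatrices.
Context {R : realType} {n : nat}.
Implicit Types A S Delta Sigma : 'M[R]_n.

Definition Sym : set 'M[R]_n := [set A | A^T = A].

Definition SPD : set 'M[R]_n :=
  [set A | Sym A /\ forall x : 'cV[R]_n, x != 0 -> 0 < (x^T *m A *m x) 0 0].

Definition Cor : set 'M[R]_n := [set A | SPD A /\ forall i, A i i = 1].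

Definition Hol : set 'M[R]_n := [set A | Sym A /\ forall i, A i i = 0].

Definition diagpart A : 'M[R]_n := diag_mx (\row_i A i i).

Definition off A : 'M[R]_n := A - diagpart A.

Definition frobenius A : R := Num.sqrt (\sum_i \sum_j A i j ^+ 2).

Definition expm A : 'M[R]_n :=
  limn (series (fun k : nat => k`!%:R^-1 *: A ^+ k)).

(* The inverse of the bijection expm : Sym -> SPD (0 off the image). *)
Definition logm : 'M[R]_n -> 'M[R]_n := 'pinv_(fun=> 0) Sym expm.

(* The diagonal matrix D such that expm (S + D) is a correlation matrix;
   it exists and is unique for S symmetric. *)
Definition calD S : 'M[R]_n :=
  xget 0 [set D : 'M[R]_n | is_diag_mx D /\ Cor (expm (S + D))].

Definition Phi Sigma : 'M[R]_n * 'M[R]_n :=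
  (off (logm Sigma), diagpart (logm Sigma) - calD (off (logm Sigma))).

(* The inverse of Phi on SPD (0 off the image). *)
Definition Phi_inv : 'M[R]_n * 'M[R]_n -> 'M[R]_n := 'pinv_(fun=> 0) SPD Phi.

Definition inner (p q : 'M[R]_n * 'M[R]_n) : R :=
  \tr (p.1 *m q.1) + \tr (p.2 *m q.2).

(* The pullback of inner by Phi.  Since SPD is open in Sym but not in 'M_n, the
   differential of Phi at Sigma is taken along tangent vectors A, B in Sym. *)
Definition gext Sigma A B : R := inner ('D_A Phi Sigma) ('D_B Phi Sigma).

End CorrelationMatrices.

(* Main.v *)
(* In the chart Phi the metric gext is the constant inner product, so its
   geodesics are the straight segments between points of the linear space
   HolDiag, and their length is the distance of the end points.

   The work lies in showing that Phi is a smooth chart.  The exponential is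
   C^k, with derivative read off the exponential of a block matrix; in
   eigenframes, tr ((e^X - e^Y) (X - Y)) dominates a positive multiple of
   tr ((X - Y)^2) on bounded sets, which gives injectivity, the lower bound on
   the derivative needed for the inverse function theorem, and uniqueness of
   calD.  Existence of calD comes from minimising tr (exp (S + D)) - tr D over
   diagonal D.  By Koszul's formula and the symmetry of second derivatives, the
   covariant acceleration of c paired with w is the inner product of
   (Phi o c)'' with the image of w, hence geodesics are affine in the chart.
   The length bound is Cauchy-Schwarz against Phi (c 1) - Phi (c 0) on each C1
   piece, with Cor being the slice where the second component vanishes. *)
Require Import Defs.
From HB Require Import structures.
From mathcomp Require Import all_boot all_order all_algebra.
From mathcomp Require Import all_classical all_reals all_analysis.
From mathcomp Require Import measurable_realfun.
From mathcomp Require Import ring lra.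

Import Order.TTheory GRing.Theory Num.Theory.
Import numFieldNormedType.Exports.

Set Implicit Arguments.
Unset Strict Implicit.
Unset Printing Implicit Defensive.
Local Open Scope ring_scope.
Local Open Scope classical_set_scope.

(** The two inverse maps behind [Phi], the logarithm and the diagonal correction, exist globally
    before any calculus: their injectivity and continuity come from trace inequalities. The inverse
    function theorem is thus needed only to pass regularity to an inverse already known to be
    continuous. Its hypothesis is a locally uniform lower bound c |v| <= |df v|, a quantitative
    injectivity that is inherited by the tangent map.

    [Phi] is meaningful on symmetric matrices, while differentials live on open subsets of 'M_n. It
    is extended through the symmetric part, and the two are compared along symmetric directions
    only. Curves are constrained on [0, 1] only, so symmetry of their velocities at the end points
    is read off one-sided limits. The acceleration is tested on symmetric vectors; that these reach
    all of [HolDiag] under the differential follows by differentiating the inverse chart along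
    lines. Admissible curves may lack a derivative at break points, so lengths are compared on open
    pieces. *)

Section Differential.
Context {R : realType}.
Implicit Types V W Z : normedModType R.

(** * Differentials through error bounds; maps of class C^k and their inverses *)

Lemma diff_near_norm V W (f : V -> W) x : differentiable f x ->
  forall e, 0 < e ->
  \forall h \near 0, `|f (h + x) - f x - 'd f x h| <= e * `|h|.
Proof.
move=> /diff_locally df e e0.
move/eqaddoP : df => /(_ e e0); apply: filterS => h /=.
by rewrite opprD -![(_ + _ : _ -> _) _]/(_ + _) -![(- _ : _ -> _) _]/(- _) addrA.
Qed.

Lemma is_diff_near_norm V W (f : V -> W) (df : V -> W) x :
  linear df -> continuous df ->
  (forall e, 0 < e ->
    \forall h \near 0, `|f (h + x) - f x - df h| <= e * `|h|) ->
  is_diff x f df.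
Proof.
move=> df_lin df_cont f_df.
pose dfM := GRing.isLinear.Build _ _ _ _ _ df_lin.
pose dfL : {linear V -> W} := HB.pack df dfM.
have flo : f \o shift x = cst (f x) + dfL +o_ (0 : V) id.
  apply/eqaddoP => e e0; apply: filterS (f_df e e0) => h /=.
  by rewrite opprD -![(_ + _ : _ -> _) _]/(_ + _) -![(- _ : _ -> _) _]/(- _) addrA.
have dE : 'd f x = dfL :> (V -> W) by exact: diff_unique.
by apply: DiffDef => //; apply/diff_locallyP; rewrite dE; split.
Qed.

Lemma near0_norm_le V (e : R) : 0 < e -> \forall x \near (0 : V), `|x| <= e.
Proof. by move=> e0; exact: nbhs0_le. Qed.

Lemma near_eq_is_diff V W (f g : V -> W) x (df : V -> W) :
  {near x, f =1 g} -> is_diff x f df -> is_diff x g df.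
Proof.
move=> fg [fx <-]; have fgx := nbhs_singleton fg.
apply: is_diff_near_norm; first exact: linearP.
  exact: diff_continuous.
move=> e e0; have := diff_near_norm fx e0.
have : \forall h \near 0, f (h + x) = g (h + x).
  by move: fg; rewrite (near_shift 0 x) subr0.
by apply: filterS2 => h /= <-; rewrite fgx.
Qed.

Lemma continuous_linear_bound V W (f : V -> W) :
  linear f -> (exists k, forall x, `|f x| <= k * `|x|) -> continuous f.
Proof.
move=> flin [k fk] x; apply/cvgrPdist_lt => e e0; near=> y.
have fB : f x - f y = f (x - y).
  pose fM := GRing.isLinear.Build _ _ _ _ _ flin.
  by rewrite -[f (x - y)]/((HB.pack f fM : {linear V -> W}) (x - y)) linearB.
rewrite fB (le_lt_trans (fk _))//.
have k1 : 0 < `|k| + 1 by rewrite ltr_pwDr.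
rewrite (@le_lt_trans _ _ ((`|k| + 1) * `|x - y|))//.
  by rewrite ler_wpM2r// (le_trans (ler_norm k))// lerDl.
rewrite -ltr_pdivlMl//; near: y.
by apply: cvgr_dist_lt => //; rewrite mulr_gt0 ?invr_gt0.
Unshelve. all: by end_near. Qed.

(* The derivative is taken as a map on the tangent bundle O x V, which avoids
   a norm on the space of linear maps. *)
Fixpoint Ck (k : nat) V W (O : set V) (f : V -> W) : Prop :=
  if k is k'.+1 then
    (forall x, O x -> differentiable f x) /\
    Ck k' (O `*` [set: V]) (fun p : V * V => 'd f (p.1) p.2)
  else forall x, O x -> {for x, continuous f}.

Lemma open_setXT V (O : set V) : open O -> open (O `*` [set: V]).
Proof.
move=> Oo; rewrite (_ : _ `*` _ = fst @^-1` O).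
  by apply: open_comp => // p _; exact: cvg_fst.
by apply/seteqP; split => p //= -[].
Qed.

Lemma Ck_subset k V W (O O' : set V) (f : V -> W) :
  O `<=` O' -> Ck k O' f -> Ck k O f.
Proof.
elim: k V W O O' f => [|k IH] V W O O' f OO' /=; first by move=> h x /OO'; exact: h.
move=> [fd fk]; split; first by move=> x /OO'; exact: fd.
by apply: IH fk => p [] /OO'.
Qed.

Lemma CkW k V W (O : set V) (f : V -> W) : Ck k.+1 O f -> Ck k O f.
Proof.
elim: k V W O f => [|k IH] V W O f.
  by move=> [fd _] x Ox; exact/differentiable_continuous/fd.
by move=> [fd fk]; split => //; exact: IH.
Qed.

Lemma Ck_eq k V W (O : set V) (f g : V -> W) : open O ->
  {in O, f =1 g} -> Ck k O f -> Ck k O g.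
Proof.
elim: k V W O f g => [|k IH] V W O f g Oo fg.
  move=> fc x Ox; have fgx : {near x, f =1 g}.
    by apply: filterS (open_nbhs_nbhs (conj Oo Ox)) => y /mem_set; exact: fg.
  rewrite /prop_for /continuous_at -(fg x) ?inE//.
  apply: cvg_trans (fc x Ox); apply: near_eq_cvg.
  exact: fgx.
move=> [fd fk].
have fgd x : O x -> is_diff x g ('d f x).
  move=> Ox; apply: (@near_eq_is_diff _ _ f).
    by apply: filterS (open_nbhs_nbhs (conj Oo Ox)) => y /mem_set; exact: fg.
  by apply: differentiableP; exact: fd.
split=> [x Ox|]; first by have [] := fgd x Ox.
apply: (IH _ _ _ _ _ _ _ fk); first exact: open_setXT.
by move=> p /[1!inE] -[Op _]; have [_ ->] := fgd _ Op.
Qed.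

Lemma Ck_cst k V W (O : set V) (a : W) : Ck k O (cst a).
Proof.
elim: k V W O a => [|k IH] V W O a; first by move=> x _; exact: cst_continuous.
split=> [x _|]; first exact: differentiable_cst.
rewrite (_ : (fun p => _) = cst 0); first exact: IH.
by apply/funext => p; rewrite diff_cst.
Qed.

Lemma Ck_lin k V W (O : set V) (f : {linear V -> W}) :
  continuous f -> Ck k O f.
Proof.
elim: k V W O f => [|k IH] V W O f fc; first by move=> x _; exact: fc.
split=> [x _|]; first exact: linear_differentiable.
rewrite (_ : (fun p => _) = f \o snd); last first.
  by apply/funext => p; rewrite diff_lin.
apply: (IH _ _ _ (f \o @snd V V)) => p.
by apply: continuous_comp; [exact: cvg_snd|exact: fc].
Qed.

Lemma Ck_linear k V W (O : set V) (f : V -> W) :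
  linear f -> continuous f -> Ck k O f.
Proof.
move=> flin fc.
pose fM := GRing.isLinear.Build _ _ _ _ _ flin.
pose fL : {linear V -> W} := HB.pack f fM.
exact: (@Ck_lin k V W O fL).
Qed.

Lemma Ck_fst k V W (O : set (V * W)) : Ck k O fst.
Proof. by apply: Ck_lin => x; exact: cvg_fst. Qed.

Lemma Ck_snd k V W (O : set (V * W)) : Ck k O snd.
Proof. by apply: Ck_lin => x; exact: cvg_snd. Qed.

Lemma Ck_pair k V W Z (O : set V) (f : V -> W) (g : V -> Z) : open O ->
  Ck k O f -> Ck k O g -> Ck k O (fun x => (f x, g x)).
Proof.
elim: k V W Z O f g => [|k IH] V W Z O f g Oo.
  by move=> fc gc x Ox; apply: cvg_pair; [exact: fc|exact: gc].
move=> [fd fk] [gd gk]; split=> [x Ox|].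
  by apply: differentiable_pair; [exact: fd|exact: gd].
apply: (@Ck_eq _ _ _ _ (fun p : V * V => ('d f (p.1) p.2, 'd g (p.1) p.2))).
- exact: open_setXT.
- by move=> p /[1!inE] -[Op _]; rewrite diff_pair//; [exact: fd|exact: gd].
- by apply: IH => //; exact: open_setXT.
Qed.

Lemma Ck_comp k V W Z (O : set V) (O' : set W) (f : V -> W) (g : W -> Z) :
  open O -> (forall x, O x -> O' (f x)) ->
  Ck k O f -> Ck k O' g -> Ck k O (g \o f).
Proof.
elim: k V W Z O O' f g => [|k IH] V W Z O O' f g Oo OO'.
  by move=> fc gc x Ox; apply: continuous_comp; [exact: fc|exact/gc/OO'].
move=> fk1 [gd gk]; have [fd fk] := fk1.
split=> [x Ox|]; first by apply: differentiable_comp; [exact: fd|exact/gd/OO'].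
have Oo2 := open_setXT Oo.
have fk' : Ck k (O `*` [set: V]) (f \o fst).
  apply: (IH _ V _ _ O) => //; last exact: CkW.
  - by move=> p [].
  - exact: Ck_fst.
apply: (@Ck_eq _ _ _ _ ((fun q : W * W => 'd g (q.1) q.2) \o
   (fun p : V * V => (f p.1, 'd f (p.1) p.2)))) => //.
  move=> p /[1!inE] -[Op _] /=.
  by have -> := diff_comp (fd _ Op) (gd _ (OO' _ Op)).
apply: (IH _ _ _ _ (O' `*` [set: W])) => //.
  by move=> p [Op _]; split => //; exact: OO'.
exact: Ck_pair.
Qed.

(** With h the increment of [g], k = f (h + x) - f x = df h + o(h). The lower bound gives |h| <= (2
    / c) |k|, which turns o(h) into o(k), and bounds the inverse of df by 1 / c. *)
Lemma is_diff_inverse V W (f : V -> W) (g : W -> V) (y : W) (c : R) :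
  0 < c -> differentiable f (g y) ->
  (forall v, c * `|v| <= `|'d f (g y) v|) ->
  (forall w, exists v, 'd f (g y) v = w) ->
  {for y, continuous g} -> (\forall z \near y, f (g z) = z) ->
  differentiable g y /\ forall w, 'd f (g y) ('d g y w) = w.
Proof.
move=> c0 fd fc fsurj gc fgK.
set x := g y in fd fc fsurj gc *.
pose inv w := projT1 (cid (fsurj w)).
have invK w : 'd f x (inv w) = w by exact: (projT2 (cid (fsurj w))).
have inj u v : 'd f x u = 'd f x v -> u = v.
  move=> /eqP; rewrite -subr_eq0 -linearB => /eqP uv0.
  have := fc (u - v); rewrite uv0 normr0 pmulr_rle0// normr_le0 subr_eq0.
  by move/eqP.
have inv_lin : linear inv.
  by move=> a u v; apply: inj; rewrite linearP !invK.
have inv_bound w : `|inv w| <= c^-1 * `|w|.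
  by rewrite ler_pdivlMl// -[in leRHS](invK w).
have inv_cont : continuous inv.
  by apply: continuous_linear_bound => //; exists c^-1.
suff gd : is_diff y g inv.
  by split => [//|w]; rewrite diff_val invK.
apply: is_diff_near_norm => // e e0.
(* [c / 2] lets the remainder be absorbed into c |h|; the other term makes the final error factor 2
   eta / c^2 at most [e]. *)
pose eta := Num.min (c / 2) (e * c ^+ 2 / 2).
have eta0 : 0 < eta by rewrite lt_min !divr_gt0 ?mulr_gt0 ?exprn_gt0.
have fgK0 : \forall k \near (0 : W), f (g (k + y)) = k + y.
  by move: fgK; rewrite (near_shift 0 y) subr0.
have h0 : (fun k => g (k + y) - x) @ (0 : W) --> (0 : V).
  rewrite -(subrr x); apply: cvgB; last exact: cvg_cst.
  rewrite [X in _ --> X](_ : x = g (0 + y)); last by rewrite add0r.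
  apply: (@continuous_comp _ _ _ (fun k => k + y) g 0).
    by apply: cvgD; [exact: cvg_id|exact: cvg_cst].
  by rewrite add0r.
have fd' := h0 _ (diff_near_norm fd eta0).
near=> k.
set h := g (k + y) - x.
have fh : `|f (h + x) - f x - 'd f x h| <= eta * `|h|.
  by rewrite /h; near: k; exact: fd'.
have kE : f (h + x) - f x = k.
  by rewrite subrK (near fgK0 k)// (nbhs_singleton fgK) addrK.
rewrite kE in fh.
have hk : c / 2 * `|h| <= `|k|.
  have : c * `|h| <= `|k| + c / 2 * `|h|.
    rewrite (le_trans (fc h))// -lerBlDl.
    rewrite (le_trans (lerB_dist _ _))// distrC (le_trans fh)//.
    by rewrite ler_wpM2r// ge_min lexx.
  rewrite -lerBlDr -mulrBl; congr (_ * _ <= _).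
  by rewrite [X in X - _]splitr addrK.
have : c * `|h - inv k| <= eta * `|h|.
  by rewrite (le_trans (fc _))// linearB invK distrC.
rewrite -ler_pdivlMl// => hinv; apply: (le_trans hinv).
have : `|h| <= 2 / c * `|k|.
  by rewrite -ler_pdivrMl ?divr_gt0// invf_div.
rewrite -(ler_pM2l (_ : 0 < c^-1 * eta)) ?mulr_gt0 ?invr_gt0//.
move=> hbd; rewrite [leLHS]mulrA; apply: (le_trans hbd).
rewrite !mulrA ler_wpM2r//.
have : eta <= e * c ^+ 2 / 2 by rewrite ge_min lexx orbT.
have cV0 : 0 < c^-1 * (2 / c) by rewrite !mulr_gt0 ?invr_gt0.
move=> etale; rewrite (_ : c^-1 * eta * 2 / c = c^-1 * (2 / c) * eta).
  rewrite -(ler_pM2l cV0) in etale; apply: (le_trans etale).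
  rewrite le_eqVlt; apply/orP; left; apply/eqP.
  by field; rewrite gt_eqF.
by rewrite -!mulrA; congr (_ * _); rewrite mulrC -!mulrA.
Unshelve. all: by end_near. Qed.

Lemma Ck_continuous k V W (O : set V) (f : V -> W) : Ck k O f ->
  forall x, O x -> {for x, continuous f}.
Proof. by elim: k => // k IH /CkW/IH. Qed.

(** Continuity of dg at (y0, w0), with u0 = dg y0 w0: applying df at g p.1 to dg p.1 p.2 - u0 gives
    the residual p.2 - df u0, which tends to 0. Dividing by the lower bound takes a single constant
    for all points near g y0, hence the locally uniform hypothesis. *)
Lemma Ck1_inverse V W (f : V -> W) (g : W -> V) (O : set V) (O' : set W) :
  open O' -> (forall y, O' y -> O (g y)) ->
  (forall y, O' y -> f (g y) = y) ->
  (forall y, O' y -> {for y, continuous g}) ->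
  Ck 1 O f ->
  (forall x, O x -> exists2 c, 0 < c &
    \forall z \near x, forall v, c * `|v| <= `|'d f z v|) ->
  (forall x, O x -> forall w, exists v, 'd f x v = w) ->
  Ck 1 O' g /\ forall y, O' y -> forall w, 'd f (g y) ('d g y w) = w.
Proof.
move=> O'o gO fgK gc [fd fdc] fc fsurj.
have gd y : O' y ->
    differentiable g y /\ forall w, 'd f (g y) ('d g y w) = w.
  move=> O'y; have [c c0 /nbhs_singleton fcy] := fc _ (gO _ O'y).
  apply: (is_diff_inverse c0 (fd _ (gO _ O'y)) fcy) => //.
  - exact: fsurj (gO _ O'y).
  - exact: gc.
  - by apply: filterS (open_nbhs_nbhs (conj O'o O'y)) => z; exact: fgK.
split; last by move=> y /gd[].
split; first by move=> y /gd[].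
move=> [y0 w0] [/= O'y0 _].
set u0 := 'd g y0 w0.
have [_ /(_ w0) du0] := gd _ O'y0.
have [c c0 fcy] := fc _ (gO _ O'y0).
pose r (p : W * W) := p.2 - 'd f (g p.1) u0.
have r0 : r @ (y0, w0) --> (0 : W).
  rewrite -(subrr w0) -[X in _ --> _ - X]du0.
  apply: cvgB; first exact: (@cvg_snd _ _ (nbhs y0) (nbhs w0)).
  have := fdc (g y0, u0) (conj (gO _ O'y0) I).
  apply: (@continuous_comp _ _ _ (fun p : W * W => (g p.1, u0))
    (fun p : V * V => 'd f (p.1) p.2) (y0, w0)).
  apply: cvg_pair; last exact: cvg_cst.
  by apply: (@continuous_comp _ _ _ fst g (y0, w0));
    [exact: cvg_fst|exact: gc].
apply/cvgrPdist_lt => e e0; near=> p.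
have O'p : O' p.1.
  near: p; apply: (@cvg_fst _ _ (nbhs y0) (nbhs w0)).
  exact: open_nbhs_nbhs.
rewrite distrC -(ltr_pM2l c0).
have fcp : forall v, c * `|v| <= `|'d f (g p.1) v|.
  near: p.
  have gfst : {for (y0, w0), continuous (g \o fst : W * W -> V)}.
    by apply: continuous_comp; [exact: cvg_fst|exact: gc].
  exact: (gfst _ fcy).
apply: (le_lt_trans (fcp _)).
rewrite linearB /=; have [_ ->] := gd _ O'p.
near: p.
have : 0 < c * e by rewrite mulr_gt0.
move/cvgrPdist_lt : r0 => /[apply]; apply: filterS => p.
by rewrite sub0r normrN.
Unshelve. all: by end_near. Qed.

(** The tangent map is linear along the fibre, so its difference quotients in a vertical direction
    are constant. *)
Lemma diff_tangent_vertical V W (f : V -> W) (p : V * V) (b : V) :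
  differentiable (fun q : V * V => 'd f (q.1) q.2) p ->
  'd (fun q : V * V => 'd f (q.1) q.2) p (0, b) = 'd f (p.1) b.
Proof.
move=> Fd; rewrite -deriveE//.
apply: cvg_lim => //; apply: cvg_near_cst.
rewrite near_withinE; near=> h => h0 /=.
rewrite scaler0 add0r -linearB addrK linearZ /= scalerA mulVf// scale1r//.
Unshelve. all: by end_near. Qed.

(* By induction on k: the tangent map of g inverts the tangent map of f, whose
   differential is block triangular and inherits the lower bound. *)
Lemma Ck_inverse k V W (f : V -> W) (g : W -> V) (O : set V) (O' : set W) :
  open O -> open O' -> (forall y, O' y -> O (g y)) ->
  (forall y, O' y -> f (g y) = y) ->
  (forall y, O' y -> {for y, continuous g}) ->
  Ck k.+1 O f ->
  (forall x, O x -> exists2 c, 0 < c &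
    \forall z \near x, forall v, c * `|v| <= `|'d f z v|) ->
  (forall x, O x -> forall w, exists v, 'd f x v = w) ->
  Ck k.+1 O' g.
Proof.
elim: k V W f g O O' => [|k IH] V W f g O O' Oo O'o gO fgK gc fk fc fsurj.
  by have [] := Ck1_inverse O'o gO fgK gc fk fc fsurj.
have fk1 : Ck k.+1 O f by exact: CkW.
have f1 : Ck 1 O f by have [fd /Ck_continuous] := fk1.
have [[gd gdc] dgK] := Ck1_inverse O'o gO fgK gc f1 fc fsurj.
have [fd Fk] := fk.
split=> //.
pose F (p : V * V) := 'd f (p.1) p.2.
pose G (q : W * W) := 'd g (q.1) q.2.
pose Tf (p : V * V) := (f p.1, F p).
pose Tg (q : W * W) := (g q.1, G q).
have OTo := open_setXT Oo; have O'To := open_setXT O'o.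
have [Fd /Ck_continuous dFc] := Fk.
have Tfk : Ck k.+1 (O `*` [set: V]) Tf.
  have fstk : Ck k.+1 (O `*` [set: V]) (f \o fst).
    by apply: (Ck_comp OTo _ _ fk1) => [p []//|]; exact: Ck_fst.
  exact: (Ck_pair OTo fstk Fk).
have dTf p a b : (O `*` [set: V]) p ->
    'd Tf p (a, b) = ('d f (p.1) a, 'd F p (a, 0) + 'd f (p.1) b).
  move=> Op; have Fdp := Fd p Op.
  have ffd : is_diff p (f \o fst) ('d f (p.1) \o fst).
    apply: is_diff_comp; last by apply: differentiableP; apply: fd; case: Op.
    have fstc : continuous (@fst V V) by move=> x; exact: cvg_fst.
    by apply: DiffDef; [exact: linear_differentiable|rewrite diff_lin].
  have [ffd1 ffd2] := ffd.
  rewrite (diff_pair ffd1 Fdp) ffd2 /=; congr (_, _).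
  rewrite -(diff_tangent_vertical b Fdp) -linearD/=.
  by congr ('d _ _ _); congr (_, _); rewrite /= ?addr0 ?add0r.
suff : Ck k.+1 (O' `*` [set: W]) Tg.
  move=> Tgk; apply: (@Ck_comp _ _ _ _ _ setT Tg snd) => //.
  exact: Ck_snd.
apply: (IH _ _ Tf Tg (O `*` [set: V])) => //.
- by move=> q [ O'q _]; split => //=; exact: gO.
- move=> [y w] [/= O'y _]; rewrite /Tf /Tg /F /G /=.
  by rewrite fgK// dgK.
- move=> q O'q; apply: cvg_pair; last exact: gdc.
  apply: (@continuous_comp _ _ _ fst g q); first exact: cvg_fst.
  by apply: gc; case: O'q.
- move=> p0 Op0; have [c c0 fcp] := fc p0.1 Op0.1.
  (* Continuity of dF at (p0, 0) bounds |dF p q| by 1 for q small and p near p0; rescaling q turns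
     this into an operator bound uniform in p. *)
  have : \forall q \near (p0, 0 : V * V), `|'d F (q.1) q.2| < 1.
    have := dFc (p0, 0) (conj Op0 I).
    move=> /cvgrPdist_lt/(_ _ ltr01); apply: filterS => q /=.
    by rewrite linear0 sub0r normrN.
  move=> [[A B] /= [Ap0 /nbhs_ballP[d /= d0 dB]] AB].
  (* The price of removing the mixed term dF p (a, 0) from the second component when b is
     estimated. *)
  pose K := c^-1 * (2 / d) + 1.
  have K0 : 0 < K by rewrite ltr_wpDl// !mulr_ge0 ?invr_ge0// ltW.
  have K1 : 1 <= K by rewrite lerDr !mulr_ge0 ?invr_ge0// ltW.
  exists (c / K); first by rewrite divr_gt0.
  near=> p => -[a b].
  have Op : (O `*` [set: V]) p.
    by near: p; exact: open_nbhs_nbhs.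
  have cp v : c * `|v| <= `|'d f (p.1) v|.
    by move: v; near: p; exact: (cvg_fst fcp).
  have Fa : `|'d F p (a, 0)| <= 2 / d * `|a|.
    have [->|a0] := eqVneq a 0.
      by rewrite -[X in 'd F p X]/(0 : V * V) linear0 !normr0 mulr0.
    pose t := d / 2 / `|a|.
    have t0 : 0 < t by rewrite !divr_gt0// normr_gt0.
    have : `|'d F p (t *: (a, 0))| < 1.
      apply: (AB (p, t *: (a, 0))); split => /=; first by near: p.
      apply: dB; rewrite -ball_normE /= sub0r normrN normrZ.
      rewrite gtr0_norm// prod_normE /= normr0 max_l//.
      by rewrite divfK ?normr_eq0// ltr_pdivrMr// ltr_pMr// ltr1n.
    rewrite linearZ normrZ gtr0_norm// -ltr_pdivlMl// mulr1 => /ltW.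
    by rewrite !invf_div mulrC.
  rewrite dTf// !prod_normE /= maxr_pMr ?divr_ge0 ?(ltW c0) ?(ltW K0)//.
  set N := Num.max `|'d f (p.1) a| _.
  have Na : c * `|a| <= N by rewrite (le_trans (cp a))// le_max lexx.
  have Nb : c * `|b| <= N * K.
    have : `|'d F p (a, 0) + 'd f (p.1) b| <= N by rewrite le_max lexx orbT.
    move=> Nab; apply: (le_trans (cp b)).
    rewrite -[X in `|X|](addKr ('d F p (a, 0))).
    rewrite (le_trans (ler_normD _ _))// normrN mulrDr mulr1 lerD//.
    apply: (le_trans Fa).
    rewrite [leRHS](_ : _ = 2 / d * (N / c)); last by rewrite mulrA mulrC.
    rewrite ler_wpM2l ?divr_ge0 ?(ltW d0)//.
    by rewrite ler_pdivlMr// mulrC.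
  have cK x : (c / K * x <= N) = (c * x <= N * K).
    by rewrite mulrAC ler_pdivrMr.
  rewrite ge_max !cK Nb andbT.
  by rewrite (le_trans Na)// ler_peMr// le_max normr_ge0.
- move=> p Op [w1 w2].
  have [a da] := fsurj _ Op.1 w1.
  have [b db] := fsurj _ Op.1 (w2 - 'd F p (a, 0)).
  by exists (a, b); rewrite dTf// da db addrC subrK.
Unshelve. all: by end_near. Qed.

End Differential.

(** * The entrywise maximum norm on matrices *)

Section MatrixNorm.
Context {R : realType}.

Lemma mx_norm_entry m n (A : 'M[R]_(m, n)) i j : `|A i j| <= `|A|.
Proof.
rewrite [leRHS]/Num.norm/= mx_normrE.
exact: (le_bigmax _ (fun ij : 'I_m * 'I_n => `|A ij.1 ij.2|) (i, j)).
Qed.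

Lemma mx_norm_le m n (A : 'M[R]_(m, n)) k :
  0 <= k -> (forall i j, `|A i j| <= k) -> `|A| <= k.
Proof.
by move=> k0 Ak; rewrite [leLHS]/Num.norm/= mx_normrE bigmax_le// => -[i j] _; exact: Ak.
Qed.

Lemma mulmx_norm m n p (A : 'M[R]_(m, n)) (B : 'M[R]_(n, p)) :
  `|A *m B| <= n%:R * `|A| * `|B|.
Proof.
apply: mx_norm_le => [|i j]; first by rewrite !mulr_ge0.
rewrite mxE (le_trans (ler_norm_sum _ _ _))//.
rewrite (@le_trans _ _ (\sum_(k < n) `|A| * `|B|))//.
  by apply: ler_sum => k _; rewrite normrM ler_pM// mx_norm_entry.
by rewrite sumr_const card_ord -mulrA mulr_natl.
Qed.

Lemma scalar_mx1_norm n : `|1%:M : 'M[R]_n| <= 1.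
Proof.
apply: mx_norm_le => // i j; rewrite mxE.
by case: eqP => _; rewrite ?normr1 ?normr0.
Qed.

Lemma exprmx_norm n (A : 'M[R]_n) k : `|A ^+ k| <= (n%:R * `|A|) ^+ k.
Proof.
elim: k => [|k IH]; first by rewrite !expr0 scalar_mx1_norm.
rewrite !exprS (le_trans (mulmx_norm _ _))// ler_wpM2l//.
Qed.

Lemma mx_linear_continuous m n (W : normedModType R) (f : 'M[R]_(m, n) -> W) :
  linear f -> continuous f.
Proof.
move=> flin; apply: continuous_linear_bound => //.
exists (\sum_i \sum_j `|f (delta_mx i j)|) => x.
pose fM := GRing.isLinear.Build _ _ _ _ _ flin.
pose fL : {linear 'M[R]_(m, n) -> W} := HB.pack f fM.
rewrite -[f]/(fL : _ -> _) {1}(matrix_sum_delta x) linear_sum.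
rewrite (le_trans (ler_norm_sum _ _ _))// mulr_suml ler_sum// => i _.
rewrite linear_sum (le_trans (ler_norm_sum _ _ _))// mulr_suml ler_sum// => j _.
by rewrite linearZ normrZ mulrC ler_wpM2l// mx_norm_entry.
Qed.

Lemma Ck_mx_linear k m n (W : normedModType R) O (f : 'M[R]_(m, n) -> W) :
  linear f -> Ck k O f.
Proof. by move=> flin; apply: Ck_linear => //; exact: mx_linear_continuous. Qed.

End MatrixNorm.

(** Completeness and norm together, for the absolute convergence of the exponential series. *)
HB.instance Definition _ (R : realType) m n := Complete.on 'M[R]_(m, n).

(** * Matrix exponential: convergence, Taylor remainder, smoothness *)

Section MatrixExponential.
Context {R : realType}.
Implicit Types n : nat.

Lemma is_cvg_expm n (A : 'M[R]_n) :
  cvgn (series (fun k : nat => k`!%:R^-1 *: A ^+ k)).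
Proof.
apply: normed_cvg; apply: series_le_cvg (is_cvg_series_exp_coeff (n%:R * `|A|)).
- by move=> k; exact: normr_ge0.
- by move=> k; rewrite /exp_coeff /= divr_ge0// exprn_ge0// mulr_ge0.
- move=> k /=; rewrite normrZ gtr0_norm ?invr_gt0 ?ltr0n ?fact_gt0//.
  by rewrite mulrC ler_wpM2r ?invr_ge0// exprmx_norm.
Qed.

Lemma expm_cvg n (A : 'M[R]_n) :
  series (fun k : nat => k`!%:R^-1 *: A ^+ k) @ \oo --> expm A.
Proof. exact: is_cvg_expm. Qed.

Lemma linear_expm_cvg n (W : normedModType R) (f : 'M[R]_n -> W)
    : linear f -> forall A : 'M[R]_n,
  (fun m : nat => \sum_(0 <= k < m) k`!%:R^-1 *: f (A ^+ k)) @ \oo --> f (expm A).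
Proof.
move=> flin A.
pose fM := GRing.isLinear.Build _ _ _ _ _ flin.
pose fL : {linear 'M[R]_n -> W} := HB.pack f fM.
have fc : continuous f by exact: mx_linear_continuous.
have := cvg_comp _ _ (@expm_cvg n A) (fc (expm A)).
apply: cvg_trans; apply: near_eq_cvg; near=> k.
rewrite /series /=.
rewrite -[f]/(fL : _ -> _) linear_sum; apply: eq_bigr => i _.
by rewrite linearZ.
Unshelve. all: by end_near. Qed.

(* dpow X H k is the upper right block of [[X, H], [0, X]] ^ k, the derivative
   of X ^ k in the direction H. *)
Fixpoint dpow n (X H : 'M[R]_n) k : 'M[R]_n :=
  if k is k'.+1 then X *m dpow X H k' + H *m X ^+ k' else 0.

Definition dexpm n (X H : 'M[R]_n) : 'M[R]_n :=
  ursubmx (expm (block_mx X H 0 X)).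

Lemma block_mx_pow n (X H : 'M[R]_n) k :
  block_mx X H 0 X ^+ k = block_mx (X ^+ k) (dpow X H k) 0 (X ^+ k).
Proof.
elim: k => [|k IH]; first by rewrite !expr0; exact: scalar_mx_block.
rewrite exprS IH -[LHS]/(_ *m _) mulmx_block !mul0mx !mulmx0 !addr0 add0r.
by rewrite !exprS.
Qed.

Lemma dexpm_cvg n (X H : 'M[R]_n) :
  (fun m : nat => \sum_(0 <= k < m) k`!%:R^-1 *: dpow X H k) @ \oo --> dexpm X H.
Proof.
have ur_lin : linear (@ursubmx R n n n n).
  by move=> a u v; apply/matrixP => i j; rewrite !mxE.
have := @linear_expm_cvg _ _ _ ur_lin (block_mx X H 0 X).
by under eq_fun do under eq_bigr do rewrite block_mx_pow block_mxKur.
Qed.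

Lemma dpow_linear n (X : 'M[R]_n) k : linear ((dpow X)^~ k).
Proof.
elim: k => [|k IH] a u v /=; first by rewrite scaler0 addr0.
rewrite IH mulmxDr mulmxDl -scalemxAr -scalemxAl scalerDr.
by rewrite addrACA.
Qed.

(** The maximum norm only satisfies |A B| <= n |A| |B|, so [r] dominates both [n] and n |X|. Each of
    the two terms of the recursion costs a factor [r], hence [2 * r]. *)
Lemma dpow_norm n (X H : 'M[R]_n) (r : R) k :
  1 <= r -> n%:R <= r -> n%:R * `|X| <= r ->
  `|dpow X H k| <= `|H| * (2 * r) ^+ k.
Proof.
move=> r1 nr Xr; have r0 : 0 <= r by exact: le_trans r1.
elim: k => [|k IH] /=; first by rewrite normr0 mulr_ge0.
rewrite (le_trans (ler_normD _ _))//.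
have H1 : `|X *m dpow X H k| <= r * (`|H| * (2 * r) ^+ k).
  by rewrite (le_trans (mulmx_norm _ _))// ler_pM// ?mulr_ge0.
have H2 : `|H *m X ^+ k| <= r * (`|H| * (2 * r) ^+ k).
  rewrite (le_trans (mulmx_norm _ _))// -mulrA ler_pM// ?mulr_ge0//.
  rewrite ler_wpM2l// (le_trans (exprmx_norm _ _))// lerXn2r ?nnegrE ?mulr_ge0//.
  by rewrite (le_trans Xr)// ler_peMl// ler1n.
rewrite (le_trans (lerD H1 H2))// exprS.
by rewrite le_eqVlt; apply/orP; left; apply/eqP; ring.
Qed.

(** The remainder obeys E_(k+1) = (H + X) E_k + H (dpow X H k), whose last term is quadratic in H by
    [dpow_norm]. Both terms are at most r |H|^2 (4 r)^k, within the factor 4 r gained at the next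
    step. *)
Lemma pow_taylor n (X H : 'M[R]_n) (r : R) k :
  1 <= r -> n%:R <= r -> n%:R * `|X| <= r -> n%:R * `|H + X| <= r ->
  `|(H + X) ^+ k - X ^+ k - dpow X H k| <= `|H| ^+ 2 * (4 * r) ^+ k.
Proof.
move=> r1 nr Xr XHr; have r0 : 0 <= r by exact: le_trans r1.
elim: k => [|k IH]; first by rewrite !expr0 subrr /= subr0 normr0 mulr_ge0.
have -> : (H + X) ^+ k.+1 - X ^+ k.+1 - dpow X H k.+1 =
    (H + X) *m ((H + X) ^+ k - X ^+ k - dpow X H k) + H *m dpow X H k.
  rewrite !exprS /= -![_ * _]/(_ *m _) !mulmxBr !mulmxDl.
  have mx_id (a b c d e : 'M[R]_n) :
      a - c - (e + b) = a - (b + c) - (d + e) + d.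
    rewrite !opprD !addrA [RHS]addrAC addrNK.
    by rewrite addrAC [in LHS](addrAC _ (- c)).
  exact: mx_id.
rewrite (le_trans (ler_normD _ _))//.
have H1 : `|(H + X) *m ((H + X) ^+ k - X ^+ k - dpow X H k)| <=
    r * (`|H| ^+ 2 * (4 * r) ^+ k).
  by rewrite (le_trans (mulmx_norm _ _))// ler_pM// ?mulr_ge0.
have H2 : `|H *m dpow X H k| <= r * (`|H| ^+ 2 * (4 * r) ^+ k).
  rewrite (le_trans (mulmx_norm _ _))// -mulrA ler_pM// ?mulr_ge0//.
  rewrite expr2 -mulrA ler_wpM2l// (le_trans (dpow_norm _ _ r1 nr Xr))//.
  rewrite ler_wpM2l// lerXn2r ?nnegrE ?mulr_ge0//.
  by rewrite ler_wpM2r// ler_nat.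
rewrite (le_trans (lerD H1 H2))// [(4 * r) ^+ k.+1]exprS.
rewrite -subr_ge0 [leRHS](_ : _ = 2 * (r * (`|H| ^+ 2 * (4 * r) ^+ k))).
  by rewrite !mulr_ge0 ?exprn_ge0 ?mulr_ge0.
by move: ((4 * r) ^+ k) => p; ring.
Qed.

Lemma dexpm_linear n (X : 'M[R]_n) : linear (dexpm X).
Proof.
move=> a u v; apply: (cvg_unique _ (@dexpm_cvg n X (a *: u + v))) => //.
apply: cvg_trans (cvgD (cvgZl_tmp (k := a) (@dexpm_cvg n X u)) (@dexpm_cvg n X v)).
apply: near_eq_cvg; near=> k => /=.
have sumE i : i`!%:R^-1 *: dpow X (a *: u + v) i =
    a *: (i`!%:R^-1 *: dpow X u i) + i`!%:R^-1 *: dpow X v i.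
  by rewrite dpow_linear scalerDr !scalerA mulrC.
by rewrite (eq_bigr _ (fun i _ => sumE i)) big_split /= -scaler_sumr.
Unshelve. all: by end_near. Qed.

Lemma expm_taylor n (X H : 'M[R]_n) (r : R) :
  1 <= r -> n%:R <= r -> n%:R * `|X| <= r -> n%:R * `|H + X| <= r ->
  `|expm (H + X) - expm X - dexpm X H| <= `|H| ^+ 2 * expR (4 * r).
Proof.
move=> r1 nr Xr XHr.
have id_lin : linear (@idfun 'M[R]_n) by [].
have c1 := cvgB (cvgB (@linear_expm_cvg _ _ _ id_lin (H + X)) (@linear_expm_cvg _ _ _ id_lin X))
  (@dexpm_cvg n X H).
have c2 := cvg_norm (c1 _ _).
apply: (cvgr_to_le (c2 _ _ _)).
near=> m.
rewrite [X in `|X|](_ : _ = \sum_(0 <= k < m)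
    k`!%:R^-1 *: ((H + X) ^+ k - X ^+ k - dpow X H k)); last first.
  by under [RHS]eq_bigr do rewrite !scalerBr; rewrite !sumrB.
rewrite (le_trans (ler_norm_sum _ _ _))//.
apply: (@le_trans _ _ (\sum_(0 <= k < m) `|H| ^+ 2 * exp_coeff (4 * r) k)).
  apply: ler_sum => k _.
  rewrite normrZ gtr0_norm ?invr_gt0 ?ltr0n ?fact_gt0//.
  rewrite /exp_coeff /= mulrA [leRHS]mulrC.
  rewrite ler_wpM2l ?invr_ge0//.
  exact: pow_taylor.
rewrite -mulr_sumr ler_wpM2l// ?exprn_ge0//.
apply: nondecreasing_cvgn_le; last exact: is_cvg_series_exp_coeff.
apply: nondecreasing_series => k _ _.
rewrite /exp_coeff /= divr_ge0// exprn_ge0// mulr_ge0//.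
by rewrite (le_trans _ r1).
Unshelve. all: by end_near. Qed.

Lemma is_diff_expm n (X : 'M[R]_n) : is_diff X (@expm R n) (dexpm X).
Proof.
apply: is_diff_near_norm; first exact: dexpm_linear.
  exact/mx_linear_continuous/dexpm_linear.
move=> e e0.
(* Large enough for [expm_taylor] at every H with |H| <= 1. *)
pose r : R := 1 + n%:R + n%:R * (`|X| + 1).
have r1 : 1 <= r by rewrite /r -addrA lerDl addr_ge0 ?mulr_ge0.
have nr : n%:R <= r by rewrite /r addrAC lerDr addr_ge0 ?mulr_ge0.
have Xr : n%:R * (`|X| + 1) <= r by rewrite /r lerDr addr_ge0.
near=> H.
have H1 : `|H| <= 1 by near: H; exact: (near0_norm_le 'M[R]_n ltr01).
apply: (le_trans (@expm_taylor _ _ _ r r1 nr _ _)).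
- by rewrite (le_trans _ Xr)// ler_wpM2l// lerDl.
- rewrite (le_trans _ Xr)// ler_wpM2l// (le_trans (ler_normD _ _))//.
  by rewrite addrC lerD2l.
- rewrite expr2 -mulrA mulrC ler_wpM2r// -ler_pdivlMr ?expR_gt0//.
  by near: H; apply: (@near0_norm_le R 'M[R]_n); rewrite divr_gt0 ?expR_gt0.
Unshelve. all: by end_near. Qed.

(** The tangent map is a linear image of the exponential in size n + n, so the induction on k runs
    over all matrix sizes at once. *)
Lemma Ck_expm k n O : Ck k O (@expm R n).
Proof.
suff : Ck k setT (@expm R n) by exact: Ck_subset.
elim: k n {O} => [|k IH] n.
  move=> X _; apply: differentiable_continuous.
  by have [] := is_diff_expm X.
split=> [X _|]; first by have [] := is_diff_expm X.
rewrite (_ : (fun p => _) = (fun p : 'M[R]_n * 'M[R]_n => dexpm p.1 p.2)); last first.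
  by apply/funext => p; have [_ ->] := is_diff_expm p.1.
have blin : linear (fun p : 'M[R]_n * 'M[R]_n => block_mx p.1 p.2 0 p.1).
  move=> a u v; rewrite scale_block_mx add_block_mx scaler0 addr0.
  by [].
have bcont : continuous (fun p : 'M[R]_n * 'M[R]_n => block_mx p.1 p.2 0 p.1).
  apply: continuous_linear_bound => //; exists 1 => p; rewrite mul1r.
  apply: mx_norm_le => // i j; rewrite prod_normE.
  rewrite !mxE; case: splitP => i' _; rewrite !mxE; case: splitP => j' _.
  - by rewrite le_max mx_norm_entry.
  - by rewrite le_max mx_norm_entry orbT.
  - by rewrite mxE normr0 le_max normr_ge0.
  - by rewrite le_max mx_norm_entry.
have ur_lin : linear (@ursubmx R n n n n).
  by move=> a u v; apply/matrixP => i j; rewrite !mxE.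
apply: (@Ck_comp _ _ _ _ _ _ setT _ (@ursubmx R n n n n)) => //.
- rewrite (_ : _ `*` _ = setT); first exact: openT.
  by apply/seteqP.
- apply: (@Ck_comp _ _ _ _ _ _ setT _ (@expm R (n + n))) => //.
    rewrite (_ : _ `*` _ = setT); first exact: openT.
    by apply/seteqP.
  exact: Ck_linear.
- exact: Ck_mx_linear.
Qed.

Lemma expm_continuous n : continuous (@expm R n).
Proof. by move=> X; apply: (@Ck_expm 0 n setT). Qed.

End MatrixExponential.

(** * Spectral theorem for real symmetric matrices *)

Section Spectral.
Context {R : realType}.

Lemma continuous_sum (T : topologicalType) (V : normedModType R) (I : Type)
    (r : seq I) (F : I -> T -> V) :
  (forall i, continuous (F i)) -> continuous (fun x => \sum_(i <- r) F i x).
Proof.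
move=> Fc; elim: r => [|i r IH] x.
  by under eq_fun do rewrite big_nil; exact: cvg_cst.
under eq_fun do rewrite big_cons.
by apply: cvgD; [exact: Fc|exact: IH].
Qed.

Lemma quadratic_form_continuous n (A : 'M[R]_n) :
  continuous (fun u : 'rV[R]_n => (u *m A *m u^T) 0 0 : R).
Proof.
rewrite (_ : (fun u => _) =
    (fun u : 'rV[R]_n => \sum_j (\sum_k u 0 k * A k j) * u 0 j)); last first.
  by apply/funext => u; rewrite mxE; apply: eq_bigr => j _; rewrite !mxE.
apply: (@continuous_sum _ R _ _
  (fun j (u : 'rV[R]_n) => (\sum_k u 0 k * A k j) * u 0 j)) => j x.
apply: continuousM; last exact: coord_continuous.
apply: (@continuous_sum _ R _ _ (fun k (u : 'rV[R]_n) => u 0 k * A k j)) => k y.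
by apply: continuousM; [exact: coord_continuous|exact: cst_continuous].
Qed.

Lemma row_sqr_norm n (u : 'rV[R]_n) : (u *m u^T) 0 0 = \sum_j u 0 j ^+ 2.
Proof. by rewrite mxE; apply: eq_bigr => j _; rewrite mxE expr2. Qed.

Lemma row_sqr_norm_gt0 n (u : 'rV[R]_n) : u != 0 -> 0 < (u *m u^T) 0 0.
Proof.
move=> u0; rewrite row_sqr_norm lt_neqAle sumr_ge0 ?andbT; last first.
  by move=> j _; exact: sqr_ge0.
apply: contra u0 => /eqP/esym/psumr_eq0P => h; apply/eqP/rowP => j.
rewrite mxE; apply/eqP; rewrite -sqrf_eq0; apply/eqP/h => // k _.
exact: sqr_ge0.
Qed.

(** The first-order condition at a minimum, tested at t = - p / (q + 1), where the value is - p^2 (q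
    + 2) / (q + 1)^2. The shift by 1 covers q = 0. *)
Lemma quadratic_ge0_linear_coef (p q : R) :
  (forall t : R, 0 <= 2 * t * p + t ^+ 2 * q) -> p = 0.
Proof.
move=> h; have q0 : 0 <= q by have := h 1; have := h (-1); nra.
have q1 : q + 1 != 0 by rewrite gt_eqF// ltr_wpDl.
have q2 : 0 < (q + 1) ^+ 2 by rewrite exprn_gt0// ltr_wpDl.
have := h (- p / (q + 1)).
rewrite (_ : _ + _ = - (p ^+ 2 * (q + 2)) / (q + 1) ^+ 2); last by field.
rewrite pmulr_lge0 ?invr_gt0// oppr_ge0 pmulr_lle0; last by rewrite ltr_wpDl.
by rewrite le_eqVlt ltNge sqr_ge0 orbF sqrf_eq0 => /eqP.
Qed.

(* Rayleigh: a maximiser of the quadratic form on the unit sphere is an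
   eigenvector. *)
Lemma sym_eigenvector n (A : 'M[R]_n.+1) : A^T = A ->
  exists (l : R) (u : 'rV[R]_n.+1), u *m u^T = 1%:M /\ u *m A = l *: u.
Proof.
move=> As.
(* The identity matrix is written out so that the sphere is a level set of a form covered by
   [quadratic_form_continuous]. *)
pose S := [set u : 'rV[R]_n.+1 | (u *m 1%:M *m u^T) 0 0 = 1].
have S0 : S !=set0.
  exists (delta_mx 0 0); rewrite /S /= mulmx1 row_sqr_norm (bigD1 ord0)//=.
  rewrite big1; first by rewrite mxE !eqxx expr1n addr0.
  by move=> j j0; rewrite mxE (negbTE j0) andbF expr0n.
have Scompact : compact S.
  apply: bounded_closed_compact; last first.
    rewrite (_ : S = (fun u : 'rV[R]_n.+1 => (u *m 1%:M *m u^T) 0 0) @^-1` [set 1])//.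
    by apply: preimage_closed => [x _|]; [exact: quadratic_form_continuous|exact: closed_eq].
  exists 1; split; first exact: num_real.
  move=> M M1 u; rewrite /S /= mulmx1 row_sqr_norm => u1.
  apply: le_trans (ltW M1).
  apply: mx_norm_le => // i j; rewrite ord1.
  rewrite -[leRHS](@sqrtr1 R) -sqrtr_sqr ler_wsqrtr// -u1 (bigD1 j)//= lerDl.
  by apply: sumr_ge0 => k _; exact: sqr_ge0.
have [u /set_mem uS umax] := EVT_max_rV S0 Scompact
  (continuous_subspaceT (@quadratic_form_continuous _ A)).
pose l := (u *m A *m u^T) 0 0.
have uu : u *m u^T = 1%:M.
  by rewrite [LHS]mx11_scalar; congr (_%:M); rewrite -[RHS]uS mulmx1.
exists l, u; split=> //.
(* By maximality the form of [B] is nonnegative, and it vanishes at u. Its variation in every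
   direction w therefore vanishes at u, which puts u in the kernel of [B]. *)
pose B := l%:M - A.
pose b (x y : 'rV[R]_n.+1) := (x *m B *m y^T) 0 0.
have Bs : B^T = B by rewrite /B linearB /= As tr_scalar_mx.
have bC x y : b x y = b y x.
  rewrite /b (_ : y *m B *m x^T = (x *m B *m y^T)^T) ?mxE//.
  by rewrite !trmx_mul trmxK Bs mulmxA.
have bDl x y z : b (x + y) z = b x z + b y z by rewrite /b !mulmxDl mxE.
have bZl a x z : b (a *: x) z = a * b x z by rewrite /b -!scalemxAl mxE.
have bE x : b x x = l * (x *m x^T) 0 0 - (x *m A *m x^T) 0 0.
  rewrite /b /B mulmxBr mulmxBl mul_mx_scalar -scalemxAl.
  by rewrite mxE [X in X + _]mxE [X in _ + X]mxE.
have b_ge0 x : 0 <= b x x.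
  have [->|x0] := eqVneq x 0; first by rewrite /b !mul0mx mxE.
  have xx := row_sqr_norm_gt0 x0.
  pose s := Num.sqrt ((x *m x^T) 0 0).
  have s0 : 0 < s by rewrite sqrtr_gt0.
  have sE : s ^+ 2 = (x *m x^T) 0 0 by rewrite sqr_sqrtr// ltW.
  have yS : S (s^-1 *: x).
    rewrite /S /= mulmx1 linearZ /= -scalemxAl -scalemxAr 2!mxE -sE.
    by field; rewrite gt_eqF.
  have := umax _ (mem_set yS).
  rewrite linearZ /= -!scalemxAl -scalemxAr 2!mxE -/l mulrA -invfM -expr2.
  rewrite mulrC ler_pdivrMr ?exprn_gt0// sE => H.
  by rewrite bE subr_ge0.
have buu : b u u = 0 by rewrite bE uu mxE eqxx mulr1 subrr.
have b0 w : b u w = 0.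
  apply: (@quadratic_ge0_linear_coef _ (b w w)) => t.
  have := b_ge0 (u + t *: w).
  have -> : b (u + t *: w) (u + t *: w) =
      b u u + t * b u w + t * b w u + t ^+ 2 * b w w.
    rewrite [LHS]bDl bZl (bC u (_ + _)) (bC w (_ + _)) !bDl !bZl; ring.
  by rewrite buu (bC w u); lra.
have uB : u *m B = 0.
  apply/rowP => j; rewrite [RHS]mxE -(b0 (delta_mx 0 j)) /b.
  by rewrite trmx_delta -colE [RHS]mxE.
apply/eqP; rewrite eq_sym -subr_eq0; apply/eqP.
by rewrite -[RHS]uB /B mulmxBr mul_mx_scalar.
Unshelve. all: by end_near. Qed.

(** The reflection in the hyperplane orthogonal to u - e exchanges e and u; it degenerates to the
    identity when u = e. It completes the unit vector u to an orthogonal matrix with first row u. *)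
Lemma householder n (u : 'rV[R]_(1 + n)) : u *m u^T = 1%:M ->
  exists H : 'M[R]_(1 + n),
    [/\ H^T = H, H *m H = 1%:M & delta_mx 0 (lshift n 0) *m H = u].
Proof.
move=> uu; set e := delta_mx 0 _.
have ee : e *m e^T = 1%:M.
  rewrite trmx_delta mul_delta_mx; apply/matrixP => i j.
  by rewrite !ord1 !mxE !eqxx.
have [->|ue] := eqVneq u e.
  by exists 1%:M; rewrite trmx1 !mulmx1.
pose w := u - e; pose s := (w *m w^T) 0 0; pose c := (e *m u^T) 0 0.
have w0 : w != 0 by rewrite subr_eq0.
have s0 : s != 0 by rewrite gt_eqF// row_sqr_norm_gt0.
have wwE : w *m w^T = s%:M by rewrite [LHS]mx11_scalar.
have euE : e *m u^T = c%:M by rewrite [LHS]mx11_scalar.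
have ueE : u *m e^T = c%:M.
  by rewrite -[LHS]trmxK trmx_mul trmxK euE tr_scalar_mx.
have ewE : e *m w^T = (c - 1)%:M.
  by rewrite /w linearB mulmxBr euE ee -raddfB.
have sE : s = 2 - 2 * c.
  have := wwE; rewrite {1}/w mulmxBl /w linearB /= !mulmxBr uu ueE euE ee.
  move=> /matrixP/(_ 0 0); rewrite !mxE eqxx !mulr1n => <-; ring.
exists (1%:M - (2 / s) *: (w^T *m w)); split.
- by rewrite linearB linearZ /= trmx1 trmx_mul trmxK.
- set W := w^T *m w; set a := 2 / s.
  have WW : W *m W = s *: W.
    by rewrite /W mulmxA -(mulmxA w^T w w^T) wwE mul_mx_scalar -scalemxAl.
  rewrite mulmxBl mul1mx mulmxBr mulmx1 -scalemxAl -scalemxAr WW !scalerA.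
  have -> : a * a * s = a + a by rewrite /a; field.
  by rewrite scalerDl opprB addrK subrK.
- rewrite mulmxBr mulmx1 -scalemxAr mulmxA ewE mul_scalar_mx scalerA.
  rewrite (_ : 2 / s * (c - 1) = -1); first by rewrite scaleN1r opprK addrC subrK.
  by rewrite sE; field; rewrite -sE.
Qed.

(** Deflation: conjugation by a Householder reflection moves an eigenvector to the first basis
    vector. By symmetry the first row and column then vanish off the corner, and induction applies
    to the lower right block. *)
Theorem spectral_sym n (A : 'M[R]_n) : A^T = A ->
  exists (P : 'M[R]_n) (d : 'rV[R]_n),
    P *m P^T = 1%:M /\ A = P^T *m diag_mx d *m P.
Proof.
elim: n A => [|n IH] A.
  by exists 1%:M, 0; split; apply/matrixP => -[].
move: A; suff : forall A : 'M[R]_(1 + n), A^T = A ->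
    exists (P : 'M[R]_(1 + n)) (d : 'rV[R]_(1 + n)),
    P *m P^T = 1%:M /\ A = P^T *m diag_mx d *m P by [].
move=> A As.
have [l [u [uu uA]]] : exists (l : R) (u : 'rV[R]_(1 + n)),
    u *m u^T = 1%:M /\ u *m A = l *: u by exact: sym_eigenvector.
have [H [Hs HH eH]] := @householder n u uu.
pose A' := H *m A *m H.
have A's : A'^T = A' by rewrite /A' !trmx_mul As Hs; exact: mulmxA.
pose A1 := A' : 'M[R]_(1 + n, 1 + n).
have eA' : (delta_mx 0 (lshift n 0) : 'rV[R]_(1 + n)) *m A1 = l *: delta_mx 0 (lshift n 0).
  rewrite /A1 /A' !mulmxA eH uA -scalemxAl; congr (_ *: _).
  by rewrite -eH -mulmxA HH mulmx1.
have row0 j : A1 (lshift n 0) j = l * (lshift n 0 == j)%:R.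
  have /matrixP/(_ 0 j) := eA'; rewrite -rowE !mxE => ->.
  by rewrite eqxx eq_sym.
have A1s i j : A1 i j = A1 j i.
  by have /matrixP/(_ j i) := A's; rewrite mxE.
have AE : A = H *m A1 *m H.
  by rewrite /A1 /A' !mulmxA HH mul1mx -mulmxA HH mulmx1.
clearbody A1.
have drs : (drsubmx A1)^T = drsubmx A1.
  by apply/matrixP => i j; rewrite !mxE A1s.
have [P2 [d2 [PP2 AE2]]] := IH _ drs.
have A1E : A1 = block_mx l%:M 0 0 (drsubmx A1).
  rewrite -[LHS]submxK; have -> : ulsubmx A1 = l%:M.
    apply/matrixP => i j; rewrite !ord1 [LHS]mxE [LHS]mxE row0.
    by rewrite eqxx mulr1 mxE eqxx.
  have -> : ursubmx A1 = 0.
    apply/matrixP => i j; rewrite !ord1 [LHS]mxE [LHS]mxE row0 mxE.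
    by rewrite eq_lrshift mulr0.
  suff -> : dlsubmx A1 = 0 by [].
  apply/matrixP => i j; rewrite !ord1 [LHS]mxE [LHS]mxE A1s row0 mxE.
  by rewrite eq_lrshift mulr0.
pose P1 : 'M[R]_(1 + n) := block_mx 1%:M 0 0 P2.
have PP1 : P1 *m P1^T = 1%:M.
  rewrite /P1 tr_block_mx !trmx0 trmx1 mulmx_block !mulmx0 !mul0mx !addr0 !add0r.
  by rewrite mulmx1 PP2 -scalar_mx_block.
exists (P1 *m H), (row_mx l%:M d2); split.
  by rewrite trmx_mul Hs mulmxA -(mulmxA P1 H H) HH mulmx1.
rewrite AE trmx_mul Hs -!mulmxA; congr (_ *m _); rewrite !mulmxA; congr (_ *m _).
rewrite diag_mx_row A1E /P1 tr_block_mx !trmx0 trmx1 !mulmx_block.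
rewrite !(mulmx0, mul0mx, addr0, add0r, mulmx1, mul1mx) -AE2.
suff -> : diag_mx (l%:M : 'rV[R]_1) = l%:M by [].
by apply/matrixP => i j; rewrite !ord1 !mxE.
Qed.

End Spectral.

(** * Spectral calculus, trace inequalities and positive definite matrices *)

Section SpectralCalculus.
Context {R : realType}.
Implicit Types n : nat.

(** For orthogonal [P], the rows of [P] are eigenvectors, with eigenvalues the entries of [d]. *)
Definition spectral_mx n (P : 'M[R]_n) (d : 'rV[R]_n) : 'M[R]_n :=
  P^T *m diag_mx d *m P.

Lemma spectral_mx_sym n (P : 'M[R]_n) (d : 'rV[R]_n) : (spectral_mx P d)^T = spectral_mx P d.
Proof. by rewrite /spectral_mx !trmx_mul trmxK tr_diag_mx mulmxA. Qed.

Lemma orthogonal_trC n (P : 'M[R]_n) : P *m P^T = 1%:M -> P^T *m P = 1%:M.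
Proof. exact: mulmx1C. Qed.

Lemma cvg_sumr (I : Type) (r : seq I) (F : I -> nat -> R) (l : I -> R) :
  (forall i, F i @ \oo --> l i) ->
  (fun m => \sum_(i <- r) F i m) @ \oo --> \sum_(i <- r) l i.
Proof.
move=> Fl; elim: r => [|i r IH].
  by under eq_fun do rewrite big_nil; rewrite big_nil; exact: cvg_cst.
under eq_fun do rewrite big_cons; rewrite big_cons.
by apply: cvgD; [exact: Fl|exact: IH].
Qed.

Lemma spectral_mxE n (P : 'M[R]_n) (d : 'rV[R]_n) i j :
  spectral_mx P d i j = \sum_k d 0 k * (P k i * P k j).
Proof.
rewrite /spectral_mx mul_mx_diag mxE; apply: eq_bigr => k _.
by rewrite !mxE mulrAC mulrC mulrA.
Qed.

(** Powers act on the eigenvalues, so each entry of the partial sums is a combination of scalar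
    exponential series. *)
Lemma expm_spectral_mx n (P : 'M[R]_n) (d : 'rV[R]_n) : P *m P^T = 1%:M ->
  expm (spectral_mx P d) = spectral_mx P (map_mx expR d).
Proof.
move=> PP.
have powE k : spectral_mx P d ^+ k = spectral_mx P (\row_i d 0 i ^+ k).
  elim: k => [|k IH].
    rewrite expr0 /spectral_mx (_ : diag_mx _ = 1%:M).
      by rewrite mulmx1 orthogonal_trC.
    by apply/matrixP => i j; rewrite !mxE expr0.
  rewrite exprS IH -[LHS]/(_ *m _) /spectral_mx !mulmxA -(mulmxA _ P P^T) PP mulmx1.
  rewrite -(mulmxA P^T) mulmx_diag.
  by congr (_ *m diag_mx _ *m _); apply/rowP => i; rewrite !mxE exprS.
apply/matrixP => i j.
have ent_lin : linear (fun A : 'M[R]_n => A i j : R^o).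
  by move=> a u v; rewrite !mxE.
have c1 := @linear_expm_cvg R n _ _ ent_lin (spectral_mx P d).
rewrite spectral_mxE.
have c2 : (fun m => \sum_k series (exp_coeff (d 0 k)) m * (P k i * P k j)) @ \oo -->
    \sum_k expR (d 0 k) * (P k i * P k j).
  apply: (@cvg_sumr _ _ (fun k m => series (exp_coeff (d 0 k)) m * (P k i * P k j))).
  move=> k; apply: cvgM; last exact: cvg_cst.
  exact: is_cvg_series_exp_coeff.
under eq_bigr do rewrite mxE.
apply: (cvg_unique _ c1) => //.
apply: cvg_trans c2; apply: near_eq_cvg; near=> m.
rewrite /series /exp_coeff /=.
under eq_bigr do rewrite mulr_suml.
rewrite exchange_big /=; apply: eq_bigr => k _.
rewrite powE spectral_mxE -[RHS]/(_ * _) mulr_sumr; apply: eq_bigr => l _.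
by rewrite mxE; ring.
Unshelve. all: by end_near. Qed.

Lemma trace_spectral_mx n (P : 'M[R]_n) (a : 'rV[R]_n) : P *m P^T = 1%:M ->
  \tr (spectral_mx P a) = \sum_i a 0 i.
Proof.
by move=> PP; rewrite /spectral_mx mxtrace_mulC mulmxA PP mul1mx mxtrace_diag.
Qed.

Lemma trace_spectral_mx_sqr n (P : 'M[R]_n) (a b : 'rV[R]_n) : P *m P^T = 1%:M ->
  \tr (spectral_mx P a *m spectral_mx P b) = \sum_i a 0 i * b 0 i.
Proof.
move=> PP; have -> : \tr (spectral_mx P a *m spectral_mx P b) =
    \tr (diag_mx a *m (P *m P^T) *m diag_mx b *m (P *m P^T)).
  by rewrite /spectral_mx -!mulmxA mxtrace_mulC !mulmxA.
rewrite PP !mulmx1 mulmx_diag mxtrace_diag.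
by apply: eq_bigr => i _; rewrite mxE.
Qed.

Lemma spectral_mx_mul_row n (P : 'M[R]_n) (d : 'rV[R]_n) i : P *m P^T = 1%:M ->
  row i P *m spectral_mx P d = d 0 i *: row i P.
Proof.
move=> PP; rewrite -row_mul /spectral_mx !mulmxA PP mul1mx.
by apply/rowP => j; rewrite mul_diag_mx !mxE.
Qed.

(** Norms are compared in the eigenvector equation of the i-th row of [P], which is nonzero by
    orthogonality. *)
Lemma spectral_mx_eigenvalue_bound n (P : 'M[R]_n) (d : 'rV[R]_n) i : P *m P^T = 1%:M ->
  `|d 0 i| <= n%:R * `|spectral_mx P d|.
Proof.
move=> PP; have := mulmx_norm (row i P) (spectral_mx P d).
rewrite spectral_mx_mul_row// normrZ mulrAC ler_pM2r// normr_gt0.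
apply/eqP => Pi0; have /matrixP/(_ i i) := PP.
rewrite [RHS]mxE eqxx mxE big1 => [|k _]; first by move/eqP; rewrite eq_sym oner_eq0.
by have /rowP/(_ k) := Pi0; rewrite !mxE => ->; rewrite mul0r.
Qed.

Section TwoFrames.
Variables (n : nat) (P Q : 'M[R]_n).
Hypotheses (PP : P *m P^T = 1%:M) (QQ : Q *m Q^T = 1%:M).

(** Doubly stochastic, since [P *m Q^T] is orthogonal: a sum over the eigenvalues of one frame can
    be spread over all pairs (i, j). *)
Let K i j := (P *m Q^T) i j ^+ 2.

Let K_ge0 i j : 0 <= K i j. Proof. exact: sqr_ge0. Qed.

Let K_row i : \sum_j K i j = 1.
Proof.
have : (P *m Q^T) *m (P *m Q^T)^T = 1%:M.
  by rewrite trmx_mul trmxK mulmxA -(mulmxA P) orthogonal_trC// mulmx1.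
move=> /matrixP/(_ i i); rewrite mxE [RHS]mxE eqxx mulr1n => <-.
by apply: eq_bigr => j _; rewrite /K expr2 [X in _ = _ * X]mxE.
Qed.

Let K_col j : \sum_i K i j = 1.
Proof.
have : (P *m Q^T)^T *m (P *m Q^T) = 1%:M.
  by rewrite trmx_mul trmxK mulmxA -(mulmxA Q) orthogonal_trC// mulmx1.
move=> /matrixP/(_ j j); rewrite mxE [RHS]mxE eqxx mulr1n => <-.
by apply: eq_bigr => i _; rewrite /K expr2 [X in _ = X * _]mxE.
Qed.

Lemma trace_spectral_mx_mul (a b : 'rV[R]_n) :
  \tr (spectral_mx P a *m spectral_mx Q b) = \sum_i \sum_j a 0 i * b 0 j * K i j.
Proof.
have -> : \tr (spectral_mx P a *m spectral_mx Q b) =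
    \tr (diag_mx a *m (P *m Q^T) *m diag_mx b *m (P *m Q^T)^T).
  rewrite /spectral_mx -!mulmxA mxtrace_mulC !mulmxA.
  by rewrite trmx_mul trmxK !mulmxA.
rewrite mul_diag_mx mul_mx_diag /mxtrace; apply: eq_bigr => i _.
rewrite mxE; apply: eq_bigr => j _; rewrite /K !mxE; ring.
Qed.

(* Only the squared overlaps of the two eigenframes occur, so scalar
   inequalities between the eigenvalues transfer to traces. *)
Lemma trace_spectral_mxB (a a' b b' : 'rV[R]_n) :
  \tr ((spectral_mx P a - spectral_mx Q b) *m
       (spectral_mx P a' - spectral_mx Q b')) =
  \sum_i \sum_j (a 0 i - b 0 j) * (a' 0 i - b' 0 j) * K i j.
Proof.
rewrite mulmxBl !mulmxBr !linearB /= trace_spectral_mx_sqr//.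
rewrite [\tr (spectral_mx Q b *m spectral_mx P a')]mxtrace_mulC.
rewrite !trace_spectral_mx_mul trace_spectral_mx_sqr//.
have -> : \sum_i a 0 i * a' 0 i = \sum_i \sum_j a 0 i * a' 0 i * K i j.
  by apply: eq_bigr => i _; rewrite -mulr_sumr K_row mulr1.
have -> : \sum_i b 0 i * b' 0 i = \sum_i \sum_j b 0 j * b' 0 j * K i j.
  by rewrite exchange_big; apply: eq_bigr => i _; rewrite -mulr_sumr K_col mulr1.
rewrite opprK [- _ + _]addrC -!sumrB -big_split; apply: eq_bigr => i _ /=.
rewrite -!sumrB -big_split; apply: eq_bigr => j _ /=; ring.
Qed.

(** Once everything is spread over pairs, each term is the tangent line inequality of exp at
    [a 0 i], evaluated at [b 0 j]. *)
Lemma klein_spectral_mx (a b : 'rV[R]_n) :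
  \tr (spectral_mx P (map_mx expR a)) +
  \tr (spectral_mx P (map_mx expR a) *m (spectral_mx Q b - spectral_mx P a)) <=
  \tr (spectral_mx Q (map_mx expR b)).
Proof.
rewrite mulmxBr linearB /= trace_spectral_mx_sqr// trace_spectral_mx_mul.
rewrite !trace_spectral_mx//.
have -> : \sum_i (map_mx expR a) 0 i = \sum_i \sum_j expR (a 0 i) * K i j.
  by apply: eq_bigr => i _; rewrite -mulr_sumr K_row mulr1 mxE.
have -> : \sum_i (map_mx expR a) 0 i * a 0 i =
    \sum_i \sum_j expR (a 0 i) * a 0 i * K i j.
  by apply: eq_bigr => i _; rewrite -mulr_sumr K_row mulr1 mxE.
have -> : \sum_i (map_mx expR b) 0 i = \sum_i \sum_j expR (b 0 j) * K i j.
  by rewrite exchange_big; apply: eq_bigr => i _; rewrite -mulr_sumr K_col mulr1 mxE.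
rewrite -sumrB -big_split ler_sum// => i _.
rewrite -sumrB -big_split ler_sum// => j _ /=.
rewrite mxE -mulrBl -mulrDl ler_wpM2r//.
have -> : expR (b 0 j) = expR (a 0 i) * expR (b 0 j - a 0 i).
  by rewrite -expRD addrC subrK.
rewrite -mulrBr -[X in X + _]mulr1 -mulrDr ler_wpM2l ?expR_ge0//.
exact: expR_ge1Dx.
Qed.

End TwoFrames.

Lemma tr_mx_sqr n (A : 'M[R]_n) : A^T = A ->
  \tr (A *m A) = \sum_i \sum_j A i j ^+ 2.
Proof.
move=> As; rewrite /mxtrace; apply: eq_bigr => i _; rewrite mxE.
by apply: eq_bigr => j _; rewrite -[in A j i]As mxE expr2.
Qed.

Lemma mx_norm_sqr_le n (A : 'M[R]_n) : `|A| ^+ 2 <= \sum_i \sum_j A i j ^+ 2.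
Proof.
have S0 : 0 <= \sum_i \sum_j A i j ^+ 2.
  by apply: sumr_ge0 => i _; apply: sumr_ge0 => j _; exact: sqr_ge0.
rewrite -(sqr_sqrtr S0) lerXn2r ?nnegrE//.
apply: mx_norm_le => // i j; rewrite -sqrtr_sqr ler_wsqrtr//.
rewrite (bigD1 i)//= (bigD1 j)//= -addrA lerDl addr_ge0//.
  by apply: sumr_ge0 => k _; exact: sqr_ge0.
by apply: sumr_ge0 => k _; apply: sumr_ge0 => l _; exact: sqr_ge0.
Qed.

Lemma tr_mul_le n (A B : 'M[R]_n) : `|\tr (A *m B)| <= n%:R ^+ 2 * `|A| * `|B|.
Proof.
rewrite /mxtrace (le_trans (ler_norm_sum _ _ _))//.
apply: (@le_trans _ _ (\sum_(i < n) n%:R * `|A| * `|B|)).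
  by apply: ler_sum => i _; rewrite (le_trans (mx_norm_entry _ _ _))// mulmx_norm.
by rewrite sumr_const card_ord -[leLHS]mulr_natl expr2 !mulrA.
Qed.

Lemma spectral_symP n (A : 'M[R]_n) : A^T = A ->
  exists (P : 'M[R]_n) (d : 'rV[R]_n), P *m P^T = 1%:M /\ A = spectral_mx P d.
Proof. exact: spectral_sym. Qed.

Lemma expm_sym n (X : 'M[R]_n) : X^T = X -> (expm X)^T = expm X.
Proof.
move=> /spectral_symP[P [d [PP ->]]].
by rewrite expm_spectral_mx// spectral_mx_sym.
Qed.

(** The slope of exp is at least [expR (- m)] to the right of [- m]; after ordering a and b, the
    factor [expR b] is split off and [expR_ge1Dx] bounds the rest. *)
Lemma expR_sub_ge (m a b : R) : - m <= a -> - m <= b ->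
  expR (- m) * ((a - b) * (a - b)) <= (expR a - expR b) * (a - b).
Proof.
wlog ba : a b / b <= a => [H am bm|am bm].
  have [ba|/ltW ab] := leP b a; first exact: H.
  have := H _ _ ab bm am; rewrite -[b - a]opprB -[expR b - _]opprB.
  by rewrite !mulrNN.
rewrite mulrA ler_wpM2r ?subr_ge0//.
have -> : expR a - expR b = expR b * (expR (a - b) - 1).
  by rewrite mulrBr mulr1 -expRD [b + _]addrC subrK.
apply: ler_pM; rewrite ?expR_ge0 ?subr_ge0// ?ler_expR//.
by rewrite lerBrDl expR_ge1Dx.
Qed.

(** The eigenvalues of X and Y lie in [- m, m], where the slope of exp is at least [expR (- m)]. *)
Lemma expm_monotone n (X Y : 'M[R]_n) (m : R) : X^T = X -> Y^T = Y ->
  n%:R * `|X| <= m -> n%:R * `|Y| <= m ->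
  expR (- m) * \tr ((X - Y) *m (X - Y)) <= \tr ((expm X - expm Y) *m (X - Y)).
Proof.
move=> /spectral_symP[P [a [PP ->]]] /spectral_symP[Q [b [QQ ->]]] Xm Ym.
rewrite !expm_spectral_mx// !trace_spectral_mxB// mulr_sumr ler_sum// => i _.
rewrite mulr_sumr ler_sum// => j _.
rewrite mulrA ler_wpM2r ?sqr_ge0// ![map_mx _ _ _ _]mxE expR_sub_ge//.
  have := spectral_mx_eigenvalue_bound a i PP => /le_trans/(_ Xm).
  by rewrite ler_norml => /andP[].
have := spectral_mx_eigenvalue_bound b j QQ => /le_trans/(_ Ym).
by rewrite ler_norml => /andP[].
Qed.

Lemma expm_monotone0 n (X Y : 'M[R]_n) : X^T = X -> Y^T = Y ->
  0 <= \tr ((expm X - expm Y) *m (X - Y)).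
Proof.
move=> Xs Ys; pose m := Num.max (n%:R * `|X|) (n%:R * `|Y|).
apply: le_trans (@expm_monotone _ X Y m Xs Ys _ _); last 2 first.
- by rewrite le_max lexx.
- by rewrite le_max lexx orbT.
rewrite mulr_ge0 ?expR_ge0// tr_mx_sqr ?linearB /= ?Xs ?Ys//.
by apply: sumr_ge0 => i _; apply: sumr_ge0 => j _; exact: sqr_ge0.
Qed.

Lemma klein n (X Y : 'M[R]_n) : X^T = X -> Y^T = Y ->
  \tr (expm X) + \tr (expm X *m (Y - X)) <= \tr (expm Y).
Proof.
move=> /spectral_symP[P [a [PP ->]]] /spectral_symP[Q [b [QQ ->]]].
by rewrite !expm_spectral_mx// klein_spectral_mx.
Qed.

(* Jensen for the probability weights P k i ^ 2, through the supporting line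
   of exp at X i i *)
Lemma expR_le_expm_diag n (X : 'M[R]_n) i : X^T = X -> expR (X i i) <= expm X i i.
Proof.
move=> /spectral_symP[P [a [PP ->]]]; rewrite expm_spectral_mx//.
set X' := spectral_mx P a; set t := X' i i.
have w1 : \sum_k P k i * P k i = 1.
  have /matrixP/(_ i i) := orthogonal_trC PP.
  rewrite mxE [RHS]mxE eqxx mulr1n => <-.
  by apply: eq_bigr => k _; rewrite [in RHS]mxE.
rewrite spectral_mxE.
have tE : \sum_k a 0 k * (P k i * P k i) = t by rewrite /t /X' spectral_mxE.
have -> : expR t = \sum_k (expR t * (1 + (a 0 k - t))) * (P k i * P k i).
  transitivity (expR t * (\sum_k P k i * P k i +
      (\sum_k a 0 k * (P k i * P k i) - t * \sum_k P k i * P k i))).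
    by rewrite w1 tE mulr1 subrr addr0 mulr1.
  rewrite mulr_sumr -sumrB -big_split /= mulr_sumr; apply: eq_bigr => k _; ring.
apply: ler_sum => k _; rewrite mxE ler_wpM2r -?expr2 ?sqr_ge0//.
have -> : expR (a 0 k) = expR t * expR (a 0 k - t) by rewrite -expRD addrC subrK.
by rewrite ler_wpM2l ?expR_ge0// expR_ge1Dx.
Qed.

(** The eigenvalues of the exponential are positive and the entries of an orthogonal matrix have
    modulus at most 1. This bounds an exponential by its diagonal alone, when nothing is known about
    the size of X. *)
Lemma expm_entry_le_trace n (X : 'M[R]_n) i j : X^T = X ->
  `|expm X i j| <= \tr (expm X).
Proof.
move=> /spectral_symP[P [a [PP ->]]]; rewrite expm_spectral_mx//.
rewrite trace_spectral_mx// spectral_mxE (le_trans (ler_norm_sum _ _ _))//.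
apply: ler_sum => k _; rewrite mxE normrM ger0_norm ?expR_ge0//.
rewrite ler_piMr ?expR_ge0// normrM.
have P1 l : `|P k l| <= 1.
  rewrite -[leRHS](@sqrtr1 R) -sqrtr_sqr ler_wsqrtr//.
  have /matrixP/(_ k k) := PP; rewrite mxE [RHS]mxE eqxx mulr1n => <-.
  rewrite (bigD1 l)//= mxE -expr2 lerDl sumr_ge0// => p _.
  by rewrite mxE -expr2 sqr_ge0.
by rewrite -[leRHS]mulr1 ler_pM.
Qed.

Lemma spectral_mx_quadratic n (P : 'M[R]_n) (d : 'rV[R]_n) (x : 'cV[R]_n) :
  (x^T *m spectral_mx P d *m x) 0 0 = \sum_k d 0 k * (P *m x) k 0 ^+ 2.
Proof.
have -> : x^T *m spectral_mx P d *m x = (P *m x)^T *m (diag_mx d *m (P *m x)).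
  by rewrite /spectral_mx trmx_mul !mulmxA.
rewrite mxE; apply: eq_bigr => k _.
by rewrite mul_diag_mx [X in X * _]mxE [X in _ * X]mxE mulrCA expr2.
Qed.

Lemma col_sqr_norm n (x : 'cV[R]_n) : (x^T *m x) 0 0 = \sum_k x k 0 ^+ 2.
Proof. by rewrite mxE; apply: eq_bigr => k _; rewrite mxE expr2. Qed.

Lemma orthogonal_sqr_norm n (P : 'M[R]_n) (x : 'cV[R]_n) : P *m P^T = 1%:M ->
  \sum_k (P *m x) k 0 ^+ 2 = \sum_k x k 0 ^+ 2.
Proof.
move=> PP; rewrite -!col_sqr_norm trmx_mul -mulmxA (mulmxA P^T).
by rewrite orthogonal_trC// mul1mx.
Qed.

Lemma col_sqr_norm_gt0 n (x : 'cV[R]_n) : x != 0 -> 0 < \sum_k x k 0 ^+ 2.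
Proof.
move=> x0; have := @row_sqr_norm_gt0 R n x^T.
rewrite trmxK col_sqr_norm; apply.
by apply: contra x0 => /eqP x0; rewrite -[x]trmxK x0 trmx0.
Qed.

Lemma row_pos_lower_bound n (d : 'rV[R]_n) : (forall i, 0 < d 0 i) ->
  exists2 e : R, 0 < e & forall i, e <= d 0 i.
Proof.
move=> d0; exists (\big[Num.min/1]_i d 0 i); last by move=> i; exact: bigmin_le.
by apply: lt_bigmin => //; exact: ltr01.
Qed.

Lemma SPD_spectral_mx n (P : 'M[R]_n) (d : 'rV[R]_n) : P *m P^T = 1%:M ->
  SPD (spectral_mx P d) <-> forall i, 0 < d 0 i.
Proof.
move=> PP; split=> [[_ dpos] i|dpos].
  have PiT : P *m (row i P)^T = delta_mx i 0.
    by rewrite tr_row -[P in LHS]mulmx1 colE mulmxA mulmx1 PP mul1mx.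
  have Pi0 : (row i P)^T != 0.
    apply/eqP => h; move: PiT; rewrite h mulmx0 => /matrixP/(_ i 0).
    by rewrite !mxE !eqxx => /eqP; rewrite eq_sym oner_eq0.
  have := dpos _ Pi0; rewrite spectral_mx_quadratic PiT (bigD1 i)//= big1.
    by rewrite mxE !eqxx expr1n mulr1 addr0.
  by move=> k ki; rewrite mxE (negbTE ki) expr0n mulr0.
split; first exact: spectral_mx_sym.
move=> x x0; rewrite spectral_mx_quadratic.
have [e e0 ed] := row_pos_lower_bound dpos.
apply: (@lt_le_trans _ _ (e * \sum_k x k 0 ^+ 2)).
  by rewrite mulr_gt0// col_sqr_norm_gt0.
rewrite -(orthogonal_sqr_norm x PP) mulr_sumr ler_sum// => k _.
by rewrite ler_wpM2r// sqr_ge0.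
Qed.

Lemma SPD_expm n (X : 'M[R]_n) : X^T = X -> SPD (expm X).
Proof.
move=> /spectral_symP[P [a [PP ->]]]; rewrite expm_spectral_mx//.
by apply/SPD_spectral_mx => // i; rewrite mxE expR_gt0.
Qed.

Lemma expm_surj n (A : 'M[R]_n) : SPD A -> exists2 X, X^T = X & expm X = A.
Proof.
move=> Apd; have [As _] := Apd.
have [P [d [PP AE]]] := spectral_symP As.
have dpos : forall i, 0 < d 0 i by apply/(SPD_spectral_mx d PP); rewrite -AE.
exists (spectral_mx P (\row_i ln (d 0 i))); first exact: spectral_mx_sym.
rewrite expm_spectral_mx// AE; congr spectral_mx.
by apply/rowP => i; rewrite !mxE lnK ?posrE.
Qed.

Lemma expm_inj n (X Y : 'M[R]_n) : X^T = X -> Y^T = Y -> expm X = expm Y -> X = Y.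
Proof.
move=> Xs Ys XY; apply/eqP; rewrite -subr_eq0 -normr_le0.
pose m := Num.max (n%:R * `|X|) (n%:R * `|Y|).
have := @expm_monotone _ X Y m Xs Ys.
rewrite !le_max !lexx orbT XY subrr mul0mx linear0 => /(_ isT isT).
rewrite pmulr_rle0 ?expR_gt0// tr_mx_sqr; last by rewrite linearB /= Xs Ys.
move=> /(le_trans (mx_norm_sqr_le _)).
by rewrite le_eqVlt ltNge sqr_ge0 orbF sqrf_eq0 => /eqP ->.
Qed.

Lemma mx_quadratic_bound n (E : 'M[R]_n) (x : 'cV[R]_n) :
  `|(x^T *m E *m x) 0 0| <= `|E| * (n%:R * \sum_k x k 0 ^+ 2).
Proof.
rewrite mxE (le_trans (ler_norm_sum _ _ _))//.
have -> : `|E| * (n%:R * \sum_k x k 0 ^+ 2) =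
    \sum_(j < n) \sum_(i < n) `|E| * ((x i 0 ^+ 2 + x j 0 ^+ 2) / 2).
  set S := \sum_k _.
  have rowE (j : 'I_n) : \sum_(i < n) `|E| * ((x i 0 ^+ 2 + x j 0 ^+ 2) / 2) =
      `|E| * ((S + n%:R * x j 0 ^+ 2) / 2).
    by rewrite -mulr_sumr -mulr_suml big_split /= sumr_const card_ord mulr_natl.
  rewrite (eq_bigr _ (fun j _ => rowE j)) -mulr_sumr -mulr_suml big_split /=.
  rewrite sumr_const card_ord -mulr_sumr -/S -[S *+ n]mulr_natl.
  by congr (_ * _); field.
apply: ler_sum => j _; rewrite mxE mulr_suml (le_trans (ler_norm_sum _ _ _))//.
apply: ler_sum => i _; rewrite mxE !normrM mulrAC mulrC ler_pM ?mulr_ge0//.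
  exact: mx_norm_entry.
rewrite -[x i 0 ^+ 2]real_normK ?num_real// -[x j 0 ^+ 2]real_normK ?num_real//.
have := sqr_ge0 (`|x i 0| - `|x j 0|); nra.
Qed.

(** Openness relative to the symmetric matrices. With [e] below all eigenvalues, the form of A is at
    least e |x|^2, while that of B - A is at most n |B - A| |x|^2. The denominator n + 1 keeps the
    radius positive for n = 0. *)
Lemma SPD_open n (A : 'M[R]_n) : SPD A ->
  exists2 e : R, 0 < e & forall B : 'M[R]_n, B^T = B -> `|B - A| < e -> SPD B.
Proof.
move=> Apd; have [As _] := Apd.
have [P [d [PP AE]]] := spectral_symP As.
have dpos : forall i, 0 < d 0 i by apply/(SPD_spectral_mx d PP); rewrite -AE.
have [e e0 ed] := row_pos_lower_bound dpos.
have n1 : 0 < n%:R + 1 :> R by rewrite ltr_wpDl.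
exists (e / (n%:R + 1)) => [|B Bs BA]; first by rewrite divr_gt0.
split=> // x x0; have S0 := col_sqr_norm_gt0 x0; set S := \sum_k _ in S0.
have -> : (x^T *m B *m x) 0 0 = (x^T *m A *m x) 0 0 + (x^T *m (B - A) *m x) 0 0.
  by rewrite -[in LHS](subrK A B) addrC mulmxDr mulmxDl mxE.
have H1 : e * S <= (x^T *m A *m x) 0 0.
  rewrite AE spectral_mx_quadratic /S -(orthogonal_sqr_norm x PP) mulr_sumr.
  by rewrite ler_sum// => k _; rewrite ler_wpM2r// sqr_ge0.
have H2 : `|(x^T *m (B - A) *m x) 0 0| < e * S.
  apply: (le_lt_trans (mx_quadratic_bound _ _)).
  rewrite mulrA ltr_pM2r//.
  apply: (@le_lt_trans _ _ (`|B - A| * (n%:R + 1))); last by rewrite -ltr_pdivlMr.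
  by rewrite ler_wpM2l// lerDl.
have : - (e * S) < (x^T *m (B - A) *m x) 0 0.
  by move: H2; rewrite ltr_norml => /andP[].
by move=> H3; rewrite -(subrr (e * S)) ler_ltD.
Qed.

End SpectralCalculus.

(** * Symmetric, diagonal and off-diagonal parts *)

Section SymmetricPart.
Context {R : realType} {n : nat}.
Implicit Types A B X Y E : 'M[R]_n.

Definition symp A : 'M[R]_n := 2^-1 *: (A + A^T).

Lemma sympE A i j : symp A i j = 2^-1 * (A i j + A j i).
Proof. by rewrite !mxE. Qed.

Lemma symp_linear : linear symp.
Proof. by move=> a u v; apply/matrixP => i j; rewrite !mxE; ring. Qed.

Lemma symp_sym A : (symp A)^T = symp A.
Proof. by apply/matrixP => i j; rewrite !mxE addrC. Qed.

Lemma symp_id A : A^T = A -> symp A = A.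
Proof.
by move=> As; apply/matrixP => i j; rewrite sympE -[A j i]/(A j i) -{2}As mxE; field.
Qed.

Lemma symp_norm A : `|symp A| <= `|A|.
Proof.
apply: mx_norm_le => // i j; rewrite sympE normrM gtr0_norm ?invr_gt0//.
rewrite ler_pdivrMl// mulr_natl mulr2n (le_trans (ler_normD _ _))//.
by rewrite lerD// mx_norm_entry.
Qed.

Lemma diagpartE A i j : diagpart A i j = A i i *+ (i == j).
Proof. by rewrite !mxE. Qed.

Lemma offE A i j : off A i j = if i == j then 0 else A i j.
Proof.
by rewrite /off !mxE; case: eqP => [->|_]; rewrite ?mulr1n ?subrr// mulr0n subr0.
Qed.

Lemma diagpart_linear : linear (@diagpart R n).
Proof.
move=> a u v; apply/matrixP => i j; rewrite !mxE.
by case: (i == j); rewrite ?mulr1n// !mulr0n mulr0 addr0.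
Qed.

Lemma off_linear : linear (@off R n).
Proof.
by move=> a u v; rewrite /off diagpart_linear scalerBr opprD addrACA.
Qed.

Lemma diagpart_norm A : `|diagpart A| <= `|A|.
Proof.
apply: mx_norm_le => // i j; rewrite diagpartE.
by case: eqP => _; rewrite ?mulr1n ?mx_norm_entry// mulr0n normr0.
Qed.

Lemma off_norm A : `|off A| <= `|A|.
Proof.
apply: mx_norm_le => // i j; rewrite offE.
by case: eqP => _; rewrite ?mx_norm_entry// normr0.
Qed.

Lemma off_diagpartK A : off A + diagpart A = A.
Proof. by rewrite /off subrK. Qed.

Lemma off_diag_mx (d : 'rV[R]_n) : off (diag_mx d) = 0.
Proof. by apply/matrixP => i j; rewrite offE !mxE; case: eqP. Qed.

Lemma diagpart_diag_mx (d : 'rV[R]_n) : diagpart (diag_mx d) = diag_mx d.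
Proof. by apply/matrixP => i j; rewrite diagpartE !mxE eqxx. Qed.

Lemma diagpart_off A : diagpart (off A) = 0.
Proof. by apply/matrixP => i j; rewrite diagpartE offE eqxx mul0rn mxE. Qed.

Lemma off_off A : off (off A) = off A.
Proof. by rewrite {1}/off diagpart_off subr0. Qed.

Lemma diagpart_sym A : (diagpart A)^T = diagpart A.
Proof. exact: tr_diag_mx. Qed.

Lemma off_symp A : off (symp A) = symp (off A).
Proof.
apply/matrixP => i j; rewrite offE !sympE !offE [j == i]eq_sym.
by case: eqP => // _; rewrite addr0 mulr0.
Qed.

Lemma diagpart_symp A : diagpart (symp A) = diagpart A.
Proof.
apply/matrixP => i j; rewrite !diagpartE sympE.
by congr (_ *+ _); field.
Qed.

Lemma tr_mul_diagpart A B : \tr (A *m diagpart B) = \tr (diagpart A *m diagpart B).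
Proof.
rewrite /mxtrace; apply: eq_bigr => i _.
by rewrite /diagpart !mul_mx_diag !mxE eqxx.
Qed.

Lemma symp_linB A B : symp (A - B) = symp A - symp B.
Proof. by apply/matrixP => i j; rewrite !mxE; ring. Qed.

Lemma sympD A B : symp (A + B) = symp A + symp B.
Proof. by apply/matrixP => i j; rewrite !mxE; ring. Qed.

Lemma mx_linear_inj_surj (f : 'M[R]_n -> 'M[R]_n) : linear f ->
  (forall v, f v = 0 -> v = 0) -> forall w, exists v, f v = w.
Proof.
move=> flin finj w.
pose fM := GRing.isLinear.Build _ _ _ _ _ flin.
pose fL : {linear 'M[R]_n -> 'M[R]_n} := HB.pack f fM.
have : lin_mx fL \in unitmx.
  rewrite -row_free_unit; apply: inj_row_free => v.
  rewrite mul_rV_lin => /eqP; rewrite mxvec_eq0 => /eqP/finj v0.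
  by rewrite -[v]vec_mxK v0 linear0.
move=> fu; exists (vec_mx (mxvec w *m invmx (lin_mx fL))).
apply: (can_inj mxvecK); rewrite -[f]/(fL : _ -> _) -mul_rV_lin.
by rewrite -mulmxA mulVmx// mulmx1.
Qed.

End SymmetricPart.

(** * Derivative of the exponential at symmetric matrices *)

Section ExponentialDerivative.
Context {R : realType} {n : nat}.
Implicit Types X Y E : 'M[R]_n.

Lemma expm_quotient_cvg X E :
  (fun h : R => h^-1 *: (expm (h *: E + X) - expm X)) @ 0^' --> dexpm X E.
Proof.
have [dX dE] := is_diff_expm X.
have <- : 'D_E (@expm R n) X = dexpm X E by rewrite deriveE// dE.
exact: (diff_derivable dX).
Qed.

Lemma dexpm_sym X E : X^T = X -> E^T = E -> (dexpm X E)^T = dexpm X E.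
Proof.
move=> Xs Es; have trc : continuous (fun A : 'M[R]_n => A^T).
  by apply: mx_linear_continuous => a u v; exact: linearP.
have c1 := @expm_quotient_cvg X E.
have := cvg_comp _ _ c1 (trc (dexpm X E)).
move=> c2; apply: (cvg_unique _ c2) => //.
apply: cvg_trans c1; apply: near_eq_cvg; near=> h => /=.
have hs : (h *: E + X)^T = h *: E + X by rewrite linearD linearZ /= Es Xs.
rewrite [RHS]linearZ /=; congr (_ *: _).
by rewrite linearB /= !expm_sym.
Unshelve. all: by end_near. Qed.

(** Strong monotonicity between X + h E and X, divided by h^2, in the limit h -> 0. The radius |X| +
    1 covers every h with |h E| <= 1. *)
Lemma dexpm_coercive X E : X^T = X -> E^T = E ->
  expR (- (n%:R * (`|X| + 1))) * \tr (E *m E) <= \tr (dexpm X E *m E).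
Proof.
move=> Xs Es; have trc : continuous (fun A : 'M[R]_n => \tr (A *m E) : R^o).
  apply: mx_linear_continuous => a u v.
  by rewrite mulmxDl -scalemxAl linearD linearZ.
have c1 := cvg_comp _ _ (@expm_quotient_cvg X E) (trc (dexpm X E)).
apply: (cvgr_to_ge c1); near=> h => /=.
have h0 : h != 0 by near: h; exact: nbhs_dnbhs_neq.
have hE : `|h *: E| <= 1.
  rewrite normrZ; have E1 : 0 < `|E| + 1 by rewrite ltr_wpDl.
  apply: (@le_trans _ _ (`|h| * (`|E| + 1))); first by rewrite ler_wpM2l// lerDl.
  rewrite -ler_pdivlMr// mul1r; near: h; apply: dnbhs0_le.
  by rewrite invr_gt0.
have hs : (h *: E + X)^T = h *: E + X by rewrite linearD linearZ /= Es Xs.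
have := @expm_monotone _ _ _ _ (n%:R * (`|X| + 1)) hs Xs.
rewrite addrK -!scalemxAl -!scalemxAr scalerA !linearZ /= => H.
have h2 : 0 < h * h by rewrite -expr2 exprn_even_gt0.
rewrite -(ler_pM2l h2).
rewrite [leLHS]mulrCA (le_trans (H _ _))//.
- rewrite ler_wpM2l// addrC (le_trans (ler_normD _ _))//.
  by rewrite lerD2l.
- by rewrite ler_wpM2l// lerDl.
- by rewrite le_eqVlt; apply/orP; left; apply/eqP; field.
Unshelve. all: by end_near. Qed.

Lemma dexpm_norm X E (r : R) : 1 <= r -> n%:R <= r -> n%:R * `|X| <= r ->
  `|dexpm X E| <= `|E| * expR (2 * r).
Proof.
move=> r1 nr Xr; have c1 := cvg_norm (@dexpm_cvg R n X E).
apply: (cvgr_to_le (c1 _)); near=> m.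
rewrite (le_trans (ler_norm_sum _ _ _))//.
apply: (@le_trans _ _ (\sum_(0 <= k < m) `|E| * exp_coeff (2 * r) k)).
  apply: ler_sum => k _.
  rewrite normrZ gtr0_norm ?invr_gt0 ?ltr0n ?fact_gt0//.
  rewrite /exp_coeff /= mulrA [leRHS]mulrC ler_wpM2l ?invr_ge0//.
  exact: dpow_norm.
rewrite -mulr_sumr ler_wpM2l//.
apply: nondecreasing_cvgn_le; last exact: is_cvg_series_exp_coeff.
apply: nondecreasing_series => k _ _.
rewrite /exp_coeff /= divr_ge0// exprn_ge0// mulr_ge0//.
by rewrite (le_trans _ r1).
Unshelve. all: by end_near. Qed.

(* Monotonicity along the ray from X0 turns the strong monotonicity on the
   sphere of radius e into a bound valid outside of it. *)
Lemma expm_gap X0 (e : R) : X0^T = X0 -> 0 < e ->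
  exists2 d : R, 0 < d & forall X, X^T = X -> e <= `|X - X0| ->
    d * `|X - X0| <= \tr ((expm X - expm X0) *m (X - X0)).
Proof.
move=> X0s e0; pose m := n%:R * (`|X0| + e).
exists (expR (- m) * e) => [|X Xs eX]; first by rewrite mulr_gt0 ?expR_gt0.
have N0 : 0 < `|X - X0| by exact: lt_le_trans eX.
pose s := e / `|X - X0|.
have s0 : 0 < s by rewrite divr_gt0.
have s1 : s <= 1 by rewrite ler_pdivrMr// mul1r.
pose Z := s *: (X - X0) + X0.
have Zs : Z^T = Z by rewrite /Z linearD linearZ linearB /= Xs X0s.
have ZX0 : Z - X0 = s *: (X - X0) by rewrite addrK.
have nZ : `|Z - X0| = e.
  by rewrite ZX0 normrZ gtr0_norm// divfK// gt_eqF.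
have H1 : expR (- m) * e ^+ 2 <= s * \tr ((expm Z - expm X0) *m (X - X0)).
  have -> : s * \tr ((expm Z - expm X0) *m (X - X0)) =
      \tr ((expm Z - expm X0) *m (Z - X0)) by rewrite ZX0 -scalemxAr linearZ.
  apply: le_trans (@expm_monotone _ _ _ _ m Zs X0s _ _); last 2 first.
  - rewrite ler_wpM2l// -[Z](subrK X0) (le_trans (ler_normD _ _))// nZ.
    by rewrite addrC.
  - by rewrite ler_wpM2l// lerDl ltW.
  rewrite ler_wpM2l ?expR_ge0// tr_mx_sqr; last by rewrite linearB /= Zs X0s.
  by rewrite -nZ mx_norm_sqr_le.
have H2 : 0 <= \tr ((expm X - expm Z) *m (X - X0)).
  have XZ : X - Z = (1 - s) *: (X - X0).
    by rewrite scalerBl scale1r /Z opprD addrA addrAC.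
  have := expm_monotone0 Xs Zs.
  rewrite XZ -scalemxAr linearZ /=.
  move: s1; rewrite le_eqVlt => /orP[/eqP s1 _|s1].
    have -> : X = Z by apply/eqP; rewrite -subr_eq0 XZ s1 subrr scale0r.
    by rewrite subrr mul0mx linear0.
  by rewrite pmulr_rge0// subr_gt0.
have -> : \tr ((expm X - expm X0) *m (X - X0)) =
    \tr ((expm X - expm Z) *m (X - X0)) + \tr ((expm Z - expm X0) *m (X - X0)).
  by rewrite -linearD -mulmxDl subrKA.
rewrite -[leLHS]add0r; apply: lerD; first exact: H2.
rewrite -(ler_pM2l s0) (le_trans _ H1)// le_eqVlt; apply/orP; left; apply/eqP.
by rewrite /s; field; rewrite gt_eqF.
Qed.

End ExponentialDerivative.

(** * Logarithm of positive definite matrices *)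

Section SymmetricLogarithm.
Context {R : realType} {n : nat}.
Implicit Types A B X Y E : 'M[R]_n.

Lemma logmE X : X^T = X -> logm (expm X) = X.
Proof.
move=> Xs; have inj : {in (@Sym R n) &, injective (@expm R n)}.
  by move=> U W /set_mem Us /set_mem Ws; exact: expm_inj.
exact: (pinvKV (fun=> 0) inj (mem_set Xs)).
Qed.

Lemma logmK A : SPD A -> (logm A)^T = logm A /\ expm (logm A) = A.
Proof. by move=> /expm_surj[X Xs <-]; rewrite logmE. Qed.

(** If the logarithms were at distance at least e, [expm_gap] would give d |log B - log A| <= n^2 |B
    - A| |log B - log A|, which bounds |B - A| from below. *)
Lemma logm_continuous A (e : R) : SPD A -> 0 < e ->
  exists2 d : R, 0 < d & forall B, SPD B -> `|B - A| < d -> `|logm B - logm A| < e.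
Proof.
move=> Apd e0; have [As AK] := logmK Apd.
have [d d0 gap] := expm_gap As e0.
have n1 : 0 < n%:R ^+ 2 + 1 :> R by rewrite ltr_wpDl// exprn_ge0.
exists (d / (n%:R ^+ 2 + 1)) => [|B Bpd BA]; first by rewrite divr_gt0.
have [Bs BK] := logmK Bpd.
rewrite ltNge; apply/negP => le_e.
have := gap _ Bs le_e; rewrite AK BK => H.
have := le_trans H (le_trans (ler_norm _) (tr_mul_le _ _)).
rewrite ler_pM2r ?(lt_le_trans e0)//; apply/negP; rewrite -ltNge.
move: BA; rewrite ltr_pdivlMr// mulrC; apply: le_lt_trans.
by rewrite ler_wpM2r// lerDl.
Qed.

(** An open set of matrices whose symmetric elements are exactly those of [SPD]. *)
Definition SymSPD : set 'M[R]_n := [set Y | SPD (symp Y)].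

Lemma open_SymSPD : open SymSPD.
Proof.
rewrite openE => Y Ypd; have [e e0 He] := SPD_open Ypd.
have : \forall Z \near Y, `|Y - Z| < e.
  by have /cvgrPdist_lt/(_ _ e0) := @cvg_id _ (nbhs Y).
apply: filterS => Z YZ; apply: He; first exact: symp_sym.
by rewrite -symp_linB (le_lt_trans (symp_norm _))// distrC.
Qed.

(* expm and logm, extended by the identity on skew-symmetric matrices: the
   symmetric matrices have empty interior in 'M_n, and the inverse function
   theorem needs maps between open sets. *)
Definition expS X : 'M[R]_n := expm (symp X) + (X - symp X).
Definition logS Y : 'M[R]_n := logm (symp Y) + (Y - symp Y).

Lemma symp_sub_symp Y : symp (Y - symp Y) = 0.
Proof. by rewrite symp_linB (symp_id (symp_sym Y)) subrr. Qed.

Lemma symp_logS Y : SymSPD Y -> symp (logS Y) = logm (symp Y).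
Proof.
move=> Ypd; have [Ls _] := logmK Ypd.
by rewrite /logS sympD symp_sub_symp addr0 symp_id.
Qed.

Lemma logSK Y : SymSPD Y -> expS (logS Y) = Y.
Proof.
move=> Ypd; have [_ LK] := logmK Ypd.
by rewrite /expS symp_logS// LK /logS [X in _ + (X - _)]addrC addrK addrC subrK.
Qed.

Lemma is_diff_mx_linear (W : normedModType R) (f : 'M[R]_n -> W) X :
  linear f -> is_diff X f f.
Proof.
move=> flin; have fc : continuous f by exact: mx_linear_continuous.
pose fM := GRing.isLinear.Build _ _ _ _ _ flin.
pose fL : {linear 'M[R]_n -> W} := HB.pack f fM.
apply: DiffDef; first exact: (@linear_differentiable _ _ _ fL).
by rewrite (@diff_lin _ _ _ fL).
Qed.

Lemma sub_symp_linear : linear (fun X : 'M[R]_n => X - symp X).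
Proof. by move=> a u v; rewrite symp_linear scalerBr opprD addrACA. Qed.

Lemma is_diff_expm_symp X :
  is_diff X (expm \o symp) (dexpm (symp X) \o symp).
Proof.
have sd := is_diff_mx_linear X (@symp_linear R n).
exact: (is_diff_comp sd (is_diff_expm (symp X))).
Qed.

Lemma is_diff_expS X :
  is_diff X expS (fun v => dexpm (symp X) (symp v) + (v - symp v)).
Proof.
have := is_diffD (is_diff_expm_symp X) (is_diff_mx_linear X sub_symp_linear).
by [].
Qed.

Lemma Ck_symp k O : Ck k O (@symp R n).
Proof. apply: Ck_mx_linear; exact: symp_linear. Qed.

Lemma CkD k (V W : normedModType R) (O : set V) (f g : V -> W) : open O ->
  Ck k O f -> Ck k O g -> Ck k O (f \+ g).
Proof.
move=> Oo fk gk.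
apply: (@Ck_comp _ _ _ _ _ _ setT (fun x => (f x, g x)) (fun p : W * W => p.1 + p.2)) => //.
  exact: Ck_pair.
apply: Ck_linear => [a u v|x]; first by rewrite /= scalerDr addrACA.
exact: add_continuous.
Qed.

Lemma Ck_expm_symp k O : open O -> Ck k O (expm \o @symp R n).
Proof.
by move=> Oo; apply: (@Ck_comp _ _ _ _ _ _ setT) => //; [exact: Ck_symp|exact: Ck_expm].
Qed.

Lemma Ck_expS k O : open O -> Ck k O expS.
Proof.
move=> Oo; apply: (@CkD _ _ _ _ (expm \o symp) (fun X => X - symp X)) => //.
  exact: Ck_expm_symp.
by apply: Ck_mx_linear; exact: sub_symp_linear.
Qed.

Lemma trace_sqr_ge_norm E : E^T = E -> `|E| ^+ 2 <= \tr (E *m E).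
Proof. by move=> Es; rewrite tr_mx_sqr// mx_norm_sqr_le. Qed.

Lemma dexpm_lower_bound X (r : R) : X^T = X -> n%:R * (`|X| + 1) <= r ->
  forall E, E^T = E -> expR (- r) * `|E| ^+ 2 <= \tr (dexpm X E *m E).
Proof.
move=> Xs Xr E Es; apply: le_trans (dexpm_coercive Xs Es).
apply: ler_pM; rewrite ?expR_ge0 ?exprn_ge0//; last exact: trace_sqr_ge_norm.
by rewrite ler_expR lerN2.
Qed.

Lemma near_symp_norm X0 (k : R) : `|X0| + 1 <= k ->
  \forall X \near X0, `|symp X| <= k.
Proof.
move=> X0k; near=> X; rewrite (le_trans (symp_norm _))// (le_trans _ X0k)//.
rewrite -[X](subrK X0) (le_trans (ler_normD _ _))// addrC lerD2l distrC.
near: X; have /cvgrPdist_le/(_ _ ltr01) := @cvg_id _ (nbhs X0).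
by [].
Unshelve. all: by end_near. Qed.

(** The differential preserves the splitting into symmetric and skew parts and is the identity on
    the skew one. On the symmetric part, coercivity divided by |symp v| gives the bound. *)
Lemma expS_diff_bound X0 : exists2 c : R, 0 < c &
  \forall X \near X0, forall v, c * `|v| <= `|'d expS X v|.
Proof.
(* Near X0 the norm of [symp X] is at most |X0| + 1, and [dexpm_lower_bound] asks for 1 more. *)
pose r : R := n%:R * (`|X0| + 2); pose c := expR (- r).
have c0 : 0 < c by exact: expR_gt0.
pose K := c^-1 * n%:R ^+ 2 + 2.
have K0 : 0 < K by rewrite ltr_wpDl// mulr_ge0 ?invr_ge0 ?exprn_ge0// ltW.
exists K^-1; first by rewrite invr_gt0.
near=> X => v.
have [_ ->] := is_diff_expS X.
set w := dexpm (symp X) (symp v); set u := w + _.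
have ws : w^T = w by rewrite /w dexpm_sym// symp_sym.
have uw : symp u = w by rewrite /u sympD symp_sub_symp addr0 symp_id.
have uv : u - symp u = v - symp v by rewrite uw /u addrC addKr.
have rX : n%:R * (`|symp X| + 1) <= r.
  rewrite ler_wpM2l// -lerBrDr (_ : _ - 1 = `|X0| + 1); last by ring.
  by near: X; exact: near_symp_norm.
have sv : `|symp v| <= c^-1 * n%:R ^+ 2 * `|u|.
  have [->|v0] := eqVneq (symp v) 0.
    by rewrite normr0 !mulr_ge0 ?invr_ge0 ?exprn_ge0// ltW.
  have := dexpm_lower_bound (symp_sym X) rX (symp_sym v).
  move=> /le_trans/(_ (le_trans (ler_norm _) (tr_mul_le _ _))).
  rewrite expr2 mulrA ler_pM2r ?normr_gt0// -/w => H.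
  rewrite -mulrA -ler_pdivrMl ?invr_gt0// invrK (le_trans H)//.
  by rewrite ler_wpM2l ?exprn_ge0// -uw symp_norm.
have vE : `|v| <= `|v - symp v| + `|symp v|.
  by rewrite -{1}[v](subrK (symp v)) ler_normD.
rewrite ler_pdivrMl// (le_trans vE)//.
rewrite -uv /K mulrDl addrC lerD// mulr_natl mulr2n.
by rewrite (le_trans (ler_normB _ _))// lerD2l symp_norm.
Unshelve. all: by end_near. Qed.

Lemma logS_continuous Y : SymSPD Y -> {for Y, continuous logS}.
Proof.
move=> Ypd.
have lc : (fun Z => logm (symp Z)) @ Y --> logm (symp Y).
  suff : forall e : R, 0 < e ->
      \forall Z \near Y, `|logm (symp Y) - logm (symp Z)| < e.
    by move=> H; exact: (@cvgrPdist_lt _ 'M[R]_n _ (nbhs Y) (nbhs_filter Y) _ _).2.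
  move=> e e0.
  have [d d0 dH] := logm_continuous Ypd e0.
  have H1 : \forall Z \near Y, SymSPD Z.
    exact: (open_nbhs_nbhs (conj open_SymSPD Ypd)).
  have H2 : \forall Z \near Y, `|Y - Z| < d.
    by have /cvgrPdist_lt/(_ _ d0) := @cvg_id _ (nbhs Y).
  apply: filterS2 H1 H2 => Z Zpd YZ; rewrite distrC; apply: dH => //.
  by rewrite -symp_linB (le_lt_trans (symp_norm _))// distrC.
have ic : continuous (fun Z : 'M[R]_n => Z - symp Z).
  by apply: mx_linear_continuous; exact: sub_symp_linear.
exact: (cvgD lc (ic Y)).
Qed.

Lemma Ck_logS k : Ck k.+1 SymSPD logS.
Proof.
apply: (@Ck_inverse _ _ _ _ expS _ setT).
- exact: openT.
- exact: open_SymSPD.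
- by [].
- exact: logSK.
- exact: logS_continuous.
- by apply: Ck_expS; exact: openT.
- by move=> X _; exact: expS_diff_bound.
- move=> X _; have [c c0 /nbhs_singleton cX] := expS_diff_bound X.
  apply: mx_linear_inj_surj => [a u v|v v0]; first exact: linearP.
  by have := cX v; rewrite v0 normr0 pmulr_rle0// normr_le0 => /eqP.
Qed.

End SymmetricLogarithm.

(** * Diagonal correction: existence and uniqueness *)

Section DiagonalCorrection.
Context {R : realType} {n : nat}.
Implicit Types A B X Y S : 'M[R]_n.

(** The tangent lines of exp with slopes [2 * d] and [d / 2] keep slopes d and - d / 2 once [d * t]
    is subtracted; the former serves t >= 0, the latter t < 0. *)
Lemma expR_linear_coercive (s d : R) : 0 < d ->
  exists C : R, forall t, d / 2 * `|t| - C <= expR (s + t) - d * t.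
Proof.
move=> d0.
have line (k t : R) : 0 < k -> k * (1 + (s + t - ln k)) <= expR (s + t).
  move=> k0; have -> : expR (s + t) = k * expR (s + t - ln k).
    by rewrite expRB lnK ?posrE// mulrC divfK// gt_eqF.
  by rewrite ler_wpM2l ?(ltW k0)// expR_ge1Dx.
pose c1 := 2 * d * (1 + s - ln (2 * d)); pose c2 := d / 2 * (1 + s - ln (d / 2)).
exists (`|c1| + `|c2|) => t.
have h1 := line (2 * d) t (mulr_gt0 (ltr0n _ 2) d0).
have h2 := line (d / 2) t (divr_gt0 d0 (ltr0n _ 2)).
have n1 : - `|c1| <= c1 by rewrite lerNl -normrN ler_norm.
have n2 : - `|c2| <= c2 by rewrite lerNl -normrN ler_norm.
have m1 : 0 <= `|c1| by []. have m2 : 0 <= `|c2| by [].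
have [t0|t0] := leP 0 t.
  rewrite ger0_norm//; rewrite /c1 in n1.
  have : 0 <= d * t by rewrite mulr_ge0// ltW.
  lra.
rewrite ltr0_norm//; rewrite /c2 in n2; lra.
Qed.

(** Its critical points in D solve diag (expm (S + D)) = d. The target d is an arbitrary positive
    vector rather than 1, because the smoothness argument needs an open set of targets. *)
Definition diag_potential S (d D : 'rV[R]_n) : R :=
  \tr (expm (S + diag_mx D)) - \sum_i d 0 i * D 0 i.

Lemma diag_potential_continuous S d : continuous (diag_potential S d).
Proof.
move=> D.
have c1 : (fun D => \tr (expm (S + diag_mx D))) @ D --> \tr (expm (S + diag_mx D)).
  have tc : continuous (@mxtrace R n : _ -> R^o).
    by apply: mx_linear_continuous => a u v; rewrite linearD linearZ.
  have dc : continuous (fun D : 'rV[R]_n => diag_mx D).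
    by apply: mx_linear_continuous => a u v; rewrite linearD linearZ.
  have sc : continuous (fun D : 'rV[R]_n => S + diag_mx D).
    by move=> E; exact: (cvgD (cvg_cst S) (dc E)).
  have ec : continuous (fun D : 'rV[R]_n => expm (S + diag_mx D)).
    by move=> E; apply: (continuous_comp (sc E)); exact: expm_continuous.
  exact: (continuous_comp (ec D) (tc _)).
have c2 : (fun D : 'rV[R]_n => \sum_i d 0 i * D 0 i) @ D --> \sum_i d 0 i * D 0 i.
  have c : continuous (fun D : 'rV[R]_n => \sum_i d 0 i * D 0 i : R^o).
    apply: mx_linear_continuous => a u v.
    by rewrite scaler_sumr -big_split /=; apply: eq_bigr => i _; rewrite !mxE /GRing.scale /=; ring.
  exact: c.
exact: (cvgB c1 c2).
Qed.

(** By [expR_le_expm_diag] the potential dominates a sum of functions of one diagonal entry each,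
    all of them coercive. *)
Lemma diag_potential_coercive S (d : 'rV[R]_n) : S^T = S -> (forall i, 0 < d 0 i) ->
  exists (a C : R), 0 < a /\ forall D, a * `|D| - C <= diag_potential S d D.
Proof.
move=> Ss d0; have [e e0 ed] := row_pos_lower_bound d0.
pose C i := projT1 (cid (expR_linear_coercive (S i i) (d0 i))).
have CH i t : d 0 i / 2 * `|t| - C i <= expR (S i i + t) - d 0 i * t.
  exact: (projT2 (cid (expR_linear_coercive (S i i) (d0 i)))).
exists (e / 2), (\sum_i C i); split; first by rewrite divr_gt0.
move=> D.
have H1 : \sum_i (d 0 i / 2 * `|D 0 i| - C i) <= diag_potential S d D.
  rewrite /diag_potential /mxtrace -sumrB ler_sum// => i _.
  apply: (le_trans (CH i _)); rewrite lerD2r.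
  have Ds : (S + diag_mx D)^T = S + diag_mx D by rewrite linearD /= Ss tr_diag_mx.
  have := expR_le_expm_diag i Ds; rewrite [(S + diag_mx D) i i]mxE.
  by rewrite [diag_mx D i i]mxE eqxx mulr1n.
apply: le_trans H1; rewrite sumrB lerD2r -ler_pdivlMl ?divr_gt0//.
apply: mx_norm_le => [|i j].
  rewrite mulr_ge0 ?invr_ge0 ?divr_ge0 ?(ltW e0)// sumr_ge0// => i _.
  by rewrite mulr_ge0// divr_ge0// ltW.
rewrite ord1 ler_pdivlMl ?divr_gt0// (bigD1 j)//=.
rewrite (@le_trans _ _ (d 0 j / 2 * `|D 0 j|))//.
  by rewrite ler_wpM2r// ler_wpM2r.
by rewrite lerDl sumr_ge0// => k _; rewrite mulr_ge0// divr_ge0// ltW.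
Qed.

Lemma diag_potential_min S (d : 'rV[R]_n) : S^T = S -> (forall i, 0 < d 0 i) ->
  exists D, forall D', diag_potential S d D <= diag_potential S d D'.
Proof.
move=> Ss d0; have [a [C [a0 aC]]] := diag_potential_coercive Ss d0.
(* Beyond this radius the coercive bound is at least the value at 0, so a minimum over the ball is
   global. *)
pose M := a^-1 * (`|diag_potential S d 0| + `|C|).
have M0 : 0 <= M by rewrite mulr_ge0 ?invr_ge0 ?(ltW a0).
pose Bl := [set D : 'rV[R]_n | `|D| <= M].
have Bl0 : Bl !=set0 by exists 0; rewrite /Bl /= normr0.
have Blc : compact Bl.
  apply: bounded_closed_compact.
    exists M; split; first exact: num_real.
    by move=> M' M'M D /le_trans; apply; exact: ltW.
  rewrite (_ : Bl = (fun D : 'rV[R]_n => `|D|) @^-1` [set x | x <= M])//.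
  apply: preimage_closed => [x _|]; last exact: closed_le.
  exact: norm_continuous.
have [D /set_mem DB Dmin] := EVT_min_rV Bl0 Blc
  (continuous_subspaceT (@diag_potential_continuous S d)).
exists D => D'; have [D'B|D'B] := leP `|D'| M.
  by apply: Dmin; rewrite inE.
apply: (@le_trans _ _ (diag_potential S d 0)).
  by apply: Dmin; rewrite inE /Bl /= normr0.
apply: le_trans (aC D'); move: D'B; rewrite /M ltr_pdivrMl// => /ltW H.
rewrite (le_trans (ler_norm _))// lerBrDr (le_trans _ H)// lerD2l.
exact: ler_norm.
Qed.

(* Klein's inequality at a perturbed point bounds the difference quotients of
   the potential, so no derivative of the trace is needed. *)
Lemma diag_solution_exists S (d : 'rV[R]_n) : S^T = S -> (forall i, 0 < d 0 i) ->
  exists D : 'rV[R]_n, forall i, expm (S + diag_mx D) i i = d 0 i.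
Proof.
move=> Ss d0; have [D Dmin] := diag_potential_min Ss d0; exists D => i.
have Ds (F : 'rV[R]_n) : (S + diag_mx F)^T = S + diag_mx F.
  by rewrite linearD /= Ss tr_diag_mx.
have diag_delta : diag_mx (delta_mx 0 i : 'rV[R]_n) = delta_mx i i.
  apply/matrixP => j k; rewrite !mxE eqxx /=.
  case: (j =P k) => [->|jk]; first by rewrite mulr1n andbb.
  rewrite mulr0n; case: (j =P i) => [ji|//]; case: (k =P i) => // ki.
  by case: jk; rewrite ji ki.
pose f (c : R) (t : R) := expm (S + diag_mx D + t *: (c *: delta_mx i i)) i i : R.
(* The directions c = 1 and c = -1 give the two inequalities between the diagonal entry and [d 0 i]
   as t tends to 0 from the right. *)
have key c t : 0 < t -> 0 <= c * (f c t - d 0 i).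
  move=> t0; set D' := D + (t * c) *: delta_mx 0 i.
  have D'E : S + diag_mx D' = S + diag_mx D + t *: (c *: delta_mx i i).
    by rewrite /D' linearD linearZ /= diag_delta addrA scalerA.
  (* Klein at D' bounds the growth of the trace from D to D' from above, minimality of D bounds it
     from below. *)
  have := klein (Ds D') (Ds D); have := Dmin D'.
  rewrite /diag_potential => h1 h2.
  have trE : \tr (expm (S + diag_mx D') *m (S + diag_mx D - (S + diag_mx D'))) =
      - (t * c) * f c t.
    have -> : S + diag_mx D - (S + diag_mx D') = - (t * c) *: delta_mx i i.
      by rewrite D'E opprD addNKr -scaleNr scalerA mulNr.
    rewrite -scalemxAr linearZ /= /f -D'E; congr (_ * _).
    rewrite /mxtrace (bigD1 i)//= big1 ?addr0.
      rewrite mxE (bigD1 i)//= big1 ?addr0 => [|k ki]; first by rewrite mxE !eqxx mulr1.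
      by rewrite mxE (negbTE ki) mulr0.
    move=> j ji; rewrite mxE big1// => k _.
    by rewrite mxE [j == i](negbTE ji) andbF mulr0.
  have sE : \sum_j d 0 j * D' 0 j = \sum_j d 0 j * D 0 j + t * c * d 0 i.
    rewrite /D' (eq_bigr (fun j => d 0 j * D 0 j + d 0 j * (t * c * (j == i)%:R))).
      rewrite big_split /=; congr (_ + _).
      rewrite (bigD1 i)//= big1 ?addr0; first by rewrite eqxx mulr1 mulrC.
      by move=> j ji; rewrite (negbTE ji) !mulr0.
    by move=> j _; rewrite !mxE eqxx /= mulrDr.
  rewrite trE in h2; rewrite sE in h1.
  have : 0 <= t * (c * (f c t - d 0 i)) by lra.
  by rewrite pmulr_rge0.
have fc c : f c t @[t --> 0^'+] --> expm (S + diag_mx D) i i.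
  apply: cvg_at_right_filter.
  have gc : (fun t : R => S + diag_mx D + t *: (c *: delta_mx i i)) @ (0 : R) -->
      S + diag_mx D + 0 *: (c *: delta_mx i i).
    have sc := @scalel_continuous R 'M[R]_n (c *: delta_mx i i).
    exact: (@cvgD _ 'M[R]_n _ (nbhs (0 : R)) (nbhs_filter _)
      (fun=> S + diag_mx D) _ _ _ (cvg_cst _) (sc 0)).
  have ec := cvg_comp _ _ gc (@expm_continuous R n _).
  have := cvg_comp _ _ ec (@coord_continuous R n n i i _).
  by rewrite scale0r addr0.
apply/eqP; rewrite eq_le; apply/andP; split.
  apply: (cvgr_to_le (fc (-1))); near=> t.
  have /key : 0 < t by near: t; exact: nbhs_right_gt.
  by move=> /(_ (-1)); rewrite mulN1r oppr_ge0 subr_le0.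
apply: (cvgr_to_ge (fc 1)); near=> t.
have /key : 0 < t by near: t; exact: nbhs_right_gt.
by move=> /(_ 1); rewrite mul1r subr_ge0.
Unshelve. all: by end_near. Qed.

(** X - Y is diagonal, so its pairing with expm X - expm Y sees only the equal diagonals and
    vanishes; strong monotonicity then forces X = Y. *)
Lemma diag_solution_unique X Y : X^T = X -> Y^T = Y -> off X = off Y ->
  (forall i, expm X i i = expm Y i i) -> X = Y.
Proof.
move=> Xs Ys oXY dXY; apply/eqP; rewrite -subr_eq0 -normr_le0.
pose m := Num.max (n%:R * `|X|) (n%:R * `|Y|).
have XYd : X - Y = diagpart (X - Y).
  rewrite -[LHS]off_diagpartK; suff -> : off (X - Y) = 0 by rewrite add0r.
  apply/matrixP => i j; have /matrixP/(_ i j) := oXY.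
  by rewrite !offE !mxE; case: eqP => // _ ->; rewrite subrr.
have tr0 : \tr ((expm X - expm Y) *m (X - Y)) = 0.
  rewrite XYd tr_mul_diagpart (_ : diagpart (expm X - expm Y) = 0).
    by rewrite mul0mx linear0.
  by apply/matrixP => i j; rewrite diagpartE !mxE dXY subrr mul0rn.
have := @expm_monotone R _ X Y m Xs Ys.
rewrite !le_max !lexx orbT tr0 => /(_ isT isT).
rewrite pmulr_rle0 ?expR_gt0// tr_mx_sqr; last by rewrite linearB /= Xs Ys.
move=> /(le_trans (mx_norm_sqr_le _)).
by rewrite le_eqVlt ltNge sqr_ge0 orbF sqrf_eq0 => /eqP ->.
Qed.

(** A single matrix carries both data: off its diagonal the matrix to be corrected, symmetrised, and
    on its diagonal the target diagonal of the exponential. *)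
Definition diag_corr Y : 'rV[R]_n :=
  xget 0 [set D | forall i, expm (symp (off Y) + diag_mx D) i i = Y i i].

Definition PosDiag : set 'M[R]_n := [set Y | forall i, 0 < Y i i].

Lemma diag_corrP Y : PosDiag Y ->
  forall i, expm (symp (off Y) + diag_mx (diag_corr Y)) i i = Y i i.
Proof.
move=> Y0; rewrite /diag_corr; case: xgetP => [D _ //|h].
have [|D HD] := @diag_solution_exists (symp (off Y)) (\row_i Y i i) (symp_sym _).
  by move=> i; rewrite mxE.
by have /= [] := h D; move=> i; rewrite HD mxE.
Qed.

(* invD is inverse to thD, and S + calD S = invD (S + 1) for S in Hol: this is
   how the smoothness of calD follows from the inverse function theorem. *)
Definition thD X : 'M[R]_n := off X + diagpart (expm (symp X)).
Definition invD Y : 'M[R]_n := off Y + diag_mx (diag_corr Y).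

Lemma symp_diag_mx (D : 'rV[R]_n) : symp (diag_mx D) = diag_mx D.
Proof. by rewrite symp_id// tr_diag_mx. Qed.

Lemma offD A B : off (A + B) = off A + off B.
Proof. by apply/matrixP => i j; rewrite !(offE, mxE); case: eqP; rewrite ?addr0. Qed.

Lemma off_invD Y : off (invD Y) = off Y.
Proof. by rewrite /invD offD off_off off_diag_mx addr0. Qed.

Lemma invDK Y : PosDiag Y -> thD (invD Y) = Y.
Proof.
move=> Y0; rewrite /thD off_invD -[RHS]off_diagpartK; congr (_ + _).
apply/matrixP => i j; rewrite !diagpartE; congr (_ *+ _).
by rewrite /invD sympD symp_diag_mx diag_corrP.
Qed.

Lemma open_PosDiag : open PosDiag.
Proof.
rewrite openE => Y Y0.
have d0 i : 0 < (\row_i Y i i : 'rV[R]_n) 0 i by rewrite mxE.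
have [e e0 ed] := row_pos_lower_bound d0.
have : \forall Z \near Y, `|Y - Z| < e.
  by have /cvgrPdist_lt/(_ _ e0) := @cvg_id _ (nbhs Y).
apply: filterS => Z YZ i.
have := le_lt_trans (mx_norm_entry (Y - Z) i i) YZ; have := ed i.
rewrite !mxE => ei; rewrite ltr_norml => /andP[_]; lra.
Qed.

Lemma is_diff_thD X :
  is_diff X thD (fun v => off v + diagpart (dexpm (symp X) (symp v))).
Proof.
have d1 := is_diff_mx_linear (expm (symp X)) (@diagpart_linear R n).
have d2 := is_diff_comp (is_diff_expm_symp X) d1.
have d3 := is_diff_mx_linear X (@off_linear R n).
have := is_diffD d3 d2.
by [].
Qed.

Lemma Ck_thD k O : open O -> Ck k O thD.
Proof.
move=> Oo; apply: (@CkD _ _ _ _ _ (@off R n) (@diagpart R n \o (expm \o symp))) => //.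
  by apply: Ck_mx_linear; exact: off_linear.
apply: (@Ck_comp _ _ _ _ _ _ setT) => //; first exact: Ck_expm_symp.
by apply: Ck_mx_linear; exact: diagpart_linear.
Qed.

End DiagonalCorrection.

(** * Diagonal correction: continuity and smoothness *)

Section DiagonalCorrectionSmooth.
Context {R : realType} {n : nat}.
Implicit Types A B W X Y S : 'M[R]_n.

Lemma expm_norm_le_trace X : X^T = X -> `|expm X| <= \tr (expm X).
Proof.
move=> Xs; apply: mx_norm_le => [|i j]; last exact: expm_entry_le_trace.
rewrite /mxtrace sumr_ge0// => i _.
by rewrite (le_trans (expR_ge0 _) (expR_le_expm_diag i Xs)).
Qed.

Lemma expm_invD_diag Y i : PosDiag Y -> expm (symp (invD Y)) i i = Y i i.
Proof.
move=> /invDK/matrixP/(_ i i).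
by rewrite /thD mxE offE eqxx add0r diagpartE eqxx mulr1n.
Qed.

(** If X and X0 were far apart, [expm_gap] would bound d |X - X0| by the trace pairing. The diagonal
    part of the pairing is small since the exponentials have the diagonals of Z and Y; the
    off-diagonal part is small since off (X - X0) comes from Z - Y and the exponentials stay
    bounded. *)
Lemma invD_near Y (e : R) : PosDiag Y -> 0 < e ->
  exists2 d : R, 0 < d & forall Z, PosDiag Z -> `|Z - Y| < d -> `|invD Z - invD Y| < e.
Proof.
move=> Y0 e0; pose X0 := symp (invD Y).
have X0s : X0^T = X0 by exact: symp_sym.
have e2 : 0 < e / 2 by rewrite divr_gt0.
have [d d0 gap] := expm_gap X0s e2.
(* [C] bounds the difference of the two exponentials: each is at most its trace, hence at most n
   (|Y| + 1) when |Z - Y| < 1. *)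
pose N : R := n%:R ^+ 2; pose C := 2 * (n%:R * (`|Y| + 1)).
have N0 : 0 <= N by rewrite exprn_ge0.
have C0 : 0 <= C by rewrite !mulr_ge0// addr_ge0.
pose K := N * (1 + C / (e / 2)) + 1.
have K0 : 0 < K by rewrite ltr_wpDl// mulr_ge0// addr_ge0// divr_ge0// ltW.
exists (Num.min (Num.min 1 (e / 2)) (d / K)).
  by rewrite !lt_min ltr01 e2 divr_gt0.
move=> Z Z0; rewrite !lt_min => /andP[/andP[ZY1 ZYe] ZYd].
pose X := symp (invD Z).
have Xs : X^T = X by exact: symp_sym.
have trE W : PosDiag W -> \tr (expm (symp (invD W))) = \sum_i W i i.
  by move=> W0; rewrite /mxtrace; apply: eq_bigr => i _; rewrite expm_invD_diag.
have nE W : PosDiag W -> `|W| <= `|Y| + 1 ->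
    `|expm (symp (invD W))| <= n%:R * (`|Y| + 1).
  move=> W0 W1; rewrite (le_trans (expm_norm_le_trace (symp_sym _)))// trE//.
  rewrite (@le_trans _ _ (\sum_(i < n) (`|Y| + 1)))//.
    apply: ler_sum => i _; rewrite (le_trans _ W1)//.
    by rewrite (le_trans (ler_norm _))// mx_norm_entry.
  by rewrite sumr_const card_ord mulr_natl.
have nXX0 : `|expm X - expm X0| <= C.
  rewrite (le_trans (ler_normB _ _))// /C mulr_natl mulr2n lerD// nE ?lerDl//.
  rewrite -[Z](subrK Y) (le_trans (ler_normD _ _))// addrC lerD2l ltW//.
have oXX0 : off (X - X0) = symp (off (Z - Y)).
  rewrite /X /X0 -symp_linB off_symp; congr symp.
  by apply/matrixP => i j; have /matrixP/(_ i j) := off_invD Z;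
     have /matrixP/(_ i j) := off_invD Y; rewrite !(offE, mxE);
     case: eqP => // _ -> ->.
have XX0e : `|X - X0| < e / 2.
  rewrite ltNge; apply/negP => le_e; have := gap _ Xs le_e.
  apply/negP; rewrite -ltNge.
  have XX0_gt0 : 0 < `|X - X0| by exact: lt_le_trans le_e.
  have -> : \tr ((expm X - expm X0) *m (X - X0)) =
      \tr (diagpart (Z - Y) *m diagpart (X - X0)) +
      \tr ((expm X - expm X0) *m off (X - X0)).
    have dZY : diagpart (Z - Y) = diagpart (expm X - expm X0).
      apply/matrixP => i j; rewrite !diagpartE; congr (_ *+ _).
      rewrite [LHS]mxE [RHS]mxE [X in _ + X]mxE [X in _ = _ + X]mxE.
      exact: esym (congr2 (fun u v => u - v) (expm_invD_diag i Z0) (expm_invD_diag i Y0)).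
    by rewrite dZY -tr_mul_diagpart -linearD -mulmxDr [diagpart _ + _]addrC off_diagpartK.
  have b1 : \tr (diagpart (Z - Y) *m diagpart (X - X0)) <=
      N * `|Z - Y| * `|X - X0|.
    rewrite (le_trans (ler_norm _))// (le_trans (tr_mul_le _ _))//.
    rewrite ler_pM ?mulr_ge0 ?diagpart_norm//.
    by rewrite ler_wpM2l// diagpart_norm.
  have b2 : \tr ((expm X - expm X0) *m off (X - X0)) <= N * C * `|Z - Y|.
    rewrite (le_trans (ler_norm _))// (le_trans (tr_mul_le _ _))//.
    rewrite ler_pM ?mulr_ge0//; first by rewrite ler_wpM2l.
    by rewrite oXX0 (le_trans (symp_norm _))// off_norm.
  apply: (le_lt_trans (lerD b1 b2)).
  (* The off-diagonal term has no factor |X - X0|; the assumption |X - X0| >= e / 2 supplies it. *)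
  have b3 : N * C * `|Z - Y| <= N * (C / (e / 2)) * `|Z - Y| * `|X - X0|.
    rewrite [leRHS]mulrAC ler_wpM2r// -[leRHS]mulrA ler_wpM2l//.
    by rewrite mulrAC ler_pdivlMr// ler_wpM2l.
  apply: (@le_lt_trans _ _ (N * (1 + C / (e / 2)) * `|Z - Y| * `|X - X0|)).
    by rewrite mulrDr mulr1 !mulrDl lerD2l.
  rewrite ltr_pM2r//; move: ZYd; rewrite ltr_pdivlMr// mulrC; apply: le_lt_trans.
  by rewrite ler_wpM2r// /K lerDl.
have -> : invD Z - invD Y = off (Z - Y) + diagpart (X - X0).
  rewrite -[LHS]off_diagpartK; congr (_ + _).
    apply/matrixP => i j; have /matrixP/(_ i j) := off_invD Z.
    by have /matrixP/(_ i j) := off_invD Y; rewrite !(offE, mxE); case: eqP => // _ -> ->.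
  by rewrite /X /X0 -symp_linB diagpart_symp.
rewrite (le_lt_trans (ler_normD _ _))// [ltRHS]splitr ltrD//.
  by rewrite (le_lt_trans (off_norm _)).
by rewrite (le_lt_trans (diagpart_norm _)).
Qed.

Lemma invD_continuous Y : PosDiag Y -> {for Y, continuous (@invD R n)}.
Proof.
move=> Y0; suff H : forall e : R, 0 < e -> \forall Z \near Y, `|invD Y - invD Z| < e.
  exact: (@cvgrPdist_lt _ 'M[R]_n _ (nbhs Y) (nbhs_filter Y) _ _).2.
move=> e e0; have [d d0 dH] := invD_near Y0 e0.
have H1 : \forall Z \near Y, PosDiag Z.
  exact: (open_nbhs_nbhs (conj open_PosDiag Y0)).
have H2 : \forall Z \near Y, `|Y - Z| < d.
  by have /cvgrPdist_lt/(_ _ d0) := @cvg_id _ (nbhs Y).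
by apply: filterS2 H1 H2 => Z Z0 YZ; rewrite distrC; apply: dH => //; rewrite distrC.
Qed.

(** The image u of v has the off-diagonal part of v and the diagonal of [dexpm (symp X) (symp v)].
    Pairing the latter matrix with [symp v] thus meets a factor from u on and off the diagonal, and
    coercivity bounds [symp v] by u. *)
Lemma thD_diff_bound X0 : exists2 c : R, 0 < c &
  \forall X \near X0, forall v, c * `|v| <= `|'d (@thD R n) X v|.
Proof.
pose r : R := n%:R * (`|X0| + 2); pose c := expR (- r).
have c0 : 0 < c by exact: expR_gt0.
(* Meets the side conditions of [dexpm_norm]; [L] is then an operator bound for the derivative,
   uniform near X0. *)
pose r' : R := 1 + n%:R + r; pose L := expR (2 * r').
have r0 : 0 <= r by rewrite mulr_ge0// addr_ge0.
pose N : R := n%:R ^+ 2.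
have N0 : 0 <= N by rewrite exprn_ge0.
have L0 : 0 <= L by exact: expR_ge0.
pose K := 1 + c^-1 * (N * (1 + L)).
have K0 : 0 < K.
  by rewrite ltr_pwDl// mulr_ge0 ?invr_ge0 ?(ltW c0)// mulr_ge0// addr_ge0.
exists K^-1; first by rewrite invr_gt0.
near=> X => v; have [_ ->] := is_diff_thD X.
set w := dexpm (symp X) (symp v); set u := off v + diagpart w.
have rX : n%:R * (`|symp X| + 1) <= r.
  rewrite ler_wpM2l// -lerBrDr (_ : _ - 1 = `|X0| + 1); last by ring.
  by near: X; exact: near_symp_norm.
have wL : `|w| <= `|symp v| * L.
  apply: dexpm_norm; first by rewrite /r' -addrA lerDl addr_ge0.
    by rewrite /r' addrAC lerDr addr_ge0.
  rewrite (@le_trans _ _ r)//; last by rewrite /r' lerDr addr_ge0.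
  by rewrite (le_trans _ rX)// ler_wpM2l// lerDl.
have ou : off u = off v.
  by rewrite /u offD off_off (_ : off (diagpart w) = 0) ?addr0// /diagpart off_diag_mx.
have du : diagpart u = diagpart w.
  by apply/matrixP => i j; rewrite !(diagpartE, offE, mxE) !eqxx add0r.
have sv : `|symp v| <= c^-1 * (N * (1 + L)) * `|u|.
  have [->|v0] := eqVneq (symp v) 0.
    by rewrite normr0 !mulr_ge0 ?invr_ge0 ?(ltW c0)// addr_ge0.
  have := dexpm_lower_bound (symp_sym X) rX (symp_sym v).
  rewrite -/w -/c -[X in w *m X]off_diagpartK mulmxDr linearD /= tr_mul_diagpart -du.
  have b1 : \tr (w *m off (symp v)) <= N * (`|symp v| * L) * `|u|.
    rewrite (le_trans (ler_norm _))// (le_trans (tr_mul_le _ _))//.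
    rewrite ler_pM ?mulr_ge0//; first by rewrite ler_wpM2l.
    by rewrite off_symp -ou (le_trans (symp_norm _))// off_norm.
  have b2 : \tr (diagpart u *m diagpart (symp v)) <= N * `|u| * `|symp v|.
    rewrite (le_trans (ler_norm _))// (le_trans (tr_mul_le _ _))//.
    rewrite ler_pM ?mulr_ge0 ?diagpart_norm//.
    by rewrite ler_wpM2l// diagpart_norm.
  move=> /le_trans/(_ (lerD b1 b2)).
  have -> : N * (`|symp v| * L) * `|u| + N * `|u| * `|symp v| =
    (N * (1 + L) * `|u|) * `|symp v| by ring.
  rewrite expr2 mulrA ler_pM2r ?normr_gt0// => H.
  by rewrite -mulrA -ler_pdivrMl ?invr_gt0// invrK.
have vE : `|v| <= `|off v| + `|symp v|.
  rewrite -{1}[v]off_diagpartK (le_trans (ler_normD _ _))// lerD2l.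
  by rewrite -diagpart_symp diagpart_norm.
rewrite ler_pdivrMl// (le_trans vE)// /K mulrDl mul1r lerD//.
by rewrite -ou off_norm.
Unshelve. all: by end_near. Qed.

Lemma Ck_invD k : Ck k.+1 PosDiag (@invD R n).
Proof.
apply: (@Ck_inverse _ _ _ _ (@thD R n) _ setT).
- exact: openT.
- exact: open_PosDiag.
- by [].
- exact: invDK.
- exact: invD_continuous.
- by apply: Ck_thD; exact: openT.
- by move=> X _; exact: thD_diff_bound.
- move=> X _; have [c c0 /nbhs_singleton cX] := thD_diff_bound X.
  apply: mx_linear_inj_surj => [a u v|v v0]; first exact: linearP.
  by have := cX v; rewrite v0 normr0 pmulr_rle0// normr_le0 => /eqP.
Qed.

End DiagonalCorrectionSmooth.

(** * The chart, its inverse and their smooth extensions *)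

Section PhiMap.
Context {R : realType} {n : nat}.
Implicit Types (S L Y A B : 'M[R]_n) (p q : 'M[R]_n * 'M[R]_n).

Definition HolDiag : set ('M[R]_n * 'M[R]_n) := [set p | Hol p.1 /\ is_diag_mx p.2].

Lemma is_diag_diagpart A : is_diag_mx A -> diagpart A = A.
Proof. by move=> /diag_mxP[d ->]; exact: diagpart_diag_mx. Qed.

Lemma diagpartD A B : diagpart (A + B) = diagpart A + diagpart B.
Proof. by apply/matrixP => i j; rewrite !(diagpartE, mxE) mulrnDl. Qed.

Lemma Hol_off S : Hol S -> off S = S.
Proof. by move=> [_ S0]; apply/matrixP => i j; rewrite offE; case: eqP => // ->. Qed.

Lemma off_Hol A : A^T = A -> Hol (off A).
Proof.
move=> As; split; last by move=> i; rewrite offE eqxx.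
by rewrite /Sym /= /off linearB /= As diagpart_sym.
Qed.

Lemma Hol_PosDiag S : Hol S -> PosDiag (S + 1%:M).
Proof. by move=> [_ S0] i; rewrite !mxE S0 add0r eqxx. Qed.

Lemma calD_Hol S : Hol S -> calD S = diag_mx (diag_corr (S + 1%:M)).
Proof.
move=> Sh; have [Ss S0] := Sh.
have oS : symp (off (S + 1%:M)) = S.
  by rewrite offD -diag_const_mx off_diag_mx addr0 Hol_off// symp_id.
have D0s (d : 'rV[R]_n) : (S + diag_mx d)^T = S + diag_mx d.
  by rewrite linearD /= Ss tr_diag_mx.
have D0i i : expm (S + diag_mx (diag_corr (S + 1%:M))) i i = 1.
  by have := diag_corrP (Hol_PosDiag Sh) i; rewrite oS !mxE S0 add0r eqxx.
apply: xget_unique => [|D [/diag_mxP[d ->] [_ Di]]].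
  by split; [exact: diag_mx_is_diag|split => //; exact: SPD_expm].
apply: (addrI S); apply: diag_solution_unique => //; first by rewrite !offD !off_diag_mx.
by move=> i; rewrite Di D0i.
Qed.

Lemma calD_HolP S : Hol S -> is_diag_mx (calD S) /\ Cor (expm (S + calD S)).
Proof.
move=> Sh; have [Ss S0] := Sh; rewrite calD_Hol//.
split; first exact: diag_mx_is_diag.
split; first by apply: SPD_expm; rewrite linearD /= Ss tr_diag_mx.
move=> i; have := diag_corrP (Hol_PosDiag Sh) i.
by rewrite offD -diag_const_mx off_diag_mx addr0 Hol_off// symp_id// !mxE S0 add0r eqxx.
Qed.

Lemma calD_unique S L : Hol S -> L^T = L -> off L = S ->
  (forall i, expm L i i = 1) -> L = S + calD S.
Proof.
move=> Sh Ls oL L1; have [/diag_mxP[d dE] [_ Si]] := calD_HolP Sh.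
apply: diag_solution_unique => //.
- by rewrite dE linearD /= tr_diag_mx Sh.1.
- by rewrite dE offD off_diag_mx addr0 (Hol_off Sh).
- by move=> i; rewrite L1 Si.
Qed.

(** The explicit inverse chart; [Phi_invE] identifies it with [Phi_inv] on [HolDiag]. *)
Definition Psi p : 'M[R]_n := expm (p.1 + calD p.1 + p.2).

Lemma is_diag_mx_sym A : is_diag_mx A -> A^T = A.
Proof. by move=> /diag_mxP[d ->]; exact: tr_diag_mx. Qed.

Lemma Phi_HolDiag Y : SPD Y -> HolDiag (Phi Y).
Proof.
move=> /logmK[Ls _]; have Sh := off_Hol Ls; split => //=.
have [/diag_mxP[d ->] _] := calD_HolP Sh.
by rewrite /diagpart -linearB /=; exact: diag_mx_is_diag.
Qed.

Lemma HolDiag_sym p : HolDiag p -> (p.1 + calD p.1 + p.2)^T = p.1 + calD p.1 + p.2.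
Proof.
move=> [Sh /is_diag_mx_sym ds]; have [/is_diag_mx_sym Ds _] := calD_HolP Sh.
by rewrite !linearD /= Sh.1 Ds ds.
Qed.

Lemma PsiK p : HolDiag p -> SPD (Psi p) /\ Phi (Psi p) = p.
Proof.
move=> pHD; have ps := HolDiag_sym pHD; split; first exact: SPD_expm.
have [Sh /is_diag_diagpart pd] := pHD; have [/is_diag_diagpart Dd _] := calD_HolP Sh.
have oD : off (calD p.1) = 0 by rewrite -Dd off_diag_mx.
have oP : off p.2 = 0 by rewrite -pd off_diag_mx.
rewrite /Phi /Psi logmE// !offD (Hol_off Sh) oD oP !addr0 [in RHS](surjective_pairing p).
congr (_, _); rewrite !diagpartD -{1}(Hol_off Sh) diagpart_off Dd pd.
by rewrite add0r [calD _ + _]addrC addrK.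
Qed.

Lemma PhiK Y : SPD Y -> Psi (Phi Y) = Y.
Proof.
move=> /logmK[Ls LE]; rewrite -{2}LE /Psi /Phi /=; congr expm.
by rewrite addrACA subrr addr0 off_diagpartK.
Qed.

Lemma Phi_invK Y : SPD Y -> Phi_inv (Phi Y) = Y.
Proof.
move=> Y0; have inj : {in (@SPD R n) &, injective (@Phi R n)}.
  by move=> U W /set_mem U0 /set_mem W0 UW; rewrite -(PhiK U0) UW PhiK.
exact: (pinvKV (fun=> 0) inj (mem_set Y0)).
Qed.

Lemma Phi_invE p : HolDiag p -> Phi_inv p = Psi p.
Proof. by move=> /PsiK[P0 {1}<-]; exact: Phi_invK. Qed.

(** By uniqueness of the correction, a unit diagonal of Y = expm L means that the diagonal of L is
    the correction of its off-diagonal part. *)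
Lemma Cor_Phi Y : SPD Y -> Cor Y <-> (Phi Y).2 = 0.
Proof.
move=> Y0; have [Ls LE] := logmK Y0; split=> [[_ Yi]|P0].
  have Sh := off_Hol Ls.
  have := calD_unique Sh Ls (erefl _) _; rewrite LE => /(_ Yi) LD.
  by rewrite /Phi /=; apply/eqP; rewrite subr_eq0 -(inj_eq (addrI (off (logm Y)))) off_diagpartK -LD.
rewrite -(PhiK Y0) /Psi P0 addr0.
by have [] := calD_HolP (Phi_HolDiag Y0).1.
Qed.

Lemma HolDiag_comb p q (a b : R) : HolDiag p -> HolDiag q ->
  HolDiag (a *: p + b *: q).
Proof.
move=> [[ps p0] /diag_mxP[d dE]] [[qs q0] /diag_mxP[e eE]]; split; last first.
  by rewrite /= dE eE -!linearZ -linearD /=; exact: diag_mx_is_diag.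
split=> [|i]; first by rewrite /Sym /= linearD /= !linearZ /= ps qs.
by rewrite !mxE p0 q0 !mulr0 addr0.
Qed.

Lemma inner_HolDiag p : HolDiag p ->
  inner p p = frobenius p.1 ^+ 2 + frobenius p.2 ^+ 2.
Proof.
have frob A : A^T = A -> \tr (A *m A) = frobenius A ^+ 2.
  move=> As; rewrite tr_mx_sqr// sqr_sqrtr//.
  by apply: sumr_ge0 => i _; apply: sumr_ge0 => j _; exact: sqr_ge0.
by move=> [[ps _] /is_diag_mx_sym ds]; rewrite /inner !frob.
Qed.

Lemma inner_ge0 p : HolDiag p -> 0 <= inner p p.
Proof. by move=> /inner_HolDiag ->; rewrite addr_ge0// sqr_ge0. Qed.

Lemma inner_eq0 p : HolDiag p -> inner p p = 0 -> p = 0.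
Proof.
move=> [[ps _] /is_diag_mx_sym ds]; rewrite /inner !tr_mx_sqr// => /eqP.
have sq0 A : 0 <= \sum_i \sum_j A i j ^+ 2 by exact: le_trans (sqr_ge0 _) (mx_norm_sqr_le A).
rewrite paddr_eq0// => /andP[/eqP p1 /eqP p2].
have nz A : \sum_i \sum_j A i j ^+ 2 = 0 -> A = 0.
  move=> A0; have := mx_norm_sqr_le A; rewrite A0 le_eqVlt ltNge sqr_ge0 orbF.
  by rewrite sqrf_eq0 normr_eq0 => /eqP.
by rewrite [p]surjective_pairing (nz _ p1) (nz _ p2).
Qed.

Lemma Ck_mx_affine k m (W : normedModType R) (O : set W) (f : W -> 'M[R]_m) (a : 'M[R]_m) :
  open O -> Ck k O f -> Ck k O (fun x => f x + a).
Proof. by move=> Oo fk; exact: (CkD Oo fk (Ck_cst k O a)). Qed.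

Lemma Ck_comp_mx_linear k (V W : normedModType R) (O : set V) m (f : V -> 'M[R]_m) (g : 'M[R]_m -> W) :
  open O -> Ck k O f -> linear g -> Ck k O (g \o f).
Proof.
move=> Oo fk gl.
exact: (@Ck_comp _ _ _ _ _ _ setT f g Oo (fun _ _ => I) fk (Ck_mx_linear k setT gl)).
Qed.

Lemma PosDiag_off1 Y : PosDiag (off Y + 1%:M).
Proof. by move=> i; rewrite !mxE !eqxx subrr add0r. Qed.

(* calDs, PsiS and PhiS coincide with calD, Psi and Phi on Hol, HolDiag and Sym
   but are smooth on open sets. *)
Definition calDs Y : 'M[R]_n := invD (off Y + 1%:M) - off Y.

Lemma calDsE S : Hol S -> calDs S = calD S.
Proof.
move=> Sh; rewrite /calDs Hol_off// calD_Hol// /invD.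
by rewrite offD -diag_const_mx off_diag_mx addr0 Hol_off// [S + _]addrC addrK.
Qed.

Lemma Ck_calDs k : Ck k.+1 setT calDs.
Proof.
have off_k : Ck k.+1 setT (@off R n) := Ck_mx_linear _ _ (@off_linear R n).
have off_k1 := Ck_mx_affine (1%:M) openT off_k.
have inv_k := @Ck_comp _ _ _ _ _ setT PosDiag _ (@invD R n) openT
  (fun Y _ => PosDiag_off1 Y) off_k1 (Ck_invD k).
have offN_lin : linear (fun Y => - off Y).
  by move=> a u v; rewrite off_linear opprD scalerN.
exact: (CkD openT inv_k (Ck_mx_linear k.+1 setT offN_lin)).
Qed.

Definition PhiS Y := Phi (symp Y).

Definition PsiS p : 'M[R]_n := expm (p.1 + calDs p.1 + p.2).

Lemma PsiSE p : HolDiag p -> PsiS p = Psi p.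
Proof. by move=> [Sh _]; rewrite /PsiS calDsE. Qed.

Lemma Ck_PsiS k : Ck k.+1 setT PsiS.
Proof.
have f1 : Ck k.+1 setT (@fst 'M[R]_n 'M[R]_n) := @Ck_fst _ k.+1 _ _ setT.
have f2 : Ck k.+1 setT (@snd 'M[R]_n 'M[R]_n) := @Ck_snd _ k.+1 _ _ setT.
have f3 := @Ck_comp _ _ _ _ _ setT setT _ _ openT (fun _ _ => I) f1 (Ck_calDs k).
have f4 := CkD openT (CkD openT f1 f3) f2.
exact: (@Ck_comp _ _ _ _ _ setT setT _ _ openT (fun _ _ => I) f4 (Ck_expm k.+1 setT)).
Qed.

Definition PhiL L : 'M[R]_n * 'M[R]_n := (off L, diagpart L - calDs (off L)).

Lemma PhiSE Y : SymSPD Y -> PhiS Y = PhiL (symp (logS Y)).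
Proof.
move=> Y0; rewrite symp_logS// /PhiS /Phi /PhiL calDsE//.
by apply: off_Hol; have [] := logmK Y0.
Qed.

Lemma Ck_PhiS k : Ck k.+1 SymSPD PhiS.
Proof.
have off_k : Ck k.+1 setT (@off R n) := Ck_mx_linear _ _ (@off_linear R n).
have dg_k : Ck k.+1 setT (@diagpart R n) := Ck_mx_linear _ _ (@diagpart_linear R n).
have f3 := @Ck_comp _ _ _ _ _ setT setT _ _ openT (fun _ _ => I) off_k (Ck_calDs k).
have N_lin : linear (fun Y : 'M[R]_n => - Y) by move=> a u v; rewrite opprD scalerN.
have f4 := CkD openT dg_k (Ck_comp_mx_linear openT f3 N_lin).
have Lk : Ck k.+1 setT PhiL := Ck_pair openT off_k f4.
have sl := Ck_comp_mx_linear open_SymSPD (Ck_logS k) (@symp_linear R n).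
have := @Ck_comp _ _ _ _ _ SymSPD setT _ _ open_SymSPD (fun _ _ => I) sl Lk.
by apply: Ck_eq open_SymSPD _ => Y /set_mem Y0; rewrite PhiSE.
Qed.

Lemma SPD_SymSPD Y : SPD Y -> SymSPD Y.
Proof. by move=> Y0; rewrite /SymSPD /= symp_id//; have [] := Y0. Qed.

Lemma PhiS_id Y : Y^T = Y -> PhiS Y = Phi Y.
Proof. by move=> Ys; rewrite /PhiS symp_id. Qed.

End PhiMap.

(** * Derivatives along curves and symmetry of second derivatives *)

Section Curves.
Context {R : realType}.
Implicit Types V W : normedModType R.

(** A directional derivative depends only on the values along the line. This is what allows [Phi],
    known on symmetric matrices, to be compared with its extension. *)
Lemma near_eq_line_derive V W (f g : V -> W) x v :
  (\forall h \near (0 : R), f (h *: v + x) = g (h *: v + x)) ->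
  'D_v f x = 'D_v g x.
Proof.
move=> fg; have fgx : f x = g x.
  by have := nbhs_singleton fg; rewrite scale0r add0r.
have fg' : \forall h \near (0 : R)^',
    h^-1 *: (f (h *: v + x) - f x) = h^-1 *: (g (h *: v + x) - g x).
  by apply: (nbhs_dnbhs); apply: filterS fg => h ->; rewrite fgx.
rewrite /derive; congr (lim _); apply/seteqP; split.
  by apply: near_eq_cvg; apply: filterS fg' => h /= ->.
by apply: near_eq_cvg; apply: filterS fg' => h /= ->.
Qed.

Lemma derive_line V W (f : V -> W) x v :
  'D_v f x = (fun h : R => f (h *: v + x))^`() 0.
Proof.
rewrite derive1E /derive; set d := (fun h : R => h^-1 *: _); set d' := (fun h : R => h^-1 *: _).
suff -> : d = d' by [].
by apply/funext => h; rewrite /d /d' /= scale0r add0r addr0 [h%:A](mulr1).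
Qed.

Lemma is_derive_comp_diff V W (c : R -> V) (f : V -> W) (t : R) v :
  is_derive t 1 c v -> differentiable f (c t) ->
  is_derive t 1 (f \o c) ('d f (c t) v).
Proof.
move=> [cd <-] fd; have cd' := (derivable1_diffP c t).1 cd.
have fcd := differentiable_comp cd' fd.
apply: DeriveDef; first exact/derivable1_diffP.
by rewrite !deriveE// diff_comp.
Qed.

Lemma is_derive_line V (x v : V) (t : R) :
  is_derive t 1 (fun h : R => h *: v + x) v.
Proof.
have key : (fun h : R => h^-1 *: (((fun h => h *: v + x) \o shift t) h%:A
    - (t *: v + x))) @ (0 : R)^' --> v.
  apply: cvg_near_cst; rewrite near_withinE; near=> h => h0 /=.
  by rewrite [h%:A]mulr1 opprD addrACA subrr addr0 -scalerBl addrK scalerA mulVf// scale1r.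
by apply: DeriveDef; [apply: cvgP key|exact: cvg_lim key].
Unshelve. all: by end_near. Qed.

(* The second difference is symmetric in v and w, so its limit yields the
   symmetry of the second derivative. *)
Lemma second_difference V (h : V -> R) (O : set V) x v w :
  open O -> O x -> (forall y, O y -> differentiable h y) ->
  differentiable (fun y => 'd h y v) x ->
  (fun s : R => s ^- 2 * (h (s *: v + (s *: w + x)) - h (s *: v + x)
     - (h (s *: w + x) - h x))) @ 0^'+ --> 'd (fun y => 'd h y v) x w.
Proof.
move=> Oo Ox hd ad; set a := fun y => 'd h y v; set L := 'd a x.
(* [s * C] bounds the displacements from x, and the two errors eps s C add up to s e. *)
apply/cvgrPdist_le => e e0; pose C := `|v| + `|w| + 1.
have C0 : 0 < C by rewrite ltr_wpDl// addr_ge0.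
pose eps := e / (2 * C); have eps0 : 0 < eps by rewrite divr_gt0 ?mulr_gt0.
have [d d0 dP] : exists2 d : R, 0 < d & forall k, `|k| < d ->
    O (k + x) /\ `|a (k + x) - a x - L k| <= eps * `|k|.
  have On : \forall k \near (0 : V), O (k + x).
    have : \forall y \near x, O y by exact: open_nbhs_nbhs.
    by rewrite (near_shift 0 x) subr0.
  have [d d0 dP] := (nbhs_normP (0 : V) _).1 (filterI On (diff_near_norm ad eps0)).
  by exists d => // k kd; apply: dP; rewrite /ball_ /= sub0r normrN.
have sC0 : 0 < d / C by rewrite divr_gt0.
near=> s.
have s0 : 0 < s by near: s; exact: nbhs_right_gt.
have sd : s * C < d by rewrite -ltr_pdivlMr//; near: s; exact: nbhs_right_lt.
(* The boolean selects u v or u v + s w, so that both displacements are treated at once. *)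
have normb (u : R) (b : bool) : 0 <= u <= s -> `|u *: v + s *: w *+ b| <= s * C.
  move=> /andP[u0 us]; rewrite (le_trans (ler_normD _ _))// normrZ ger0_norm//.
  have : `|s *: w *+ b| <= s * `|w|.
    by case: b; rewrite ?mulr1n ?mulr0n ?normr0 ?normrZ ?gtr0_norm ?mulr_ge0// ltW.
  have : u * `|v| <= s * `|v| by rewrite ler_wpM2r.
  rewrite /C; move: (`|v|) (`|w|) (`| _ |) => nv nw nn; nra.
have nor (u : R) (b : bool) : 0 <= u <= s -> `|u *: v + s *: w *+ b| < d.
  by move=> /(normb u b)/le_lt_trans; apply.
(* The mean value theorem for [phi] turns the second difference into s times a first difference of
   [a], to which differentiability of [a] at x applies. *)
pose phi (u : R) := h (u *: v + (s *: w + x)) - h (u *: v + x).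
pose dphi (u : R) := a (u *: v + (s *: w + x)) - a (u *: v + x).
have phid u : 0 <= u <= s -> is_derive u 1 phi (dphi u).
  move=> us; have O1 := (dP _ (nor u true us)).1; have O2 := (dP _ (nor u false us)).1.
  rewrite /= mulr1n -addrA in O1; rewrite /= mulr0n addr0 in O2.
  have d1 := is_derive_comp_diff (is_derive_line (s *: w + x) v u) (hd _ O1).
  have d2 := is_derive_comp_diff (is_derive_line x v u) (hd _ O2).
  exact: is_deriveB d1 d2.
have [||u uin phiE] := @MVT R phi dphi 0 s s0.
- by move=> u /[1!in_itv]/= /andP[/ltW u0 /ltW us]; apply: phid; rewrite u0.
- apply: derivable_within_continuous => u /[1!in_itv]/= us.
  by have [] := phid u us.
have us : 0 <= u <= s.
  by move: uin; rewrite in_itv/= => /andP[/ltW-> /ltW->].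
have := (dP _ (nor u true us)).2; have := (dP _ (nor u false us)).2.
have := normb u true us; have := normb u false us.
rewrite /= mulr1n mulr0n addr0 -(addrA (u *: v)).
set k1 := u *: v; set k2 := u *: v + s *: w => n1 n2 e1 e2.
have L12 : L k2 - L k1 = s * L w by rewrite -linearB /k2 addrAC subrr add0r linearZ.
have -> : h (s *: v + (s *: w + x)) - h (s *: v + x) - (h (s *: w + x) - h x) =
    phi s - phi 0 by rewrite /phi !scale0r !add0r.
rewrite phiE subr0 /dphi -/k1.
have -> : L w - s ^- 2 * ((a (k1 + (s *: w + x)) - a (k1 + x)) * s) =
   s^-1 * (s * L w - (a (k1 + (s *: w + x)) - a (k1 + x))).
  by field; rewrite gt_eqF.
rewrite normrM gtr0_norm ?invr_gt0// ler_pdivrMl// -L12.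
have -> : L k2 - L k1 - (a (k1 + (s *: w + x)) - a (k1 + x)) =
   (a (k1 + x) - a x - L k1) - (a (k1 + (s *: w + x)) - a x - L k2) by ring.
apply: le_trans (ler_normB _ _) _; apply: le_trans (lerD e1 e2) _.
rewrite -mulrDr (_ : s * e = eps * (s * C + s * C)).
  by rewrite ler_pM2l// lerD.
by rewrite /eps; field; rewrite gt_eqF.
Unshelve. all: by end_near. Qed.

Lemma diff_second_sym V (h : V -> R) (O : set V) x v w :
  open O -> O x -> (forall y, O y -> differentiable h y) ->
  differentiable (fun y => 'd h y v) x -> differentiable (fun y => 'd h y w) x ->
  'd (fun y => 'd h y v) x w = 'd (fun y => 'd h y w) x v.
Proof.
move=> Oo Ox hd vd wd.
pose D v w (s : R) := s ^- 2 * (h (s *: v + (s *: w + x)) - h (s *: v + x)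
  - (h (s *: w + x) - h x)).
have H1 : D v w @ 0^'+ --> _ := second_difference Oo Ox hd vd (w := w).
have H2 : D w v @ 0^'+ --> _ := second_difference Oo Ox hd wd (w := v).
have DE : D v w = D w v.
  apply/funext => s; congr (_ * _); rewrite (addrCA (s *: v)).
  by rewrite !opprB; ring.
by rewrite DE in H1; exact: (cvg_unique _ H1 H2).
Qed.

End Curves.

(** * The constant inner product on pairs of matrices *)

Section InnerProduct.
Context {R : realType} {n : nat}.
Notation MM := ('M[R]_n * 'M[R]_n)%type.
Implicit Types (p q : MM) (P Q : R -> MM).

Lemma innerC p q : inner p q = inner q p.
Proof. by rewrite /inner mxtrace_mulC [X in _ + X]mxtrace_mulC. Qed.

Lemma inner_linear p : linear (inner p : MM -> R).
Proof.
by move=> a u v; rewrite /inner /= !mulmxDr -!scalemxAr !linearD !linearZ /= addrACA.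
Qed.

Lemma inner_bilinear : bilinear_for (GRing.Scale.Law.clone _ _ *:%R _)
  (GRing.Scale.Law.clone _ _ *:%R _) (inner : MM -> MM -> R).
Proof.
split=> [q|p]; last exact: inner_linear.
by move=> a u v; rewrite /= !(innerC _ q) inner_linear.
Qed.

HB.instance Definition _ := bilinear_isBilinear.Build R MM MM R _ _
  (inner : MM -> MM -> R) inner_bilinear.

Lemma tr_mulmx_continuous :
  continuous (fun p : MM => \tr (p.1 *m p.2) : R).
Proof.
have -> : (fun p : MM => \tr (p.1 *m p.2) : R) =
    (fun p => \sum_i (fun i p => \sum_j (fun j p => p.1 i j * p.2 j i) j p) i p).
  by apply/funext => p; apply: eq_bigr => i _; rewrite mxE.
apply: continuous_sum => i; apply: continuous_sum => j p.
apply: (@continuousM _ _ (fun p : MM => p.1 i j) (fun p : MM => p.2 j i)).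
  exact: (continuous_comp (@cvg_fst _ _ _ _ _) (@coord_continuous _ _ _ i j _)).
exact: (continuous_comp (@cvg_snd _ _ _ _ _) (@coord_continuous _ _ _ j i _)).
Qed.

Lemma inner_continuous : continuous (fun x : MM * MM => inner x.1 x.2 : R).
Proof.
have c11 : continuous (fun x : MM * MM => x.1.1).
  by move=> x; apply: (@continuous_comp _ _ _ fst fst); exact: cvg_fst.
have c12 : continuous (fun x : MM * MM => x.1.2).
  by move=> x; apply: (@continuous_comp _ _ _ fst snd); [exact: cvg_fst|exact: cvg_snd].
have c21 : continuous (fun x : MM * MM => x.2.1).
  by move=> x; apply: (@continuous_comp _ _ _ snd fst); [exact: cvg_snd|exact: cvg_fst].
have c22 : continuous (fun x : MM * MM => x.2.2).
  by move=> x; apply: (@continuous_comp _ _ _ snd snd); exact: cvg_snd.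
move=> x; apply: (@continuousD _ _ _ (fun x : MM * MM => \tr (x.1.1 *m x.2.1) : R)
  (fun x : MM * MM => \tr (x.1.2 *m x.2.2) : R)).
- apply: (@continuous_comp _ _ _ (fun x : MM * MM => (x.1.1, x.2.1)) (fun p : MM => \tr (p.1 *m p.2) : R));
    last exact: tr_mulmx_continuous.
  exact: (cvg_pair (c11 x) (c21 x)).
- apply: (@continuous_comp _ _ _ (fun x : MM * MM => (x.1.2, x.2.2)) (fun p : MM => \tr (p.1 *m p.2) : R));
    last exact: tr_mulmx_continuous.
  exact: (cvg_pair (c12 x) (c22 x)).
Qed.

Lemma innerl_continuous q : continuous (inner q : MM -> R).
Proof.
move=> p; apply: (@continuous_comp _ _ _ (fun p : MM => (q, p)) (fun x : MM * MM => inner x.1 x.2 : R)).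
  exact: (@cvg_pair _ _ _ (nbhs p) (nbhs q) (nbhs p) _ _ _ (cst q) id (cvg_cst q) cvg_id).
exact: inner_continuous.
Qed.

Lemma is_derive_pair (V W : normedModType R) (f : R -> V) (g : R -> W) (t : R) v w :
  is_derive t 1 f v -> is_derive t 1 g w ->
  is_derive t 1 (fun s => (f s, g s)) (v, w).
Proof.
move=> [fd <-] [gd <-].
have fd' := (derivable1_diffP f t).1 fd; have gd' := (derivable1_diffP g t).1 gd.
have d := differentiable_pair fd' gd'.
apply: DeriveDef; first exact/derivable1_diffP.
by rewrite !deriveE// diff_pair.
Qed.

Lemma is_derive_inner P Q (t : R) p q :
  is_derive t 1 P p -> is_derive t 1 Q q ->
  is_derive t 1 (fun s => inner (P s) (Q s)) (inner p (Q t) + inner (P t) q).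
Proof.
move=> Pd Qd; have d := is_derive_pair Pd Qd.
have := is_derive_comp_diff d (differentiable_bilin (P t, Q t) inner_continuous).
by rewrite (diff_bilin _ inner_continuous) /= addrC.
Qed.

(** The trace form is not positive on general pairs of matrices, so positivity is assumed on the
    span of p and q only. *)
Lemma inner_cauchy_schwarz p q : (forall a b : R, 0 <= inner (a *: p + b *: q) (a *: p + b *: q)) ->
  inner p q ^+ 2 <= inner p p * inner q q.
Proof.
move=> pos.
have E a b : inner (a *: p + b *: q) (a *: p + b *: q) =
    a ^+ 2 * inner p p + 2 * a * b * inner p q + b ^+ 2 * inner q q.
  have lin u : inner u (a *: p + b *: q) = a * inner u p + b * inner u q.
    rewrite inner_linear -[b *: q]addr0 inner_linear.
    by rewrite [inner u 0](_ : _ = 0) ?addr0// /inner /= !mulmx0 !linear0 addr0.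
  by rewrite lin (innerC _ p) (innerC _ q) !lin (innerC q p); ring.
(* With A, C the squares of p, q and B their product, the first two choices give C (A C - B^2) >= 0
   and A (A C - B^2) >= 0; the others give A, C >= 0 and settle A = C = 0. *)
have h1 := pos (inner q q) (- inner p q); rewrite E in h1.
have h2 := pos (inner p q) (- inner p p); rewrite E in h2.
have h3 := pos 1 0; rewrite E in h3.
have h4 := pos 0 1; rewrite E in h4.
have h5 := pos 1 1; rewrite E in h5.
have h6 := pos 1 (-1); rewrite E in h6.
move: (inner p p) (inner q q) (inner p q) h1 h2 h3 h4 h5 h6 => A C B h1 h2 h3 h4 h5 h6.
rewrite leNgt; apply/negP => lt.
have A0 : 0 <= A by nra.
have C0 : 0 <= C by nra.
have [Cp|] := ltP 0 C; first by nra.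
have [Ap|] := ltP 0 A; first by nra.
move=> A1 C1; have B0 : B = 0 by lra.
by move: lt; rewrite B0 expr0n /=; nra.
Qed.

End InnerProduct.

(** * Christoffel symbols of a pullback metric *)

Section PullbackMetric.
Context {R : realType} {n : nat} {V : normedModType R}.
Notation MM := ('M[R]_n * 'M[R]_n)%type.
Variables (F : V -> MM) (O : set V).
Hypotheses (Oo : open O) (Fk : Ck 2 O F).

Let G (p : V * V) := 'd F (p.1) p.2.

Let Fd y : O y -> differentiable F y.
Proof. by case: Fk => + _; exact. Qed.

Let Gd p : O p.1 -> differentiable G p.
Proof. by case: Fk => _ [+ _] Op; apply. Qed.

Lemma is_diff_inner_comp (f : V -> MM) y df q :
  is_diff y f df -> is_diff y (inner q \o f) (inner q \o df).
Proof.
move=> fd; apply: is_diff_comp; have fc := @innerl_continuous R n q.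
pose fM := GRing.isLinear.Build _ _ _ _ _ (inner_linear q).
pose fL : {linear MM -> R} := HB.pack (inner q : MM -> R) fM.
apply: DiffDef; first exact: (@linear_differentiable _ _ _ fL).
by rewrite (@diff_lin _ _ _ fL).
Qed.

Let is_diff_G x v : O x ->
  is_diff x (fun y => G (y, v)) (fun k => 'd G (x, v) (k, 0)).
Proof.
move=> Ox; have d1 : is_diff x (fun y => (y, v)) (fun k => (k, 0)).
  exact: is_diff_pair.
have [Gxd _] : is_diff (x, v) G ('d G (x, v)) by apply: differentiableP; exact: Gd.
exact: (is_diff_comp d1 (differentiableP Gxd)).
Qed.

(** Both sides are second derivatives of the scalar function [inner q \o F], to which
    [diff_second_sym] applies. *)
Lemma inner_second_diff_sym q x v w : O x ->
  inner q ('d G (x, v) (w, 0)) = inner q ('d G (x, w) (v, 0)).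
Proof.
move=> Ox; pose h := inner q \o F.
have hd y : O y -> is_diff y h (inner q \o 'd F y).
  by move=> Oy; apply: is_diff_inner_comp; apply: differentiableP; exact: Fd.
have hv u : is_diff x (fun y => 'd h y u) (fun k => inner q ('d G (x, u) (k, 0))).
  have := is_diff_inner_comp q (is_diff_G u Ox).
  apply: near_eq_is_diff; apply: filterS (open_nbhs_nbhs (conj Oo Ox)) => y Oy.
  by have [_ ->] := hd y Oy.
have [vd vE] := hv v; have [wd wE] := hv w.
have := @diff_second_sym R V h O x v w Oo Ox _ vd wd.
by rewrite vE wE; apply => y /hd[].
Qed.

Lemma is_derive_pullback (c : R -> V) (s : R) v :
  is_derive s 1 c v -> O (c s) -> is_derive s 1 (F \o c) (G (c s, v)).
Proof. by move=> cd Os; apply: is_derive_comp_diff => //; exact: Fd. Qed.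

Lemma is_derive_pullback2 (c c' : R -> V) (t : R) v a :
  is_derive t 1 c v -> is_derive t 1 c' a -> O (c t) ->
  is_derive t 1 (fun s => G (c s, c' s)) ('d G (c t, c' t) (v, a)).
Proof.
move=> cd c'd Ot; have Gt : differentiable G (c t, c' t) by exact: Gd.
exact: (is_derive_comp_diff (is_derive_pair cd c'd) Gt).
Qed.

(* The symmetry of the second derivative of F cancels all the terms of the
   Christoffel symbol which do not come from the acceleration of F \o c. *)
Lemma pullback_koszul x v a w : O x ->
  let g y := fun v w => inner ('d F y v) ('d F y w) in
  g x a w + 'D_v (fun y => g y v w) x - 2^-1 * 'D_w (fun y => g y v v) x =
  inner ('d G (x, v) (v, a)) ('d F x w).
Proof.
move=> Ox g.
have Dg k u1 u2 : 'D_k (fun y => g y u1 u2) x =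
    inner ('d G (x, u1) (k, 0)) ('d F x u2) + inner ('d F x u1) ('d G (x, u2) (k, 0)).
  rewrite derive_line derive1E.
  have ld u : is_derive (0 : R) 1 (fun h : R => G (h *: k + x, u)) ('d G (x, u) (k, 0)).
    have d := is_derive_pair (is_derive_line x k 0) (is_derive_cst u (0 : R) 1).
    have := is_derive_comp_diff d (_ : differentiable G _).
    by rewrite scale0r add0r; apply; exact: Gd.
  have [_ ->] := is_derive_inner (ld u1) (ld u2).
  by rewrite scale0r add0r.
rewrite !Dg [inner _ ('d F x v)]innerC.
rewrite (inner_second_diff_sym _ v w Ox).
have vaE : (v, a) = (v, 0) + (0, a) :> V * V by congr (_, _); rewrite /= ?addr0 ?add0r.
have dG : 'd G (x, v) (v, a) = 'd G (x, v) (v, 0) + 'd F x a.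
  have Gxd : differentiable G (x, v) by exact: Gd.
  by rewrite vaE linearD; congr (_ + _); exact: (diff_tangent_vertical a Gxd).
have innerE (q r s : MM) : inner (q + r) s = inner q s + inner r s.
  have := inner_linear s 1 q r; rewrite [1 *: q]scale1r [1 *: inner s q]scale1r.
  by rewrite !(innerC s).
apply: etrans (esym (etrans (congr1 (fun z => inner z ('d F x w)) dG) (innerE _ _ _))).
rewrite /g; move: (inner _ _) (inner _ _) (inner _ _) => i1 i2 i3; by field.
Qed.

End PullbackMetric.

(** * Curves constrained on the unit interval *)

Section CurvesOnUnitInterval.
Context {R : realType}.
Implicit Types V W : normedModType R.

Lemma is_derive1 V (c : R -> V) (t : R) : derivable c t 1 -> is_derive t 1 c (c^`() t).
Proof. by move=> cd; apply: DeriveDef => //; rewrite derive1E. Qed.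

Lemma is_derive1E V (c : R -> V) (t : R) v : is_derive t 1 c v -> c^`() t = v.
Proof. by move=> [_ <-]; rewrite derive1E. Qed.

(** Derivatives are determined by a one-sided limit that stays in [0, 1]: from the left at t = 1,
    from the right elsewhere. *)
Lemma is_derive_unit_itv_eq V (c d : R -> V) (t : R) v w :
  is_derive t 1 c v -> is_derive t 1 d w -> 0 <= t <= 1 ->
  (forall s, 0 <= s <= 1 -> c s = d s) -> v = w.
Proof.
move=> [cd <-] [dd <-] t01 cE; have cdt := cE t t01.
pose Q (f : R -> V) (h : R) := h^-1 *: ((f \o shift t) h%:A - f t).
have Hc : Q c @ 0^' --> 'D_1 c t by exact: cd.
have Hd : Q d @ 0^' --> 'D_1 d t by exact: dd.
have key (D : set_system R) : ProperFilter D -> Q c @ D --> 'D_1 c t ->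
    Q d @ D --> 'D_1 d t -> (\forall h \near D, 0 <= h + t <= 1) ->
    'D_1 c t = 'D_1 d t.
  move=> PD Hc' Hd' Dh.
  have Hcd : Q c @ D --> 'D_1 d t.
    apply: cvg_trans Hd'; apply: near_eq_cvg.
    by apply: filterS Dh => h ht; rewrite /Q /= [h%:A]mulr1 cdt cE.
  exact: (cvg_unique _ Hc' Hcd).
have /andP[t0 t1] := t01.
move: t1; rewrite le_eqVlt => /orP[/eqP t1|t1].
  apply: (key _ _ (cvg_dnbhs_at_left Hc) (cvg_dnbhs_at_left Hd)).
  near=> h; have : h < 0 by near: h; exact: nbhs_left_lt.
  have : - 1 < h by near: h; exact: nbhs_left_gt.
  by move=> h1 h0; apply/andP; split; lra.
apply: (key _ _ (cvg_dnbhs_at_right Hc) (cvg_dnbhs_at_right Hd)).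
near=> h; have : 0 < h by near: h; exact: nbhs_right_gt.
have : h < 1 - t by near: h; apply: nbhs_right_lt; lra.
by move=> h1 h0; apply/andP; split; lra.
Unshelve. all: by end_near. Qed.

Lemma affine_of_derive2 (f f1 : R -> R) :
  (forall t : R, 0 <= t <= 1 -> is_derive t 1 f (f1 t)) ->
  (forall t : R, 0 <= t <= 1 -> is_derive t 1 f1 0) ->
  forall s t : R, 0 <= s <= 1 -> 0 <= t <= 1 -> f t = f s + (t - s) * f1 s.
Proof.
move=> fd f1d.
have mvt (g dg : R -> R) : (forall t : R, 0 <= t <= 1 -> is_derive t 1 g (dg t)) ->
    forall s t : R, 0 <= s <= 1 -> 0 <= t <= 1 -> s <= t ->
    exists2 u, 0 <= u <= 1 & g t - g s = dg u * (t - s).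
  move=> gd s t /andP[s0 s1] /andP[t0 t1] st.
  have gd' u : u \in `[s, t]%R -> is_derive u 1 g (dg u).
    by rewrite in_itv/= => /andP[su ut]; apply: gd; rewrite (le_trans s0 su) (le_trans ut t1).
  have gdo u : u \in `]s, t[%R -> is_derive u 1 g (dg u).
    by rewrite in_itv/= => /andP[/ltW su /ltW ut]; apply: gd'; rewrite in_itv/= su.
  have gc : {within `[s, t], continuous g}.
    by apply: derivable_within_continuous => u /gd'[].
  have [u uin uE] := MVT_segment st gdo gc.
  exists u; last exact: uE.
  move: uin; rewrite in_itv/= => /andP[su ut].
  by rewrite (le_trans s0 su) (le_trans ut t1).
have f1_cst s t : 0 <= s <= 1 -> 0 <= t <= 1 -> f1 s = f1 t.
  move=> s01 t01; have [st|/ltW st] := leP s t.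
    by have [u _ /eqP] := mvt _ _ f1d s t s01 t01 st; rewrite mul0r subr_eq0 => /eqP.
  by have [u _ /eqP] := mvt _ _ f1d t s t01 s01 st; rewrite mul0r subr_eq0 => /eqP.
move=> s t s01 t01; have [st|/ltW st] := leP s t.
  have [u u01 E] := mvt _ _ fd s t s01 t01 st.
  by rewrite (f1_cst s u s01 u01) mulrC -E addrC subrK.
have [u u01 E] := mvt _ _ fd t s t01 s01 st.
by rewrite (f1_cst s u s01 u01) -opprB mulNr mulrC -E opprB addrC subrK.
Qed.

Lemma Ck2_line_C2 V W (F : V -> W) (x v : V) :
  Ck 2 setT F -> C2 (fun h : R => F (h *: v + x)).
Proof.
move=> [Fd [Gd Gc]]; pose G (p : V * V) := 'd F (p.1) p.2.
pose l (h : R) : V := h *: v + x.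
have ld (h : R) : is_derive h 1 l v := is_derive_line x v h.
have lvd (h : R) : is_derive h 1 (fun h => (l h, v)) (v, 0).
  exact: (is_derive_pair (ld h) (is_derive_cst v h 1)).
have d1 (h : R) : is_derive h 1 (F \o l) (G (l h, v)).
  exact: (is_derive_comp_diff (ld h) (Fd _ I)).
have d2 (h : R) : is_derive h 1 (fun h => G (l h, v)) ('d G (l h, v) (v, 0)).
  exact: (is_derive_comp_diff (lvd h) (Gd (l h, v) (conj I I))).
have E1 : (F \o l)^`() = (fun h => G (l h, v)).
  by apply/funext => h; exact: is_derive1E (d1 h).
have E2 : (fun h => G (l h, v))^`() = (fun h => 'd G (l h, v) (v, 0)).
  by apply/funext => h; exact: is_derive1E (d2 h).
have C2' : C2 (F \o l); last exact: C2'.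
split; first by move=> h; have [] := d1 h.
rewrite E1; split; first by move=> h; have [] := d2 h.
rewrite E2 => h.
have lc : {for h, continuous (fun h => ((l h, v), (v, 0 : V)))}.
  have [cd _] := is_derive_pair (lvd h) (is_derive_cst (v, 0 : V) h 1).
  by apply: differentiable_continuous; apply/derivable1_diffP.
exact: (continuous_comp lc (Gc ((l h, v), (v, 0)) (conj (conj I I) I))).
Qed.

End CurvesOnUnitInterval.

(** * Geodesic equation of the extended metric *)

Section ExtendedMetric.
Context {R : realType} {n : nat}.
Notation MM := ('M[R]_n * 'M[R]_n)%type.
Implicit Types (A v w a Y : 'M[R]_n) (p q : MM) (c : R -> 'M[R]_n).

Notation F := (@PhiS R n).
Notation G := (fun p : 'M[R]_n * 'M[R]_n => 'd (@PhiS R n) (p.1) p.2).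

Lemma PhiS_differentiable Y : SPD Y -> differentiable F Y.
Proof. by move=> /SPD_SymSPD Y0; have [+ _] := @Ck_PhiS R n 0; exact. Qed.

Lemma PsiS_differentiable p : differentiable (@PsiS R n) p.
Proof. by case: (@Ck_PsiS R n 0) => Pd _; exact: (Pd p I). Qed.

Lemma is_derive_innerr q (P : R -> MM) (t : R) p : is_derive t 1 P p ->
  is_derive t 1 (fun s => inner q (P s)) (inner q p).
Proof.
move=> Pd; have d := is_derive_inner (is_derive_cst q t 1) Pd.
have E : inner 0 (P t) + inner q p = inner q p :> R.
  by rewrite [inner 0 _]innerC [X in X + _](_ : _ = 0) ?add0r// /inner !mulmx0 !linear0 add0r.
exact: (is_derive_eq d E).
Qed.

(** For symmetric v the line through Y consists of symmetric matrices, where [Phi] and [PhiS]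
    agree. *)
Lemma derive_Phi Y v : SPD Y -> v^T = v -> 'D_v Phi Y = 'd F Y v.
Proof.
move=> Y0 vs; rewrite -deriveE; last exact: PhiS_differentiable.
apply: near_eq_line_derive; near=> h; rewrite PhiS_id//.
by rewrite linearD linearZ /= vs; have [-> _] := Y0.
Unshelve. all: by end_near. Qed.

Lemma gextE Y v w : SPD Y -> v^T = v -> w^T = w ->
  gext Y v w = inner ('d F Y v) ('d F Y w).
Proof. by move=> Y0 vs ws; rewrite /gext !derive_Phi. Qed.

Lemma near_line_SPD Y v : SPD Y -> v^T = v -> \forall h \near (0 : R), SPD (h *: v + Y).
Proof.
move=> Y0 vs; have [e e0 eP] := SPD_open Y0; have v1 : 0 < `|v| + 1 by rewrite ltr_wpDl.
near=> h; apply: eP; first by rewrite linearD linearZ /= vs; have [-> _] := Y0.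
rewrite addrK normrZ (@le_lt_trans _ _ (`|h| * (`|v| + 1)))//.
  by rewrite ler_wpM2l// lerDl.
rewrite -ltr_pdivlMr//; near: h; exact: (@nbhs0_lt R R^o _ (divr_gt0 e0 v1)).
Unshelve. all: by end_near. Qed.

Lemma derive_gext Y k v w : SPD Y -> k^T = k -> v^T = v -> w^T = w ->
  'D_k (fun y => gext y v w) Y = 'D_k (fun y => inner ('d F y v) ('d F y w)) Y.
Proof.
move=> Y0 ks vs ws; apply: near_eq_line_derive.
by apply: filterS (near_line_SPD Y0 ks) => h h0; exact: gextE.
Qed.

Lemma covariant_accelerationE c (t : R) w : SPD (c t) -> (derive1 c t)^T = derive1 c t ->
  (derive1 (derive1 c) t)^T = derive1 (derive1 c) t -> w^T = w ->
  covariant_acceleration gext c t w =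
  inner ('d G (c t, derive1 c t) (derive1 c t, derive1 (derive1 c) t)) ('d F (c t) w).
Proof.
move=> ct0 vs as_ ws.
have E1 := gextE ct0 as_ ws.
have E2 := derive_gext ct0 vs vs ws.
have E3 := derive_gext ct0 ws vs vs.
have K := pullback_koszul open_SymSPD (@Ck_PhiS R n 1) (derive1 c t) (derive1 (derive1 c) t) w (SPD_SymSPD ct0).
apply: etrans K; rewrite /covariant_acceleration.
exact: (congr2 (fun x y => x - y) (congr2 +%R E1 E2) (congr1 ( *%R 2^-1) E3)).
Qed.

Lemma is_derive_trmx c (t : R) v : is_derive t 1 c v ->
  is_derive t 1 (fun s => (c s)^T) v^T.
Proof.
move=> cd; have tl : linear (fun A : 'M[R]_n => A^T) by move=> a' u w; rewrite linearP.
have [d dE] := is_diff_mx_linear (c t) tl.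
by have := is_derive_comp_diff cd d; rewrite dE.
Qed.

Lemma is_derive_unit_itv_sym c (t : R) v : is_derive t 1 c v -> 0 <= t <= 1 ->
  (forall s, 0 <= s <= 1 -> (c s)^T = c s) -> v^T = v.
Proof.
move=> cd t01 cs; exact: (is_derive_unit_itv_eq (is_derive_trmx cd) cd t01 cs).
Qed.

(** Makes the velocity and the acceleration admissible tangent vectors, end points included,
    although c is known to be symmetric on [0, 1] only. *)
Lemma geodesic_sym c : geodesic SPD Sym gext c -> forall t : R, 0 <= t <= 1 ->
  (derive1 c t)^T = derive1 c t /\ (derive1 (derive1 c) t)^T = derive1 (derive1 c) t.
Proof.
move=> [[cd [c'd _]] cg].
have c's t : 0 <= t <= 1 -> (derive1 c t)^T = derive1 c t.
  move=> t01; apply: (is_derive_unit_itv_sym (is_derive1 (cd t)) t01) => s s01.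
  by have [[]] := cg s s01.
move=> t t01; split; first exact: c's.
exact: (is_derive_unit_itv_sym (is_derive1 (c'd t)) t01 c's).
Qed.

(** The vector w is the initial velocity of [PsiS] along the line from [Phi Y] in direction q: that
    curve is symmetric, hence so is w, and [PhiS] undoes [PsiS] along it. Every q in [HolDiag] thus
    comes from a symmetric test vector. *)
Lemma diff_PhiS_surj Y q : SPD Y -> HolDiag q -> exists2 w, w^T = w & 'd F Y w = q.
Proof.
move=> Y0 qHD; have pHD := Phi_HolDiag Y0; pose p := Phi Y.
pose l (h : R) := h *: q + p.
have lHD h : HolDiag (l h) by have := HolDiag_comb h 1 qHD pHD; rewrite scale1r.
have PK h := PsiK (lHD h).
have Pd := PsiS_differentiable (l 0).
have d1 := is_derive_comp_diff (is_derive_line p q 0) Pd.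
set w := 'd _ _ _ in d1.
have PsiSl h : PsiS (l h) = Psi (l h) by apply: PsiSE.
have ws : w^T = w.
  have t01 : 0 <= (0 : R) <= 1 by rewrite lexx ler01.
  apply: (is_derive_unit_itv_sym d1 t01) => s _.
  by have [[sym _] _] := PK s; rewrite /= PsiSl.
have l0 : PsiS (l 0) = Y by rewrite PsiSl /l scale0r add0r PhiK.
exists w => //.
have Fd : differentiable F (PsiS (l 0)) by rewrite l0; exact: PhiS_differentiable.
have d2 := is_derive_comp_diff d1 Fd.
have lE : F \o (@PsiS R n \o l) = l.
  apply/funext => h /=; have [[sym _] PE] := PK h.
  by rewrite PsiSl PhiS_id.
have d3 : is_derive (0 : R) 1 (F \o (@PsiS R n \o l)) q by rewrite lE; exact: is_derive_line.
by rewrite -l0 -(is_derive1E d3) (is_derive1E d2).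
Qed.

(** At each time q is the image of some symmetric w, and the geodesic equation tested on w kills the
    second derivative of the scalar function [inner q (Phi (c r))]. *)
Lemma geodesic_affine c (s t : R) q : geodesic SPD Sym gext c ->
  0 <= s <= 1 -> 0 <= t <= 1 -> HolDiag q ->
  inner q (Phi (c t)) =
  inner q (Phi (c s)) + (t - s) * inner q ('d F (c s) (derive1 c s)).
Proof.
move=> cg s01 t01 qHD; have csym := geodesic_sym cg.
have [[cd [c'd _]] cg'] := cg.
have c0 r : 0 <= r <= 1 -> SPD (c r) by move=> /cg'[].
have cS r : 0 <= r <= 1 -> SymSPD (c r) by move=> /c0/SPD_SymSPD.
have d1 (r : R) : 0 <= r <= 1 -> is_derive r 1 (fun r => inner q (F (c r)))
    (inner q ('d F (c r) (derive1 c r))).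
  move=> r01.
  have d := is_derive_pullback (@Ck_PhiS R n 1) (is_derive1 (cd r)) (cS r r01).
  exact: is_derive_innerr d.
have d2 (r : R) : 0 <= r <= 1 -> is_derive r 1 (fun r => inner q ('d F (c r) (derive1 c r))) 0.
  move=> r01.
  have d := is_derive_pullback2 (@Ck_PhiS R n 1) (is_derive1 (cd r)) (is_derive1 (c'd r)) (cS r r01).
  apply: (is_derive_eq (is_derive_innerr q d)).
  have [w ws <-] := diff_PhiS_surj (c0 r r01) qHD.
  have [vs as_] := csym r r01.
  rewrite innerC -(covariant_accelerationE (c0 r r01) vs as_ ws).
  by have [_ /(_ w ws)] := cg' r r01.
have := affine_of_derive2 d1 d2 s01 t01.
by rewrite !PhiS_id//; [have [] := c0 s s01|have [] := c0 t t01].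
Qed.

End ExtendedMetric.

(** * Geodesics read in the chart; correlation matrices as a totally geodesic slice *)

Section Geodesics.
Context {R : realType} {n : nat}.
Notation MM := ('M[R]_n * 'M[R]_n)%type.
Implicit Types (A v w Y : 'M[R]_n) (p q : MM) (c : R -> 'M[R]_n).

Lemma inner_lincomb r p q (a b : R) : inner r (a *: p + b *: q) = a * inner r p + b * inner r q.
Proof.
rewrite inner_linear -[b *: q]addr0 inner_linear.
by rewrite [inner r 0](_ : _ = 0) ?addr0// /inner /= !mulmx0 !linear0 addr0.
Qed.

Lemma HolDiagB p q : HolDiag p -> HolDiag q -> HolDiag (p - q).
Proof. by move=> pHD qHD; have := HolDiag_comb 1 (-1) pHD qHD; rewrite scale1r scaleN1r. Qed.

Lemma inner_ext p q : HolDiag p -> HolDiag q ->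
  (forall r, HolDiag r -> inner r p = inner r q) -> p = q.
Proof.
move=> pHD qHD pq; have dHD := HolDiagB pHD qHD.
apply/eqP; rewrite -subr_eq0; apply/eqP; apply: inner_eq0 => //.
have := inner_lincomb (p - q) p q 1 (-1); rewrite scale1r scaleN1r => ->.
by rewrite (pq _ dHD) mul1r mulN1r subrr.
Qed.

Lemma Phi_geodesic c (t : R) : geodesic SPD Sym gext c -> 0 <= t <= 1 ->
  Phi (c t) = (1 - t) *: Phi (c 0) + t *: Phi (c 1).
Proof.
move=> cg t01; have c0 r : 0 <= r <= 1 -> SPD (c r).
  by move=> r01; have [_ /(_ r r01)[]] := cg.
have t0 : 0 <= (0 : R) <= 1 by rewrite lexx ler01.
have t1 : 0 <= (1 : R) <= 1 by rewrite lexx ler01.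
have H r r01 := Phi_HolDiag (c0 r r01).
apply: inner_ext; [exact: H|exact: (HolDiag_comb _ _ (H _ t0) (H _ t1))|].
move=> r rHD; rewrite inner_lincomb.
have interp (a b x y : R) : x = a + (t - 0) * b -> y = a + (1 - 0) * b ->
  x = (1 - t) * a + t * y by move=> -> ->; ring.
exact: (interp _ _ _ _ (geodesic_affine cg t0 t01 rHD) (geodesic_affine cg t0 t1 rHD)).
Qed.

Lemma Cor_line Y A : Cor Y -> Hol A -> \forall h \near (0 : R), Cor (h *: A + Y).
Proof.
move=> [Y0 Y1] [As A0]; apply: filterS (near_line_SPD Y0 As) => h h0.
by split => // i; rewrite !mxE A0 mulr0 add0r.
Qed.

Lemma Cor_line_PhiS Y A : Cor Y -> Hol A ->
  \forall h \near (0 : R), cst (0 : 'M[R]_n) h = (snd \o (@PhiS R n \o (fun h => h *: A + Y))) h.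
Proof.
move=> Yc Ah; apply: filterS (Cor_line Yc Ah) => h hc.
change (0 = (PhiS (h *: A + Y)).2).
by rewrite PhiS_id; [rewrite ((Cor_Phi hc.1).1 hc)|have [] := hc.1].
Qed.

(* Phi has vanishing second component along Y + h A, which stays in Cor. *)
Lemma diff_PhiS_Cor Y A : Cor Y -> Hol A -> ('d (@PhiS R n) Y A).2 = 0.
Proof.
move=> Yc Ah; have Y0 := Yc.1.
have sd q : differentiable (@snd 'M[R]_n 'M[R]_n) q.
  by apply: linear_differentiable => x; exact: cvg_snd.
have Fd : differentiable (@PhiS R n) (0 *: A + Y).
  by rewrite scale0r add0r; exact: PhiS_differentiable.
have d1 := is_derive_comp_diff (is_derive_line Y A 0) Fd.
have d2 := is_derive_comp_diff d1 (sd _).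
have d3 := near_eq_is_derive (Cor_line_PhiS Yc Ah) (is_derive_cst (0 : 'M[R]_n) (0 : R) 1).
have sE q r : 'd (@snd 'M[R]_n 'M[R]_n) q r = r.2.
  by rewrite diff_lin// => x; exact: cvg_snd.
have E := etrans (esym (is_derive1E d2)) (is_derive1E d3).
have Y' : 0 *: A + Y = Y by rewrite scale0r add0r.
by rewrite Y' sE in E.
Qed.

(** Let D be the second component of [Phi (c t)]. Pairing Phi o c with (0, D) gives an affine
    function of time whose value and slope vanish at s, and whose value at t is tr (D D). *)
Lemma totally_geodesic_Cor : totally_geodesic (SPD : set 'M[R]_n) Sym gext Cor Hol.
Proof.
move=> c cg s s01 cs c's t t01.
have c0 r : 0 <= r <= 1 -> SPD (c r).
  by move=> r01; have [_ /(_ r r01)[]] := cg.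
apply/(Cor_Phi (c0 t t01)); set D := (Phi (c t)).2.
have qHD : HolDiag ((0, D) : MM).
  split; last by have [_] := Phi_HolDiag (c0 t t01).
  by split=> [|i]; rewrite /Sym /= ?trmx0 ?mxE.
have inner0D q : inner ((0, D) : MM) q = \tr (D *m q.2).
  by rewrite /inner /= mul0mx linear0 add0r.
have inner_snd0 q : q.2 = 0 -> inner ((0, D) : MM) q = 0.
  by move=> q0; rewrite inner0D q0 mulmx0 linear0.
have vanish (x y z k : R) : x = y + k * z -> y = 0 -> z = 0 -> x = 0.
  by move=> -> -> ->; rewrite mulr0 addr0.
have D0 := vanish _ _ _ _ (geodesic_affine cg s01 t01 qHD)
  (inner_snd0 _ ((Cor_Phi (c0 s s01)).1 cs)) (inner_snd0 _ (diff_PhiS_Cor cs c's)).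
have DD : inner ((0, D) : MM) (0, D) = 0.
  exact: (etrans (inner0D (0, D)) (etrans (esym (inner0D (Phi (c t)))) D0)).
exact: (congr1 snd (inner_eq0 qHD DD)).
Qed.

End Geodesics.

(** * Chart segments as geodesics *)

Section StraightGeodesic.
Context {R : realType} {n : nat}.
Notation MM := ('M[R]_n * 'M[R]_n)%type.
Variables (p0 p1 : MM).
Hypotheses (p0HD : HolDiag p0) (p1HD : HolDiag p1).

Let q := p1 - p0.
Let l (h : R) : MM := h *: q + p0.

(** Built from [PsiS] rather than [Psi], whose smoothness on the whole space gives the C2 property
    on all of R. *)
Definition straight (h : R) : 'M[R]_n := PsiS (h *: (p1 - p0) + p0).

Let lHD h : HolDiag (l h).
Proof. by have := HolDiag_comb h 1 (HolDiagB p1HD p0HD) p0HD; rewrite scale1r. Qed.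

Lemma straightE h : straight h = Psi (h *: (p1 - p0) + p0).
Proof. exact: PsiSE (lHD h). Qed.

Lemma straight_SPD h : SPD (straight h).
Proof. by rewrite straightE; exact: (PsiK (lHD h)).1. Qed.

Lemma Phi_straight h : Phi (straight h) = h *: (p1 - p0) + p0.
Proof. by rewrite straightE; exact: (PsiK (lHD h)).2. Qed.

Lemma straight_C2 : C2 straight.
Proof. exact: Ck2_line_C2 (Ck_PsiS 1). Qed.

Let straight_d (h : R) : is_derive h 1 straight (derive1 straight h).
Proof. by apply: is_derive1; have [sd _] := straight_C2; exact: sd. Qed.

Let straight_d2 (h : R) : is_derive h 1 (derive1 straight) (derive1 (derive1 straight) h).
Proof. by apply: is_derive1; have [_ [sd _]] := straight_C2; exact: sd. Qed.

Let straight_sym h : (straight h)^T = straight h.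
Proof. by have [] := straight_SPD h. Qed.

Let PhiS_straight : @PhiS R n \o straight = l.
Proof. by apply/funext => h; rewrite /= PhiS_id// Phi_straight. Qed.

Lemma straight_velocity (h : R) : 'd (@PhiS R n) (straight h) (derive1 straight h) = p1 - p0.
Proof.
have d1 := is_derive_pullback (@Ck_PhiS R n 1) (straight_d h) (SPD_SymSPD (straight_SPD h)).
rewrite PhiS_straight in d1.
exact: (etrans (esym (is_derive1E d1)) (is_derive1E (is_derive_line p0 q h))).
Qed.

Let derive_sym (c : R -> 'M[R]_n) (t : R) v : is_derive t 1 c v ->
  (forall s, (c s)^T = c s) -> v^T = v.
Proof.
move=> cd cs; have cE : (fun s => (c s)^T) = c by apply/funext.
have ct := is_derive_trmx cd; rewrite cE in ct.
exact: (etrans (esym (is_derive1E ct)) (is_derive1E cd)).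
Qed.

Lemma derive_straight_sym h : (derive1 straight h)^T = derive1 straight h.
Proof. exact: derive_sym (straight_d h) straight_sym. Qed.

Lemma straight_geodesic : geodesic SPD Sym gext straight.
Proof.
split; first exact: straight_C2.
move=> t _; split; first exact: straight_SPD.
move=> w ws; have s2 := derive_sym (straight_d2 t) derive_straight_sym.
have E := covariant_accelerationE (straight_SPD t) (derive_straight_sym t) s2 ws.
have d2 := is_derive_pullback2 (@Ck_PhiS R n 1) (straight_d t) (straight_d2 t)
  (SPD_SymSPD (straight_SPD t)).
have vE : (fun s : R => 'd (@PhiS R n) (straight s) (derive1 straight s)) = cst q.
  by apply/funext => s; exact: straight_velocity.
rewrite /= vE in d2.
have Z := etrans (esym (is_derive1E d2)) (is_derive1E (is_derive_cst q t 1)).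
apply: (etrans E); apply: (etrans (congr1 (fun z => inner z _) Z)).
by rewrite /inner /= !mul0mx linear0 addr0.
Qed.

Lemma straight_speed t : speed gext straight t = Num.sqrt (inner (p1 - p0) (p1 - p0)).
Proof.
rewrite /speed; congr (Num.sqrt _).
have E := gextE (straight_SPD t) (derive_straight_sym t) (derive_straight_sym t).
apply: (etrans E); exact: (congr2 inner (straight_velocity t) (straight_velocity t)).
Qed.

Lemma straight_length :
  riem_length gext straight = (Num.sqrt (inner (p1 - p0) (p1 - p0)))%:E.
Proof.
rewrite /riem_length; under eq_integral do rewrite straight_speed.
rewrite integral_cst//= lebesgue_measure_itv/= lte_fin ltr01 -EFinB subr0 mule1//.
Qed.

Lemma straight_admissible : admissible SPD straight.
Proof.
split; last by move=> t _; exact: straight_SPD.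
exists 1%N, (fun i => i%:R); split => //.
  by move=> [|]// _; exact: ltr01.
move=> [|]// _; exists straight => //.
case: straight_C2 => sd [sd2 _]; split; first exact: sd.
move=> t; exact: (differentiable_continuous ((derivable1_diffP _ t).1 (sd2 t))).
Qed.

End StraightGeodesic.

(** * Integral bounds over a subdivision *)

Section PiecewiseIntegralBound.
Context {R : realType}.
Notation mu := (@lebesgue_measure R).
Implicit Types (f psi phi k sigma : R -> R) (a b N : R).

Lemma continuous_itv_within f a b :
  (forall t, a <= t <= b -> {for t, continuous f}) -> {within `[a, b], continuous f}.
Proof.
by move=> fc; apply: continuous_in_subspaceT => t /[1!inE] /=; rewrite in_itv/=; exact: fc.
Qed.

(** The fundamental theorem of calculus; the integrands are compared on the open interval, the end
    points being negligible. *)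
Lemma integral_lower_bound phi k sigma a b N : a < b ->
  (forall t, a <= t <= b -> is_derive t (1 : R) phi (k t)) ->
  (forall t, a <= t <= b -> {for t, continuous k}) ->
  (forall t, a <= t <= b -> {for t, continuous sigma}) ->
  (forall t, a < t < b -> k t <= N * sigma t) ->
  ((phi b - phi a)%:E <= N%:E * \int[mu]_(t in `[a, b]) (sigma t)%:E)%E.
Proof.
move=> ab phid kc sc kN.
have kw := continuous_itv_within kc; have sw := continuous_itv_within sc.
have phic t : a <= t <= b -> {for t, continuous phi}.
  by move=> /phid[d _]; apply: differentiable_continuous; exact/derivable1_diffP.
have phiLR : derivable_oo_LRcontinuous phi a b.
  split.
  - by move=> t; rewrite in_itv/= => /andP[/ltW at_ /ltW tb]; have [] := phid t; rewrite ?at_.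
  - by apply: cvg_at_right_filter; apply: phic; rewrite lexx ltW.
  - by apply: cvg_at_left_filter; apply: phic; rewrite lexx ltW.
have phiE : {in `]a, b[%R, phi^`() =1 k}.
  move=> t; rewrite in_itv/= => /andP[/ltW at_ /ltW tb].
  by apply: is_derive1E; apply: phid; rewrite at_.
have ftc := continuous_FTC2 ab kw phiLR phiE.
have ik : mu.-integrable `[a, b] (EFin \o k).
  by apply: continuous_compact_integrable => //; exact: segment_compact.
have is_ : mu.-integrable `[a, b] (EFin \o sigma).
  by apply: continuous_compact_integrable => //; exact: segment_compact.
have oc : `]a, b[ `<=` `[a, b]%classic by exact: subset_itv_oo_cc.
have iko : mu.-integrable `]a, b[ (EFin \o k) by apply: (@integrableS _ _ _ mu `[a, b]) => //.
have iso : mu.-integrable `]a, b[ (EFin \o sigma) by apply: (@integrableS _ _ _ mu `[a, b]) => //.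
have mko : measurable_fun `]a, b[ k by apply/measurable_EFinP; case/integrableP: iko.
have mso : measurable_fun `]a, b[ sigma by apply/measurable_EFinP; case/integrableP: iso.
have oo g : measurable_fun `]a, b[ g ->
    (\int[mu]_(t in `[a, b]) (g t)%:E = \int[mu]_(t in `]a, b[) (g t)%:E)%E.
  by move=> mg; apply: integral_itv_bndoo; exact/measurable_EFinP.
rewrite EFinB -ftc (oo k mko) (oo sigma mso).
rewrite -integralZl//; apply: le_integral => //.
  exact: integrableZl.
by move=> t /[1!inE]/=; rewrite in_itv/= => abt; rewrite -EFinM lee_fin kN.
Qed.

(** At break points the derivative behind f may not exist. On each piece f is therefore replaced by
    a function [sigma], continuous up to the end points and equal to f inside, and psi by a
    differentiable [phi] with the same end values. *)
Definition piece_bound f psi N a b : Prop :=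
  exists phi k sigma : R -> R,
    [/\ phi a = psi a, phi b = psi b,
      forall t, a <= t <= b -> [/\ is_derive t (1 : R) phi (k t),
        {for t, continuous k} & {for t, continuous sigma}]
      & forall t, a < t < b -> f t = sigma t /\ k t <= N * sigma t].

Lemma piece_boundP f psi N a b : a < b -> piece_bound f psi N a b ->
  measurable_fun `[a, b] f /\
  ((psi b - psi a)%:E <= N%:E * \int[mu]_(t in `[a, b]) (f t)%:E)%E.
Proof.
move=> ab [phi [k [sigma [<- <- H fs]]]].
have sc t : a <= t <= b -> {for t, continuous sigma} by move=> /H[].
have ms : measurable_fun `[a, b] sigma.
  by apply: subspace_continuous_measurable_fun => //; exact: continuous_itv_within.
have mso : measurable_fun `]a, b[ sigma.
  by apply: measurable_funS ms => //; exact: subset_itv_oo_cc.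
have fsE : {in `]a, b[%classic, sigma =1 f}.
  by move=> t /[1!inE]/=; rewrite in_itv/= => /fs[].
have mfo : measurable_fun `]a, b[ f by apply: eq_measurable_fun mso; exact: fsE.
split; first exact: measurable_fun_itv_cc mfo.
have -> : (\int[mu]_(t in `[a, b]) (f t)%:E = \int[mu]_(t in `[a, b]) (sigma t)%:E)%E.
  by apply: eq_integral_itv_bounded => // t; rewrite in_itv/= => /fs[].
apply: (@integral_lower_bound phi k) => //.
- by move=> t /H[].
- by move=> t /H[].
- by move=> t /fs[].
Qed.

Lemma piecewise_integral_bound f psi N (m : nat) (s : nat -> R) :
  0 <= N -> (forall t, 0 <= f t) -> (forall i, (i < m)%N -> s i < s i.+1) ->
  (forall i, (i < m)%N -> piece_bound f psi N (s i) (s i.+1)) ->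
  ((psi (s m) - psi (s 0%N))%:E <= N%:E * \int[mu]_(t in `[s 0%N, s m]) (f t)%:E)%E.
Proof.
move=> N0 f0 slt spb.
(* Measurability of f is carried through the induction, since additivity of the integral over the
   pieces relies on it. *)
suff : forall i, (i <= m)%N -> s 0%N <= s i /\ (measurable_fun `[s 0%N, s i] f /\
    ((psi (s i) - psi (s 0%N))%:E <= N%:E * \int[mu]_(t in `[s 0%N, s i]) (f t)%:E)%E).
  by move=> /(_ m (leqnn m))[_ []].
elim=> [_|i IH im].
  split => //; split; first by rewrite set_itv1; exact: measurable_fun_set1.
  rewrite subrr mule_ge0// ?lee_fin//; apply: integral_ge0 => t _.
  by rewrite lee_fin.
have [s0i [mi Hi]] := IH (ltnW im).
have [mp Hp] := piece_boundP (slt i im) (spb i im).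
have sii := ltW (slt i im).
have UE : `[s 0%N, s i.+1]%classic = `[s 0%N, s i] `|` `]s i, s i.+1].
  by rewrite -itv_bndbnd_setU// bnd_simp.
have mpo : measurable_fun `]s i, s i.+1] f by exact/measurable_fun_itv_obnd_cbndP.
have mU : measurable_fun (`[s 0%N, s i] `|` `]s i, s i.+1]) f by exact/measurable_funU.
split; first exact: le_trans s0i sii.
split; first by rewrite UE.
rewrite UE ge0_integral_setU//.
- rewrite [X in (_ + X)%E](integral_itv_obnd_cbnd (f := EFin \o f)); last exact/measurable_EFinP.
  rewrite ge0_muleDr; [|by apply: integral_ge0 => t _; rewrite lee_fin..].
  have -> : psi (s i.+1) - psi (s 0%N) =
    (psi (s i) - psi (s 0%N)) + (psi (s i.+1) - psi (s i)) by ring.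
  by rewrite EFinD leeD.
- exact/measurable_EFinP.
- by move=> t _; rewrite lee_fin.
- apply/disj_setPRL => t /=; rewrite !in_itv/= => /andP[sit _] /andP[_ tsi].
  by move: (lt_le_trans sit tsi); rewrite ltxx.
Qed.

End PiecewiseIntegralBound.

(** * Lower bound on the length of admissible curves *)

Section LengthBound.
Context {R : realType} {n : nat}.
Notation MM := ('M[R]_n * 'M[R]_n)%type.
Implicit Types (A Y : 'M[R]_n) (p q Q : MM) (c e : R -> 'M[R]_n).

(** Symmetry of both components is enough for positivity of [inner], and passes to the velocity of a
    curve in the chart by differentiation. *)
Definition SymPair p := p.1^T = p.1 /\ p.2^T = p.2.

Lemma HolDiag_SymPair p : HolDiag p -> SymPair p.
Proof. by move=> [[ps _] /is_diag_mx_sym ds]. Qed.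

Lemma SymPair_inner_ge0 p : SymPair p -> 0 <= inner p p.
Proof.
have sq0 A : 0 <= \sum_i \sum_j A i j ^+ 2 by exact: le_trans (sqr_ge0 _) (mx_norm_sqr_le A).
by move=> [ps ds]; rewrite /inner !tr_mx_sqr// addr_ge0.
Qed.

Lemma inner_le_norm p q : SymPair p -> SymPair q ->
  inner p q <= Num.sqrt (inner p p) * Num.sqrt (inner q q).
Proof.
move=> ps qs; have p0 := SymPair_inner_ge0 ps.
have cs : inner p q ^+ 2 <= inner p p * inner q q.
  apply: inner_cauchy_schwarz => a b; apply: SymPair_inner_ge0.
  by split; rewrite /= linearD !linearZ /= ?ps.1 ?ps.2 ?qs.1 ?qs.2.
by rewrite -sqrtrM// (le_trans (ler_norm _))// -sqrtr_sqr ler_wsqrtr.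
Qed.

Lemma is_derive_near_sym e (t : R) v : is_derive t 1 e v ->
  (\forall s \near t, (e s)^T = e s) -> v^T = v.
Proof.
move=> ed es; have d := near_eq_is_derive es (is_derive_trmx ed).
exact: (etrans (esym (is_derive1E d)) (is_derive1E ed)).
Qed.

Lemma is_derive_fst (P : R -> MM) (t : R) p : is_derive t 1 P p ->
  is_derive t 1 (fun s => (P s).1) p.1.
Proof.
move=> Pd; have fc : continuous (@fst 'M[R]_n 'M[R]_n) by move=> x; exact: cvg_fst.
have fd : differentiable (@fst 'M[R]_n 'M[R]_n) (P t) by exact: linear_differentiable.
have d := is_derive_comp_diff Pd fd.
have dE : 'd (@fst 'M[R]_n 'M[R]_n) (P t) p = p.1 by rewrite diff_lin.
by rewrite dE in d.
Qed.

Lemma is_derive_snd (P : R -> MM) (t : R) p : is_derive t 1 P p ->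
  is_derive t 1 (fun s => (P s).2) p.2.
Proof.
move=> Pd; have fc : continuous (@snd 'M[R]_n 'M[R]_n) by move=> x; exact: cvg_snd.
have fd : differentiable (@snd 'M[R]_n 'M[R]_n) (P t) by exact: linear_differentiable.
have d := is_derive_comp_diff Pd fd.
have dE : 'd (@snd 'M[R]_n 'M[R]_n) (P t) p = p.2 by rewrite diff_lin.
by rewrite dE in d.
Qed.

Lemma velocity_SymPair e (t : R) p : is_derive t 1 (@PhiS R n \o e) p ->
  (\forall s \near t, SPD (e s)) -> SymPair p.
Proof.
move=> d e0; have es : \forall s \near t, SymPair ((@PhiS R n \o e) s).
  apply: filterS e0 => s s0; apply: HolDiag_SymPair.
  have [es _] := s0; have := Phi_HolDiag s0.
  by rewrite -(PhiS_id es).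
split.
- by apply: (is_derive_near_sym (is_derive_fst d)); apply: filterS es => s [].
- by apply: (is_derive_near_sym (is_derive_snd d)); apply: filterS es => s [].
Qed.

(** The map [e] is C1 up to the end points, so its integrands are continuous on [a, b]; the
    derivative of c is identified with that of [e] inside the interval. *)
Lemma piece_bound_speed c e a b Q : HolDiag Q -> C1 e ->
  (forall t, a <= t <= b -> c t = e t) -> (forall t, a <= t <= b -> SPD (c t)) -> a < b ->
  piece_bound (speed gext c) (fun t => inner Q (@PhiS R n (c t)))
    (Num.sqrt (inner Q Q)) a b.
Proof.
move=> QHD [ed ec] ce c0 ab.
have e0 t : a <= t <= b -> SPD (e t) by move=> tab; rewrite -ce//; exact: c0.
pose w t : MM := 'd (@PhiS R n) (e t) (derive1 e t).
have d1 (t : R) : a <= t <= b -> is_derive t 1 (@PhiS R n \o e) (w t).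
  move=> tab.
  exact: (is_derive_pullback (@Ck_PhiS R n 1) (is_derive1 (ed t)) (SPD_SymSPD (e0 t tab))).
have wc t : a <= t <= b -> {for t, continuous w}.
  move=> tab.
  have evc : {for t, continuous (fun t => (e t, derive1 e t))}.
    exact: (cvg_pair (differentiable_continuous ((derivable1_diffP _ t).1 (ed t))) (ec t)).
  have [_ Gk] := @Ck_PhiS R n 0.
  have Gc := Gk (e t, derive1 e t) (conj (SPD_SymSPD (e0 t tab)) I).
  exact: (continuous_comp evc Gc).
exists (fun t => inner Q (@PhiS R n (e t))), (fun t => inner Q (w t)),
  (fun t => Num.sqrt (inner (w t) (w t))); split.
- by rewrite ce// lexx ltW.
- by rewrite ce// lexx ltW.
- move=> t tab; split.
  + exact: is_derive_innerr (d1 t tab).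
  + exact: (continuous_comp (wc t tab) (@innerl_continuous R n Q _)).
  + have wwc : {for t, continuous (fun t => (w t, w t))}.
      exact: (cvg_pair (wc t tab) (wc t tab)).
    have ic := continuous_comp wwc (@inner_continuous R n _).
    exact: (continuous_comp ic (@sqrt_continuous R _)).
- move=> t /andP[at_ tb].
  have tab : a <= t <= b by rewrite !ltW.
  have near_ab : \forall s \near t, a <= s <= b.
    have : `]a, b[%classic t by rewrite /= in_itv/= at_.
    move=> /(conj (itv_open a b))/open_nbhs_nbhs; apply: filterS => s.
    by rewrite /= in_itv/= => /andP[/ltW -> /ltW ->].
  have e0n : \forall s \near t, SPD (e s) by apply: filterS near_ab => s; exact: e0.
  have cen : \forall s \near t, c s = e s by apply: filterS near_ab => s; exact: ce.
  have c'E : derive1 c t = derive1 e t by rewrite !derive1E; exact: near_eq_derive.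
  have vs : (derive1 e t)^T = derive1 e t.
    by apply: (is_derive_near_sym (is_derive1 (ed t))); apply: filterS e0n => s [].
  split; last first.
    apply: inner_le_norm; first exact: HolDiag_SymPair.
    exact: velocity_SymPair (d1 t tab) e0n.
  rewrite /speed (ce t tab) c'E.
  by have -> := gextE (e0 t tab) vs vs.
Qed.

Lemma step_nondecreasing (m : nat) (s : nat -> R) : (forall i, (i < m)%N -> s i < s i.+1) ->
  forall i j, (i <= j)%N -> (j <= m)%N -> s i <= s j.
Proof.
move=> slt i; elim=> [|j IH]; first by rewrite leqn0 => /eqP ->.
rewrite leq_eqVlt => /orP[/eqP -> //|]; rewrite ltnS => ij jm.
exact: le_trans (IH ij (ltnW jm)) (ltW (slt j jm)).
Qed.

Lemma length_lower_bound c (Q := Phi (c 1) - Phi (c 0)) : admissible SPD c ->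
  ((Num.sqrt (inner Q Q))%:E <= riem_length gext c)%E.
Proof.
move=> [[m [s [s0 sm slt sp]]] c0].
have QHD : HolDiag Q.
  by apply: HolDiagB; apply: Phi_HolDiag; apply: c0; rewrite ?lexx ler01.
have s01 i t : (i < m)%N -> s i <= t <= s i.+1 -> 0 <= t <= 1.
  move=> im /andP[st ts]; rewrite -{1}s0 -{1}sm.
  rewrite (le_trans (step_nondecreasing slt (leq0n i) (ltnW im)) st).
  exact: (le_trans ts (step_nondecreasing slt im (leqnn m))).
have pb i : (i < m)%N -> piece_bound (speed gext c)
    (fun t => inner Q (@PhiS R n (c t))) (Num.sqrt (inner Q Q)) (s i) (s i.+1).
  move=> im; have [e e1 ce] := sp i im.
  apply: (piece_bound_speed QHD e1 ce) (slt i im) => t /(s01 i t im); exact: c0.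
have N0 : 0 <= Num.sqrt (inner Q Q) by exact: sqrtr_ge0.
have := piecewise_integral_bound N0 (fun t => sqrtr_ge0 _) slt pb.
rewrite s0 sm -/(riem_length gext c).
have L0 : (0 <= riem_length gext c)%E.
  by apply: integral_ge0 => t _; rewrite lee_fin sqrtr_ge0.
have psiE : inner Q (@PhiS R n (c 1)) - inner Q (@PhiS R n (c 0)) = inner Q Q.
  have symc t : 0 <= t <= 1 -> (c t)^T = c t by move=> /c0[].
  rewrite !PhiS_id; [|by apply: symc; rewrite lexx ler01..].
  have := inner_lincomb Q (Phi (c 1)) (Phi (c 0)) 1 (-1).
  by rewrite scale1r scaleN1r mul1r mulN1r => <-.
rewrite psiE -{1}(sqr_sqrtr (inner_ge0 QHD)) expr2 EFinM.
(* One factor of the chord length cancels; for a zero chord the claim is that lengths are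
   nonnegative. *)
move: N0; rewrite le_eqVlt => /orP[/eqP <- _ //|N0].
by rewrite lee_pmul2l.
Qed.

End LengthBound.

(** * The geodesic distance and the resulting description of geodesics *)

Section Distance.
Context {R : realType} {n : nat}.
Implicit Types X Y : 'M[R]_n.

Lemma line_combE (V : lmodType R) (x y : V) (t : R) :
  (1 - t) *: x + t *: y = t *: (y - x) + x.
Proof. by rewrite scalerBl scale1r scalerBr addrC addrA addrAC. Qed.

Lemma riem_distE X Y (q := Phi Y - Phi X) : SPD X -> SPD Y ->
  riem_dist SPD gext X Y = (Num.sqrt (inner q q))%:E.
Proof.
move=> X0 Y0; have XHD := Phi_HolDiag X0; have YHD := Phi_HolDiag Y0.
apply/eqP; rewrite eq_le; apply/andP; split.
  rewrite -(straight_length XHD YHD); apply: ereal_inf_lbound.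
  exists (straight (Phi X) (Phi Y)) => //; split.
  - exact: straight_admissible.
  - by rewrite straightE// scale0r add0r PhiK.
  - by rewrite straightE// scale1r subrK PhiK.
apply: le_ereal_inf_tmp => _ [c [cadm c0 c1] <-].
by have := length_lower_bound cadm; rewrite c0 c1.
Qed.

End Distance.

Theorem corollary4p32 (R : realType) (n : nat) (Sigma0 Sigma1 : 'M[R]_n)
    (hSigma0 : SPD Sigma0) (hSigma1 : SPD Sigma1) :
  let S0 := (Phi Sigma0).1 in
  let S1 := (Phi Sigma1).1 in
  let Delta0 := (Phi Sigma0).2 in
  let Delta1 := (Phi Sigma1).2 in
  let S_ (t : R) := (1 - t) *: S0 + t *: S1 in
  let Delta_ (t : R) := (1 - t) *: Delta0 + t *: Delta1 in
  let gamma (t : R) :=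
    Phi_inv ((1 - t) *: (S0, Delta0) + t *: (S1, Delta1)) in
  [/\ forall t : R, 0 <= t <= 1 ->
        gamma t = expm (S_ t + calD (S_ t) + Delta_ t),
      minimizing_geodesic SPD Sym gext gamma Sigma0 Sigma1 /\
      (forall c : R -> 'M[R]_n,
        minimizing_geodesic SPD Sym gext c Sigma0 Sigma1 ->
        forall t : R, 0 <= t <= 1 -> c t = gamma t),
      (riem_dist SPD gext Sigma0 Sigma1 ^+ 2)%E =
        (frobenius (S1 - S0) ^+ 2 + frobenius (Delta1 - Delta0) ^+ 2)%:E,
      Cor Sigma0 -> Cor Sigma1 ->
        [/\ Delta0 = 0, Delta1 = 0
          & forall t : R, 0 <= t <= 1 -> Cor (gamma t)]
    & totally_geodesic (SPD : set 'M[R]_n) Sym gext Cor Hol].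
Proof.
move=> S0 S1 D0 D1 S_ Delta_ gamma.
have HD0 := Phi_HolDiag hSigma0; have HD1 := Phi_HolDiag hSigma1.
have HD t : HolDiag ((1 - t) *: Phi Sigma0 + t *: Phi Sigma1).
  exact: HolDiag_comb.
have pairE (p q : 'M[R]_n * 'M[R]_n) t :
    (1 - t) *: (p.1, p.2) + t *: (q.1, q.2) = (1 - t) *: p + t *: q.
  by case: p q => ? ? [].
have gammaPsi t : gamma t = Psi ((1 - t) *: Phi Sigma0 + t *: Phi Sigma1).
  exact: (etrans (congr1 Phi_inv (pairE _ _ t)) (Phi_invE (HD t))).
(* Equality as functions on all of [R], so that the C2 property outside [0, 1] is inherited too. *)
have gammaE : gamma = straight (Phi Sigma0) (Phi Sigma1).
  apply/funext => t; apply: (etrans (gammaPsi t)).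
  exact: (etrans (congr1 Psi (line_combE _ _ _)) (esym (straightE HD0 HD1 t))).
have gammaPhi t : SPD (gamma t) /\ Phi (gamma t) = (1 - t) *: Phi Sigma0 + t *: Phi Sigma1.
  by have [P0 PE] := PsiK (HD t); rewrite gammaPsi.
have gamma0 : gamma 0 = Sigma0.
  by rewrite gammaE straightE// scale0r add0r PhiK.
have gamma1 : gamma 1 = Sigma1.
  by rewrite gammaE straightE// scale1r subrK PhiK.
split.
- by move=> t _; exact: gammaPsi.
- split=> [|c [cg c0 c1 _] t t01].
    split => //; first by rewrite gammaE; exact: straight_geodesic.
    by rewrite riem_distE// gammaE; exact: straight_length.
  have ct0 : SPD (c t) by have [_ /(_ t t01)[]] := cg.
  (* [Psi] recovers a point of [SPD] from its chart image, and [Phi_geodesic] determines that image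
     by the end points. *)
  rewrite -(PhiK ct0) gammaPsi; congr Psi.
  by rewrite (Phi_geodesic cg t01) c0 c1.
- rewrite riem_distE// -EFin_expe sqr_sqrtr; last exact: inner_ge0 (HolDiagB HD1 HD0).
  by rewrite (inner_HolDiag (HolDiagB HD1 HD0)).
- move=> /(Cor_Phi hSigma0) Z0 /(Cor_Phi hSigma1) Z1.
  split; [exact: Z0|exact: Z1|move=> t _].
  have [g0 gP] := gammaPhi t; apply/(Cor_Phi g0); apply: (etrans (congr1 snd gP)).
  apply: (etrans (congr2 (fun A B => (1 - t) *: A + t *: B) Z0 Z1)).
  by rewrite !scaler0 addr0.
- exact: totally_geodesic_Cor.
Qed.
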